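(* There is a real number $B_4$ with $|B_4-2.60|\le 0.01$ such that the following holds for every $L>2\pi/\sqrt{B_4}$. For every $\lambda>0$, the set $S_{L,\lambda}$ is nonempty and is stable in the following sense: for every $\epsilon>0$ there exists $\delta>0$ such that if $u_0\in L^2_{\rm per}(0,L)$ satisfies $d(u_0,S_{L,\lambda})<\delta$, then the solution $u(x,t)$ of $u_t=-i\nabla H_L(u)$ with initial data $u(\cdot,0)=u_0$ satisfies $d(u(\cdot,t),S_{L,\lambda})<\epsilon$ for all $t\ge0$. Here $d(u,S_{L,\lambda})=\inf_{\phi\in S_{L,\lambda}}\|u-\phi\|_{L^2_{\rm per}(0,L)}$.
   Context: For $L>0$, $L^2_{\rm per}(0,L)$ is the space of complex-valued measurable functions on $\mathbb R$ that are $L$-periodic and square-integrable on $[0,L]$, with $\|u\|^2_{L^2_{\rm per}(0,L)}=\int_0^L|u|^2\,dx$ and real inner product $\langle u,v\rangle=\Re\int_0^L u\bar v\,dx$. Let $\mathcal F_Lu[n]=\frac1L\int_0^Le^{-i(2\pi n/L)x}u(x)\,dx$ for $n\in\mathbb Z$. For $t\in\mathbb R$, the operator $T^L_t$ on $L^2_{\rm per}(0,L)$ is defined by $\mathcal F_L(T^L_tu)[n]=e^{-i(2\pi n/L)^2t}\mathcal F_Lu[n]$. Define $H_L(u)=-\frac{2\pi}{L}\int_0^L\int_0^1|T^L_tu(x)|^4\,dt\,dx$ and $P(u)=\frac12\int_0^L|u|^2\,dx$. The gradient $\nabla H_L(u)\in L^2_{\rm per}(0,L)$ is defined by $\lim_{\epsilon\to0}\frac{H_L(u+\epsilon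 v)-H_L(u)}{\epsilon}=\langle\nabla H_L(u),v\rangle$ for all $v\in L^2_{\rm per}(0,L)$ ($\epsilon$ real); explicitly $\nabla H_L(u)=-\frac{8\pi}{L}\int_0^1T^L_{-t}\big(|T^L_tu|^2T^L_tu\big)\,dt$. The periodic DMNLS equation is $u_t=-i\nabla H_L(u)$; it is (known to be) globally well-posed in $L^2_{\rm per}(0,L)$: for each $u_0\in L^2_{\rm per}(0,L)$ there is a unique global strong solution with $u(\cdot,0)=u_0$, and $H_L$ and $P$ are conserved along solutions. $S_{L,\lambda}$ denotes the set of all $\phi\in L^2_{\rm per}(0,L)$ with $P(\phi)=\lambda$ and $H_L(\phi)=\inf\{H_L(u):u\in L^2_{\rm per}(0,L),\ P(u)=\lambda\}$ (the ground-state profiles). *)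

(* Defs.v *)
From HB Require Import structures.
From mathcomp Require Import all_boot all_order all_algebra.
From mathcomp Require Export complex.
From mathcomp Require Import all_classical all_reals all_analysis.
Import Order.TTheory GRing.Theory Num.Theory.
Import numFieldNormedType.Exports.

Set Implicit Arguments.
Unset Strict Implicit.
Unset Printing Implicit Defensive.

Local Open Scope classical_set_scope.
Local Open Scope complex_scope.
Local Open Scope ring_scope.

Section DMNLS.
Context {R : realType}.
Local Notation mu := (@lebesgue_measure R).
Implicit Types (L t lambda : R) (u v g phi : R -> R[i]) (S : set (R -> R[i])).

Definition expi (theta : R) : R[i] := cos theta +i* sin theta.

Definition cabs (z : R[i]) : R := ComplexField.Normc.normc z.

(* A map into R[i] is measurable when its real and imaginary parts are. *)
Definition cmeasurable_fun d (X : measurableType d) (f : X -> R[i]) : Prop :=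
  measurable_fun setT (fun x => complex.Re (f x)) /\
  measurable_fun setT (fun x => complex.Im (f x)).

Definition Cintegral (D : set R) (f : R -> R[i]) : R[i] :=
  (\int[mu]_(x in D) complex.Re (f x)) +i* (\int[mu]_(x in D) complex.Im (f x)).

(* Elements are functions, not classes: equality in the space L^2_per(0,L) is
   equality almost everywhere. Every class has a Borel representative. *)
Definition L2per L : set (R -> R[i]) := [set u |
  [/\ cmeasurable_fun u,
      forall x, u (x + L) = u x &
      (\int[mu]_(x in `[0%R, L]) ((cabs (u x)) ^+ 2)%:E < +oo)%E]].

Definition L2norm L u : R :=
  Num.sqrt (\int[mu]_(x in `[0, L]) (cabs (u x)) ^+ 2).

Definition L2inner L u v : R :=
  complex.Re (Cintegral `[0, L] (fun x => u x * (v x)^*%C)).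

Definition L2dist L u S : R :=
  inf [set L2norm L (fun x => u x - phi x) | phi in S].

Definition freq L (n : int) : R := 2 * pi * n%:~R / L.

Definition fourier L u (n : int) : R[i] :=
  (L^-1)%:C * Cintegral `[0, L] (fun x => expi (- (freq L n * x)) * u x).

(* W t is a representative of T^L_t u for every t. Joint measurability in (t, x)
   gives a meaning to the integral in t at fixed x in the definition of H. *)
Definition is_propagation L u (W : R -> R -> R[i]) : Prop :=
  [/\ cmeasurable_fun (fun p : R * R => W p.1 p.2),
      forall t, L2per L (W t) &
      forall t n, fourier L (W t) n =
        expi (- (freq L n ^+ 2 * t)) * fourier L u n].

Definition T L t u : R -> R[i] :=
  xget (fun _ _ => 0) [set W | is_propagation L u W] t.

Definition H L u : R :=
  - (2 * pi / L) *
  fine (\int[mu]_(x in `[0%R, L]) \int[mu]_(t in `[0%R, 1%R])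
          ((cabs (T L t u x)) ^+ 4)%:E)%E.

Definition P L u : R := 2^-1 * \int[mu]_(x in `[0, L]) (cabs (u x)) ^+ 2.

Definition is_gradH L u g : Prop :=
  L2per L g /\
  forall v, L2per L v ->
    (H L (fun x => u x + e%:C * v x) - H L u) / e @[e --> (0 : R)^']
      --> L2inner L g v.

(* The time derivative is taken in the L^2 norm, at every t; it is then
   automatically continuous in t, since the gradient of H is locally Lipschitz. *)
Definition is_solution L (u0 : R -> R[i]) (u : R -> R -> R[i]) : Prop :=
  [/\ forall t, L2per L (u t),
      {ae mu, forall x, u 0 x = u0 x} &
      forall t, exists2 g, is_gradH L (u t) g &
        L2norm L (fun x => (h^-1)%:C * (u (t + h) x - u t x) - (- 'i%C * g x))
          @[h --> (0 : R)^'] --> (0 : R)].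

Definition ground_states L lambda : set (R -> R[i]) := [set phi |
  [/\ L2per L phi, P L phi = lambda &
      (H L phi)%:E =
        ereal_inf [set (H L u)%:E | u in [set u | L2per L u /\ P L u = lambda]]]].

End DMNLS.

(* Main.v *)
From Stdlib Require Import BinInt.
Require Import Defs.
From mathcomp Require Import all_boot all_order all_algebra.
From mathcomp Require Import all_classical all_reals all_analysis.
From mathcomp Require Import measurable_realfun ssrZ ring lra zify.
Import Order.TTheory GRing.Theory Num.Theory.
Import numFieldNormedType.Exports.
Set Implicit Arguments.
Unset Strict Implicit.
Unset Printing Implicit Defensive.
Local Open Scope classical_set_scope.
Local Open Scope complex_scope.
Local Open Scope ring_scope.

(** On Fourier coefficients Q = -H / (2 pi) is a quartic form indexed
    by the parallelograms n1 + n3 = n2 + n4. Its degenerate parallelograms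
    contribute 2 m^2 - sum |c_n|^4, where m is the mass, and the oscillation in
    time damps the others by the inverse product of their sides. Hence the
    best constant M in Q(u) <= M m(u)^2 is finite, data whose coefficients are
    all small have Q close to at most 2 m^2, and two groups of far-away
    frequencies of masses a and b interact by 4ab only.

    If (2 pi / L)^2 < 2.59, then M > 2. For (2 pi / L)^2 <= 1 this is seen on
    three modes; otherwise on thirteen modes with a quadratic phase, for which
    Q - 2 m^2 reduces to a sine sum that is bounded below on a grid by integer
    arithmetic and between grid points by its Lipschitz constant.

    Since M > 2, a near-maximiser of Q at fixed mass cannot spread out, and as
    2M - 4 > 0 it cannot split in two: up to the Galilean boosts
    u -> e^{2 pi i n x / L} u, which preserve Q, near-maximisers are precompact.
    This gives ground states, and it gives their stability because the mass and
    Q are conserved. *)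

(** * Complex numbers *)

Section ComplexModulus.
Context {R : realType}.
Implicit Types (x y z : R[i]) (s : R).

(** The condition on L beyond positivity is used only to obtain M > 2. [B4] is taken at 2.59, the
    smallest value that the statement allows, so that only periods with (2 pi / L)^2 < 2.59 have to
    be treated. The number 2M - 4 is the price of splitting: M (a + b)^2 exceeds M a^2 + M b^2 + 4ab
    by (2M - 4) ab. The quartic form is explicit on finite sums only. Bounds are proved there and
    extended by Fatou's lemma, compactness is extended by truncation. [T] is an arbitrary choice
    among representatives, so H is tied to the form through the uniqueness of Fourier coefficients.
    Conservation is derived from the definition of a solution. The gradient is only a directional
    derivative, so no chain rule applies along the flow: the remainder of u(t + h) is absorbed by
    Young inequalities whose parameter is proportional to |h|. The first-order terms vanish because
    g is orthogonal to -i g and, by phase invariance of H, u is orthogonal to i g. *)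

Definition csq z : R := complex.Re z ^+ 2 + complex.Im z ^+ 2.

Lemma csq_ge0 z : 0 <= csq z.
Proof. by rewrite addr_ge0 // sqr_ge0. Qed.

Lemma cabs_ge0 z : 0 <= cabs z.
Proof. by rewrite /cabs; case: z => a b; exact: sqrtr_ge0. Qed.

Lemma cabs2 z : cabs z ^+ 2 = csq z.
Proof. by rewrite /cabs /csq; case: z => a b /=; rewrite sqr_sqrtr // addr_ge0 // sqr_ge0. Qed.

Lemma cabs4 z : cabs z ^+ 4 = csq z ^+ 2.
Proof. by rewrite -cabs2 -exprM. Qed.

Lemma cabsM x y : cabs (x * y) = cabs x * cabs y.
Proof. exact: ComplexField.Normc.normcM. Qed.

Lemma cabs_le_csq z t : 0 <= t -> csq z <= t ^+ 2 -> cabs z <= t.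
Proof. by move=> t0; rewrite -cabs2 ler_pXn2r // nnegrE cabs_ge0. Qed.

Lemma csqM x y : csq (x * y) = csq x * csq y.
Proof. by rewrite -!cabs2 cabsM exprMn. Qed.

Lemma csq0 : csq 0 = 0.
Proof. by rewrite /csq /= expr0n /= addr0. Qed.

Lemma csq_eq0 z : csq z = 0 -> z = 0.
Proof.
case: z => a b /eqP; rewrite /csq /= paddr_eq0 ?sqr_ge0 // !sqrf_eq0.
by case/andP => /eqP -> /eqP ->.
Qed.

Lemma csqN z : csq (- z) = csq z.
Proof. by case: z => a b; rewrite /csq /= !sqrrN. Qed.

Lemma csqC z : csq z^*%C = csq z.
Proof. by case: z => a b; rewrite /csq /= sqrrN. Qed.

Lemma csq_real (a : R) : csq a%:C = a ^+ 2.
Proof. by rewrite /csq /= expr0n /= addr0. Qed.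

Lemma csq_expi (a : R) : csq (expi a) = 1.
Proof. by rewrite /csq /= cos2Dsin2. Qed.

Lemma expiD (a b : R) : expi (a + b) = expi a * expi b.
Proof.
rewrite /expi cosD sinD; apply/eqP; rewrite eq_complex /=.
by apply/andP; split; apply/eqP; ring.
Qed.

Lemma expi0 : expi (0 : R) = 1.
Proof. by rewrite /expi cos0 sin0. Qed.

Lemma expiN (a : R) : expi (- a) = (expi a)^*%C.
Proof. by rewrite /expi cosN sinN. Qed.

Lemma csq_Re z : complex.Re z ^+ 2 <= csq z.
Proof. by rewrite /csq lerDl sqr_ge0. Qed.

Lemma csq_Im z : complex.Im z ^+ 2 <= csq z.
Proof. by rewrite /csq lerDr sqr_ge0. Qed.

(** The gap between the two sides is s |x - y/s|^2. The parameter stays free because continuity and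
    conservation need the factor of |x|^2 arbitrarily close to 1. *)
Lemma csqD_young s x y : 0 < s ->
  csq (x + y) <= (1 + s) * csq x + (1 + s^-1) * csq y.
Proof.
move=> s0; case: x => a b; case: y => c d; rewrite /csq /=.
have key (p q : R) : (p + q) ^+ 2 <= (1 + s) * p ^+ 2 + (1 + s^-1) * q ^+ 2.
  rewrite -subr_ge0.
  have -> : (1 + s) * p ^+ 2 + (1 + s^-1) * q ^+ 2 - (p + q) ^+ 2 =
            s * (p - s^-1 * q) ^+ 2 by field; rewrite gt_eqF.
  by rewrite mulr_ge0 ?sqr_ge0 // ltW.
by have := key a c; have := key b d; lra.
Qed.

(* With |x + y| <= |x| + |y| this is Young's inequality for each mixed term of
   (|x| + |y|)^4, the small factor s being put on |x|^4. *)
Lemma csqD_young4 s x y : 0 < s -> s <= 1 ->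
  csq (x + y) ^+ 2 <= (1 + 7 * s) * csq x ^+ 2 + 8 * s ^- 3 * csq y ^+ 2.
Proof.
move=> s0 s1.
have H := csqD_young x y s0.
have x0 := csq_ge0 x; have y0 := csq_ge0 y; have xy0 := csq_ge0 (x + y).
set a := csq x in H x0 *; set b := csq y in H y0 *; set c := csq _ in H xy0 *.
have si : 1 <= s^-1 by rewrite invf_ge1.
have s0' : 0 < s^-1 by rewrite invr_gt0.
have ss : s * s^-1 = 1 by rewrite mulfV // gt_eqF.
have c2 : c ^+ 2 <= ((1 + s) * a + (1 + s^-1) * b) ^+ 2.
  by rewrite ler_pXn2r // nnegrE (le_trans xy0 H).
have m := sqr_ge0 (s * a - s^-1 * b).
set t := s^-1 in si s0' ss H c2 m *.
have t23 : t ^+ 2 <= t ^+ 3 by rewrite [leRHS]exprSr ler_peMr // sqr_ge0.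
have cr : 2 * (1 + s) * (1 + t) * (a * b) <= 4 * s * a ^+ 2 + 4 * t ^+ 3 * b ^+ 2.
  have e : 2 * (1 + s) * (1 + t) <= 8 * t.
    have : 0 <= (1 - s) * (1 + t) by rewrite mulr_ge0 // ?subr_ge0 // addr_ge0 // ltW.
    by lra.
  have ab0 : 0 <= a * b by rewrite mulr_ge0.
  apply: (le_trans (ler_wpM2r ab0 e)).
  rewrite -subr_ge0.
  have -> : 4 * s * a ^+ 2 + 4 * t ^+ 3 * b ^+ 2 - 8 * t * (a * b) =
     4 * s * (a - t ^+ 2 * b) ^+ 2 by rewrite /t; field; rewrite gt_eqF.
  by rewrite mulr_ge0 ?sqr_ge0 // mulr_ge0 // ltW.
have e1 : (1 + s) ^+ 2 * a ^+ 2 <= (1 + 3 * s) * a ^+ 2.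
  by apply: ler_wpM2r; [exact: sqr_ge0|nra].
have e2 : (1 + t) ^+ 2 * b ^+ 2 <= 4 * t ^+ 3 * b ^+ 2.
  by apply: ler_wpM2r; [exact: sqr_ge0|nra].
rewrite -exprVn -/t; lra.
Qed.
End ComplexModulus.

(** * Square-integrable periodic functions *)

Section L2.
Context {R : realType}.
Local Notation mu := (@lebesgue_measure R).
Variable L : R.
Hypothesis L0 : 0 < L.
Local Notation D := (`[0, L]%classic : set R).
Implicit Types (u v : R -> R[i]).

Lemma measurable_csq d (X : measurableType d) (A : set X) (f : X -> R[i]) :
  cmeasurable_fun f -> measurable_fun A (fun x => csq (f x)).
Proof.
move=> [mr mi]; apply: (@measurable_funS _ _ _ _ setT) => //.
by apply: measurable_funD; apply: measurable_funX.
Qed.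

Lemma cmeasurable_funD d (X : measurableType d) (f g : X -> R[i]) :
  cmeasurable_fun f -> cmeasurable_fun g -> cmeasurable_fun (fun x => f x + g x).
Proof.
move=> [fr fi] [gr gi]; split.
- rewrite (_ : (fun x => _) = (fun x => complex.Re (f x) + complex.Re (g x))).
    exact: measurable_funD.
  by apply/funext => x; case: (f x) => a b; case: (g x).
- rewrite (_ : (fun x => _) = (fun x => complex.Im (f x) + complex.Im (g x))).
    exact: measurable_funD.
  by apply/funext => x; case: (f x) => a b; case: (g x).
Qed.

Lemma cmeasurable_funM d (X : measurableType d) (f g : X -> R[i]) :
  cmeasurable_fun f -> cmeasurable_fun g -> cmeasurable_fun (fun x => f x * g x).
Proof.
move=> [fr fi] [gr gi]; split.
- rewrite (_ : (fun x => _) = (fun x => complex.Re (f x) * complex.Re (g x)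
                                      - complex.Im (f x) * complex.Im (g x))).
    by apply: measurable_funB; apply: measurable_funM.
  by apply/funext => x; case: (f x) => a b; case: (g x).
- rewrite (_ : (fun x => _) = (fun x => complex.Re (f x) * complex.Im (g x)
                                      + complex.Im (f x) * complex.Re (g x))).
    by apply: measurable_funD; apply: measurable_funM.
  by apply/funext => x; case: (f x) => a b; case: (g x).
Qed.

Lemma cmeasurable_cst d (X : measurableType d) (z : R[i]) :
  cmeasurable_fun (fun _ : X => z).
Proof. by split; exact: measurable_cst. Qed.

Lemma cmeasurable_funB d (X : measurableType d) (f g : X -> R[i]) :
  cmeasurable_fun f -> cmeasurable_fun g -> cmeasurable_fun (fun x => f x - g x).
Proof.
move=> mf mg.
rewrite (_ : (fun x => _) = (fun x => f x + (-1) * g x)).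
  by apply: cmeasurable_funD => //; apply: cmeasurable_funM => //; exact: cmeasurable_cst.
by apply/funext => x; rewrite mulN1r.
Qed.

Lemma cmeasurable_expi d (X : measurableType d) (f : X -> R) :
  measurable_fun setT f -> cmeasurable_fun (fun x => expi (f x)).
Proof.
move=> mf; split => /=.
- by apply: (measurableT_comp _ mf); apply: continuous_measurable_fun; exact: continuous_cos.
- by apply: (measurableT_comp _ mf); apply: continuous_measurable_fun; exact: continuous_sin.
Qed.

Lemma cmeasurable_conj d (X : measurableType d) (f : X -> R[i]) :
  cmeasurable_fun f -> cmeasurable_fun (fun x => (f x)^*%C).
Proof.
move=> [fr fi]; split.
- rewrite (_ : (fun x => _) = (fun x => complex.Re (f x))) //.
  by apply/funext => x; case: (f x).
- rewrite (_ : (fun x => _) = (fun x => - complex.Im (f x))).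
    exact: measurable_funN.
  by apply/funext => x; case: (f x).
Qed.

Lemma cmeasurable_sum d (X : measurableType d) I (s : seq I) (f : I -> X -> R[i]) :
  (forall i, cmeasurable_fun (f i)) -> cmeasurable_fun (fun x => \sum_(i <- s) f i x).
Proof.
move=> mf; elim: s => [|i s IH].
  by under eq_fun do rewrite big_nil; exact: cmeasurable_cst.
by under eq_fun do rewrite big_cons; exact: cmeasurable_funD.
Qed.

(* In the extended reals, so that no integrability is needed. *)
Definition sqn u : \bar R := (\int[mu]_(x in D) (csq (u x))%:E)%E.

Lemma L2perE u : L2per L u <->
  [/\ cmeasurable_fun u, forall x, u (x + L) = u x & (sqn u < +oo)%E].
Proof.
rewrite /L2per /= /sqn; under eq_integral do rewrite cabs2.
by [].
Qed.

Lemma sqn_ge0 u : (0 <= sqn u)%E.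
Proof. by apply: integral_ge0 => x _; rewrite lee_fin csq_ge0. Qed.

Lemma L2per_meas u : L2per L u -> cmeasurable_fun u.
Proof. by move=> /L2perE[]. Qed.

Lemma L2per_sqn u : L2per L u -> (sqn u < +oo)%E.
Proof. by move=> /L2perE[]. Qed.

Lemma L2per_fin u : L2per L u -> sqn u \is a fin_num.
Proof. by move=> /L2perE[_ _ uoo]; rewrite ge0_fin_numE // sqn_ge0. Qed.

Lemma L2normE u : L2norm L u = Num.sqrt (fine (sqn u)).
Proof. by rewrite /L2norm /Rintegral /sqn; under eq_integral do rewrite cabs2. Qed.

Lemma PE u : P L u = 2^-1 * fine (sqn u).
Proof. by rewrite /P /Rintegral /sqn; under eq_integral do rewrite cabs2. Qed.

Lemma sqn_young (s : R) u v : 0 < s -> cmeasurable_fun u -> cmeasurable_fun v ->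
  (sqn (fun x => u x + v x)%R <= (1 + s)%:E * sqn u + (1 + s^-1)%:E * sqn v)%E.
Proof.
move=> s0 mu_ mv_; rewrite /sqn.
have s1 : 0 <= 1 + s by lra.
have s2 : 0 <= 1 + s^-1 by rewrite addr_ge0 // invr_ge0 ltW.
have mc (w : R -> R[i]) : cmeasurable_fun w -> measurable_fun D (fun x => (csq (w x))%:E).
  by move=> mw; apply/measurable_EFinP; exact: measurable_csq.
rewrite -!ge0_integralZl_EFin //; try (by move=> x _; rewrite lee_fin csq_ge0); try exact: mc.
rewrite -ge0_integralD //.
- apply: ge0_le_integral => //.
  + by move=> x _; rewrite lee_fin csq_ge0.
  + by apply: mc; exact: cmeasurable_funD.
  + by apply: emeasurable_funD; apply: measurable_funeM; exact: mc.
  + by move=> x _; rewrite -!EFinM -EFinD lee_fin; exact: csqD_young.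
- by move=> x _; rewrite -EFinM lee_fin mulr_ge0 // csq_ge0.
- by apply: measurable_funeM; exact: mc.
- by move=> x _; rewrite -EFinM lee_fin mulr_ge0 // csq_ge0.
- by apply: measurable_funeM; exact: mc.
Qed.

Lemma sqnD_le u v : cmeasurable_fun u -> cmeasurable_fun v ->
  (sqn (fun x => u x + v x)%R <= 2%:E * sqn u + 2%:E * sqn v)%E.
Proof.
move=> mu_ mv_; have := sqn_young ltr01 mu_ mv_.
by rewrite invr1 (_ : 1 + 1 = 2 :> R).
Qed.

Lemma sqnZ z u : cmeasurable_fun u -> sqn (fun x => z * u x) = ((csq z)%:E * sqn u)%E.
Proof.
move=> mu_; rewrite /sqn; under eq_integral do rewrite csqM EFinM.
rewrite ge0_integralZl_EFin ?csq_ge0 //.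
- by move=> x _; rewrite lee_fin csq_ge0.
- by apply/measurable_EFinP; exact: measurable_csq.
Qed.

Lemma sqnN u : sqn (fun x => - u x) = sqn u.
Proof. by rewrite /sqn; under eq_integral do rewrite csqN. Qed.

Lemma L2perD u v : L2per L u -> L2per L v -> L2per L (fun x => u x + v x).
Proof.
move=> Lu Lv; move: (Lu) (Lv) => /L2perE[mu_ pu uoo] /L2perE[mv_ pv voo]; apply/L2perE; split.
- exact: cmeasurable_funD.
- by move=> x; rewrite pu pv.
- apply: (le_lt_trans (sqnD_le mu_ mv_)); apply: lte_add_pinfty.
    by apply: lte_mul_pinfty.
  by apply: lte_mul_pinfty.
Qed.

Lemma L2perZ z u : L2per L u -> L2per L (fun x => z * u x).
Proof.
move=> Lu; move: (Lu) => /L2perE[mu_ pu uoo]; apply/L2perE; split.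
- by apply: cmeasurable_funM => //; exact: cmeasurable_cst.
- by move=> x; rewrite pu.
- by rewrite sqnZ //; apply: lte_mul_pinfty => //; rewrite lee_fin csq_ge0.
Qed.

Lemma L2perB u v : L2per L u -> L2per L v -> L2per L (fun x => u x - v x).
Proof.
move=> Lu Lv; rewrite (_ : (fun x => _) = (fun x => u x + (-1) * v x)).
  by apply: L2perD => //; exact: L2perZ.
by apply/funext => x; rewrite mulN1r.
Qed.

Lemma L2per_sum I (s : seq I) (f : I -> R -> R[i]) :
  (forall i, L2per L (f i)) -> L2per L (fun x => \sum_(i <- s) f i x).
Proof.
move=> mf; elim: s => [|i s IH].
  under eq_fun do rewrite big_nil.
  apply/L2perE; split => //.
  by rewrite /sqn; under eq_integral do rewrite csq0; rewrite integral0.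
by under eq_fun do rewrite big_cons; exact: L2perD.
Qed.

Lemma sqn_ae u v : cmeasurable_fun u -> cmeasurable_fun v ->
  ae_eq mu D u v -> sqn u = sqn v.
Proof.
move=> mu_ mv_ uv; rewrite /sqn; apply: ge0_ae_eq_integral => //.
- by apply/measurable_EFinP; exact: measurable_csq.
- by apply/measurable_EFinP; exact: measurable_csq.
- by move=> x _; rewrite lee_fin csq_ge0.
- by move=> x _; rewrite lee_fin csq_ge0.
- by apply: filterS uv => x + Dx => /(_ Dx) ->.
Qed.

Lemma integrable_scale (a : R) (h : R -> R) : mu.-integrable D (EFin \o h) ->
  mu.-integrable D (EFin \o (fun x => a * h x)).
Proof.
move=> ih; rewrite (_ : EFin \o _ = (fun x => a%:E * (EFin \o h) x))%E //.
exact: integrableZl.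
Qed.

Lemma integrable_sub (g h : R -> R) : mu.-integrable D (EFin \o g) ->
  mu.-integrable D (EFin \o h) -> mu.-integrable D (EFin \o (fun x => g x - h x)).
Proof.
move=> ig ih; rewrite (_ : EFin \o _ = ((EFin \o g) \- (EFin \o h))%E) //.
exact: integrableB.
Qed.

Definition cintegrable (f : R -> R[i]) : Prop :=
  mu.-integrable D (EFin \o (fun x => complex.Re (f x))) /\
  mu.-integrable D (EFin \o (fun x => complex.Im (f x))).

Lemma csq_integrable u : L2per L u -> mu.-integrable D (EFin \o (fun x => csq (u x))).
Proof.
move=> /L2perE[m _ uoo]; apply/integrableP; split.
  by apply/measurable_EFinP; exact: measurable_csq.
rewrite (_ : (\int[mu]_(x in D) _)%E = sqn u) //.
by apply: eq_integral => x _; rewrite /= ger0_norm // csq_ge0.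
Qed.

Lemma cintegrable_le (f : R -> R[i]) (g : R -> R) : cmeasurable_fun f ->
  (forall x, csq (f x) <= g x ^+ 2) -> (forall x, 0 <= g x) ->
  mu.-integrable D (EFin \o g) -> cintegrable f.
Proof.
move=> [mr mi] fg g0 ig; split; apply: (le_integrable _ _ _ ig) => //.
- by apply/measurable_EFinP; exact: measurable_funTS.
- move=> x _ /=; rewrite lee_fin -(ler_pXn2r (n := 2)) // ?nnegrE //.
  by rewrite !real_normK ?num_real // (le_trans (csq_Re _)).
- by apply/measurable_EFinP; exact: measurable_funTS.
- move=> x _ /=; rewrite lee_fin -(ler_pXn2r (n := 2)) // ?nnegrE //.
  by rewrite !real_normK ?num_real // (le_trans (csq_Im _)).
Qed.

Lemma cintegrableM u v : L2per L u -> L2per L v -> cintegrable (fun x => u x * v x).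
Proof.
move=> Lu Lv; apply: (@cintegrable_le _ (fun x => csq (u x) + csq (v x))).
- by apply: cmeasurable_funM; exact: L2per_meas.
- move=> x; rewrite csqM; have := csq_ge0 (u x); have := csq_ge0 (v x); nra.
- by move=> x; rewrite addr_ge0 // csq_ge0.
- rewrite (_ : EFin \o _ = (EFin \o (fun x => csq (u x))) \+ (EFin \o (fun x => csq (v x))))%E.
    by apply: integrableD => //; exact: csq_integrable.
  by [].
Qed.

Lemma cintegrableD f g : cintegrable f -> cintegrable g -> cintegrable (fun x => f x + g x).
Proof.
move=> [fr fi] [gr gi]; split.
- rewrite (_ : EFin \o _ = (EFin \o (fun x => complex.Re (f x))) \+ (EFin \o (fun x => complex.Re (g x))))%E.
    exact: integrableD.
  by apply/funext => x /=; case: (f x) => a b; case: (g x).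
- rewrite (_ : EFin \o _ = (EFin \o (fun x => complex.Im (f x))) \+ (EFin \o (fun x => complex.Im (g x))))%E.
    exact: integrableD.
  by apply/funext => x /=; case: (f x) => a b; case: (g x).
Qed.

Lemma CintegralD f g : cintegrable f -> cintegrable g ->
  Cintegral D (fun x => f x + g x) = Cintegral D f + Cintegral D g.
Proof.
move=> [fr fi] [gr gi]; rewrite /Cintegral.
rewrite [RHS](_ : _ = (\int[mu]_(x in D) complex.Re (f x) + \int[mu]_(x in D) complex.Re (g x))
  +i* (\int[mu]_(x in D) complex.Im (f x) + \int[mu]_(x in D) complex.Im (g x))) //.
rewrite -!RintegralD //; congr (_ +i* _); apply: eq_Rintegral => x _.
- by case: (f x) => a b; case: (g x).
- by case: (f x) => a b; case: (g x).
Qed.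

Lemma cintegrableZ z f : cintegrable f -> cintegrable (fun x => z * f x).
Proof.
move=> [fr fi]; case: z => a b; split.
- rewrite (_ : EFin \o _ = (fun x => a%:E * (EFin \o (fun x => complex.Re (f x))) x
        - b%:E * (EFin \o (fun x => complex.Im (f x))) x))%E.
    by apply: integrableB => //; apply: integrableZl.
  by apply/funext => x /=; case: (f x).
- rewrite (_ : EFin \o _ = (fun x => a%:E * (EFin \o (fun x => complex.Im (f x))) x
        + b%:E * (EFin \o (fun x => complex.Re (f x))) x))%E.
    by apply: integrableD => //; apply: integrableZl.
  by apply/funext => x /=; case: (f x).
Qed.

Lemma CintegralZ z f : cintegrable f ->
  Cintegral D (fun x => z * f x) = z * Cintegral D f.
Proof.
move=> [fr fi]; case: z => a b; rewrite /Cintegral.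
rewrite [RHS](_ : _ = (a * (\int[mu]_(x in D) complex.Re (f x)) - b * (\int[mu]_(x in D) complex.Im (f x)))
  +i* (a * (\int[mu]_(x in D) complex.Im (f x)) + b * (\int[mu]_(x in D) complex.Re (f x)))) //.
rewrite -!RintegralZl // -RintegralB ?integrable_scale // -RintegralD ?integrable_scale //.
congr (_ +i* _); apply: eq_Rintegral => x _.
- by case: (f x).
- by case: (f x).
Qed.

Lemma Cintegral_sum I (s : seq I) (f : I -> R -> R[i]) : (forall i, cintegrable (f i)) ->
  cintegrable (fun x => \sum_(i <- s) f i x) /\
  Cintegral D (fun x => \sum_(i <- s) f i x) = \sum_(i <- s) Cintegral D (f i).
Proof.
move=> cf; elim: s => [|i s [IH1 IH2]].
  rewrite big_nil; under eq_fun do rewrite big_nil; split.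
    by split; exact: integrable0.
  by rewrite /Cintegral /= !Rintegral_cst // !mul0r.
rewrite big_cons; under eq_fun do rewrite big_cons; split; first exact: cintegrableD.
by rewrite CintegralD // IH2.
Qed.
End L2.

(** * Fourier coefficients and trigonometric polynomials *)

Section Fourier.
Context {R : realType}.
Local Notation mu := (@lebesgue_measure R).

Lemma is_derive_sin_scale (a x : R) : a != 0 ->
  is_derive x (1 : R) (fun y => sin (a * y) / a) (cos (a * x)).
Proof.
move=> a0.
have h : is_derive x (1 : R) (fun y => a * y) a by apply: is_derive_eq; rewrite ?scaler0 ?add0r; exact: mulr1.
have h2 : is_derive x (1 : R) (sin \o (fun y => a * y)) (cos (a * x) * a).
  exact: is_derive1_comp.
have h3 : is_derive x (1 : R) (a^-1 \*: (sin \o (fun y => a * y))) (a^-1 *: (cos (a * x) * a)).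
  exact: is_deriveZ.
rewrite (_ : (fun y => _) = (a^-1 \*: (sin \o (fun y => a * y)))); last first.
  by apply/funext => y /=; rewrite mulrC.
by apply: (is_derive_eq h3); rewrite /GRing.scale /= mulrCA mulVf // mulr1.
Qed.

Lemma is_derive_cos_scale (a x : R) : a != 0 ->
  is_derive x (1 : R) (fun y => - cos (a * y) / a) (sin (a * x)).
Proof.
move=> a0.
have h : is_derive x (1 : R) (fun y => a * y) a by apply: is_derive_eq; rewrite ?scaler0 ?add0r; exact: mulr1.
have h2 : is_derive x (1 : R) (cos \o (fun y => a * y)) (- sin (a * x) * a).
  exact: is_derive1_comp.
have h3 : is_derive x (1 : R) ((- a^-1) \*: (cos \o (fun y => a * y))) ((- a^-1) *: (- sin (a * x) * a)).
  exact: is_deriveZ.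
rewrite (_ : (fun y => _) = ((- a^-1) \*: (cos \o (fun y => a * y)))); last first.
  by apply/funext => y /=; rewrite /GRing.scale /= mulrC mulrN mulNr.
by apply: (is_derive_eq h3); rewrite /GRing.scale /= !mulNr mulrN opprK mulrCA mulVf // mulr1.
Qed.

Lemma continuous_scale_comp (f : R -> R) (a : R) : continuous f -> continuous (fun x => f (a * x)).
Proof.
move=> cf x; apply: (@continuous_comp _ _ _ (fun y => a * y) f); last exact: cf.
by apply: cvgMl_tmp; exact: cvg_id.
Qed.

Lemma Rintegral_primitive (f F : R -> R) (b : R) : 0 < b -> continuous f ->
  (forall x, is_derive x (1 : R) F (f x)) -> \int[mu]_(x in `[0, b]) f x = F b - F 0.
Proof.
move=> b0 cf dF; rewrite /Rintegral (@continuous_FTC2 _ f F) //.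
- by apply: continuous_subspaceT => x; exact: cf.
- have cF : continuous F.
    by move=> x; apply: differentiable_continuous; apply/derivable1_diffP; exact: ex_derive.
  split.
  + by move=> x _; exact: ex_derive.
  + by apply: cvg_at_right_filter; exact: cF.
  + by apply: cvg_at_left_filter; exact: cF.
- by move=> x _; rewrite derive1E; exact: derive_val.
Qed.

Lemma Rintegral_cos (a b : R) : a != 0 -> 0 < b ->
  \int[mu]_(x in `[0, b]) cos (a * x) = sin (a * b) / a.
Proof.
move=> a0 b0; have cf : continuous (fun x : R => cos (a * x)).
  by apply: continuous_scale_comp; exact: continuous_cos.
rewrite (Rintegral_primitive b0 cf (fun x => is_derive_sin_scale x a0)).
by rewrite mulr0 sin0 mul0r subr0.
Qed.

Lemma Rintegral_sin (a b : R) : a != 0 -> 0 < b ->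
  \int[mu]_(x in `[0, b]) sin (a * x) = (1 - cos (a * b)) / a.
Proof.
move=> a0 b0; have cf : continuous (fun x : R => sin (a * x)).
  by apply: continuous_scale_comp; exact: continuous_sin.
rewrite (Rintegral_primitive b0 cf (fun x => is_derive_cos_scale x a0)).
by rewrite mulr0 cos0 mulrBl mul1r !mulNr mul1r opprK addrC.
Qed.

Lemma expi_2pi (n : int) : expi (2 * pi * n%:~R : R) = 1.
Proof.
have key (m : nat) : expi (2 * pi * m%:R : R) = 1.
  elim: m => [|m IH]; first by rewrite mulr0 expi0.
  rewrite -[m.+1]addn1 natrD mulrDr expiD IH mul1r mulr1 /expi.
  by rewrite (_ : 2 * pi = pi *+ 2) ?cos2pi ?sin2pi // mulr_natl.
case: n => m; first exact: key.
rewrite NegzE mulrNz mulrN expiN (key m.+1).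
by apply/eqP; rewrite eq_complex /= oppr0 !eqxx.
Qed.

Variable L : R.
Hypothesis L0 : 0 < L.
Local Notation D := (`[0, L]%classic : set R).
Implicit Types (u v : R -> R[i]) (s : seq int) (c : int -> R[i]).

Definition efun (n : int) (x : R) : R[i] := expi (freq L n * x).

Lemma freqD m n : freq L (m + n) = freq L m + freq L n.
Proof. by rewrite /freq intrD mulrDr mulrDl. Qed.

Lemma freqN n : freq L (- n) = - freq L n.
Proof. by rewrite /freq mulrNz mulrN mulNr. Qed.

Lemma freq0 : freq L 0 = 0.
Proof. by rewrite /freq mulr0 mul0r. Qed.

Lemma efunD m n x : efun (m + n) x = efun m x * efun n x.
Proof. by rewrite /efun freqD mulrDl expiD. Qed.

Lemma efunN n x : efun (- n) x = (efun n x)^*%C.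
Proof. by rewrite /efun freqN mulNr expiN. Qed.

Lemma efun0 x : efun 0 x = 1.
Proof. by rewrite /efun freq0 mul0r expi0. Qed.

Lemma csq_efun n x : csq (efun n x) = 1.
Proof. exact: csq_expi. Qed.

Lemma efun_periodic n x : efun n (x + L) = efun n x.
Proof.
rewrite /efun mulrDr expiD (_ : freq L n * L = 2 * pi * n%:~R) ?expi_2pi ?mulr1 //.
by rewrite /freq mulfVK // gt_eqF.
Qed.

Lemma mu_D : mu D = L%:E.
Proof. by rewrite lebesgue_measure_itv /= lte_fin L0 oppr0 addr0. Qed.

Lemma efun_meas n : cmeasurable_fun (efun n).
Proof.
apply: cmeasurable_expi; apply: continuous_measurable_fun.
by apply: (continuous_scale_comp (f := id)) => x; exact: cvg_id.
Qed.

Lemma L2per_efun n : L2per L (efun n).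
Proof.
apply/L2perE; split; first exact: efun_meas.
- by move=> x; exact: efun_periodic.
- rewrite /sqn; under eq_integral do rewrite csq_efun.
  by rewrite integral_cst //= mul1e mu_D ltry.
Qed.

Lemma freq_eq0 n : (freq L n == 0) = (n == 0).
Proof.
rewrite /freq !mulf_eq0 invr_eq0 (gt_eqF L0) orbF pnatr_eq0 /= (gt_eqF (pi_gt0 R)) /=.
by rewrite intr_eq0.
Qed.

Lemma Cintegral_efun n : Cintegral D (efun n) = (if n == 0 then L else 0)%:C.
Proof.
have [->|n0] := eqVneq n 0.
  rewrite /Cintegral (@eq_Rintegral _ _ _ _ _ (cst 1)) ?Rintegral_cst //; last first.
    by move=> x _; rewrite efun0.
  rewrite (@eq_Rintegral _ _ _ _ _ (cst 0)) ?Rintegral_cst //; last first.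
    by move=> x _; rewrite efun0.
  by rewrite (_ : fine _ = L) ?mul1r ?mul0r //; exact: (congr1 fine mu_D).
have f0 : freq L n != 0 by rewrite freq_eq0.
have fL : freq L n * L = 2 * pi * n%:~R by rewrite /freq mulfVK // gt_eqF.
have /eqP := expi_2pi n; rewrite eq_complex /= => /andP[/eqP c1 /eqP s0].
by rewrite /Cintegral /= Rintegral_cos // Rintegral_sin // fL c1 s0 subrr !mul0r.
Qed.

Lemma fourierE u n : fourier L u n =
  (L^-1)%:C * Cintegral D (fun x => u x * (efun n x)^*%C).
Proof.
rewrite /fourier; congr (_ * Cintegral _ _); apply/funext => x.
by rewrite mulrC -efunN /efun freqN mulNr.
Qed.

Lemma L2per_conj u : L2per L u -> L2per L (fun x => (u x)^*%C).
Proof.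
move=> /L2perE[m p h]; apply/L2perE; split; first exact: cmeasurable_conj.
- by move=> x; rewrite p.
- by rewrite /sqn; under eq_integral do rewrite csqC.
Qed.

Lemma fourier_integrable u n : L2per L u -> cintegrable L (fun x => u x * (efun n x)^*%C).
Proof. by move=> Lu; apply: cintegrableM => //; apply: L2per_conj; exact: L2per_efun. Qed.

Lemma fourierD u v n : L2per L u -> L2per L v ->
  fourier L (fun x => u x + v x) n = fourier L u n + fourier L v n.
Proof.
move=> Lu Lv; rewrite !fourierE -mulrDr -CintegralD; try exact: fourier_integrable.
by congr (_ * Cintegral _ _); apply/funext => x; rewrite mulrDl.
Qed.

Lemma fourierZ z u n : L2per L u -> fourier L (fun x => z * u x) n = z * fourier L u n.
Proof.
move=> Lu; rewrite !fourierE mulrCA -(CintegralZ z (fourier_integrable n Lu)).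
by congr (_ * Cintegral _ _); apply/funext => x; rewrite mulrA.
Qed.

Lemma fourierB u v n : L2per L u -> L2per L v ->
  fourier L (fun x => u x - v x) n = fourier L u n - fourier L v n.
Proof.
move=> Lu Lv; have -> : (fun x => u x - v x) = (fun x => u x + (-1) * v x).
  by apply/funext => x; rewrite mulN1r.
by rewrite fourierD ?fourierZ ?mulN1r //; exact: L2perZ.
Qed.

Lemma fourier_sum I (s : seq I) (f : I -> R -> R[i]) n : (forall i, L2per L (f i)) ->
  fourier L (fun x => \sum_(i <- s) f i x) n = \sum_(i <- s) fourier L (f i) n.
Proof.
move=> Lf; rewrite fourierE.
under [in RHS]eq_bigr do rewrite fourierE.
rewrite -mulr_sumr -(Cintegral_sum _ _).2; last by move=> i; exact: fourier_integrable.
by congr (_ * Cintegral _ _); apply/funext => x; rewrite mulr_suml.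
Qed.

Lemma fourier_efun m n : fourier L (efun m) n = (m == n)%:R.
Proof.
rewrite fourierE (_ : (fun x => _) = efun (m - n)); last first.
  by apply/funext => x; rewrite efunD efunN.
rewrite Cintegral_efun subr_eq0; case: eqP => _ /=; last by rewrite mulr0.
by rewrite -rmorphM mulVf ?gt_eqF // rmorph1.
Qed.

Definition trig s c (x : R) : R[i] := \sum_(n <- s) c n * efun n x.

Lemma L2per_trig s c : L2per L (trig s c).
Proof. by apply: L2per_sum => n; apply: L2perZ; exact: L2per_efun. Qed.

Lemma fourier_trig s c n : uniq s ->
  fourier L (trig s c) n = if n \in s then c n else 0.
Proof.
move=> us; rewrite fourier_sum; last by move=> i; apply: L2perZ; exact: L2per_efun.
under eq_bigr => i _ do rewrite (fourierZ _ _ (L2per_efun i)) fourier_efun.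
case: ifPn => ns.
  rewrite (big_rem n) //= eqxx mulr1 big1_seq ?addr0 // => m /andP[_ ms].
  rewrite (_ : m == n = false) ?mulr0 //; apply/negbTE/eqP => mn.
  by move: ms; rewrite mn mem_rem_uniq // inE eqxx.
rewrite big1_seq // => m /andP[_ ms]; rewrite (_ : m == n = false) ?mulr0 //.
by apply/negbTE/eqP => mn; move: ns; rewrite -mn ms.
Qed.

Definition cip u v : R[i] := Cintegral D (fun x => u x * (v x)^*%C).

Lemma cip_trig u s c : L2per L u ->
  cip u (trig s c) = L%:C * \sum_(n <- s) fourier L u n * (c n)^*%C.
Proof.
move=> Lu; rewrite /cip (_ : (fun x => _) =
  (fun x => \sum_(n <- s) (c n)^*%C * (u x * (efun n x)^*%C))); last first.
  apply/funext => x; rewrite /trig rmorph_sum mulr_sumr; apply: eq_bigr => n _.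
  by rewrite rmorphM mulrCA mulrA.
rewrite (Cintegral_sum _ _).2; last by move=> n; apply: cintegrableZ; exact: fourier_integrable.
rewrite mulr_sumr; apply: eq_bigr => n _; rewrite CintegralZ; last exact: fourier_integrable.
rewrite fourierE mulrA mulrA -rmorphM mulfV ?gt_eqF // rmorph1 mul1r; exact: mulrC.
Qed.

Lemma Re_cipE u v : complex.Re (cip u v) = \int[mu]_(x in D) complex.Re (u x * (v x)^*%C).
Proof. by []. Qed.

Lemma csq_cip z w : csq (z - w) = csq z - 2 * complex.Re (z * w^*%C) + csq w :> R.
Proof. by case: z => a b; case: w => c d; rewrite /csq /=; ring. Qed.

Lemma sqnB_cip u v : L2per L u -> L2per L v ->
  fine (sqn L (fun x => u x - v x)) =
  fine (sqn L u) - 2 * complex.Re (cip u v) + fine (sqn L v).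
Proof.
move=> Lu Lv.
have iu := csq_integrable Lu; have iv := csq_integrable Lv.
have ic := (cintegrableM Lu (L2per_conj Lv)).1.
have ic2 := integrable_scale 2 ic.
rewrite Re_cipE -RintegralZl // /sqn -RintegralB // -RintegralD //; last first.
  exact: integrable_sub.
by apply: eq_Rintegral => x _; rewrite csq_cip.
Qed.

Lemma Re_mulconj (z : R[i]) : complex.Re (z * z^*%C) = csq z.
Proof. by case: z => a b; rewrite /csq /= ; ring. Qed.

Lemma Re_sum I (s : seq I) (f : I -> R[i]) :
  complex.Re (\sum_(i <- s) f i) = \sum_(i <- s) complex.Re (f i).
Proof.
elim: s => [|i s IH]; first by rewrite !big_nil.
by rewrite !big_cons -IH; case: (f i) => a b; case: (\sum_(j <- s) f j).
Qed.

Lemma Re_scale (a : R) z : complex.Re (a%:C * z) = a * complex.Re z.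
Proof. by case: z => b d /=; rewrite mul0r subr0. Qed.

Lemma sqn_trig s c : uniq s -> sqn L (trig s c) = (L * \sum_(n <- s) csq (c n))%:E.
Proof.
move=> us; rewrite -[LHS]fineK; last by apply: L2per_fin; exact: L2per_trig.
congr EFin; transitivity (complex.Re (cip (trig s c) (trig s c))).
  by rewrite Re_cipE /sqn; apply: eq_Rintegral => x _; rewrite Re_mulconj.
rewrite cip_trig; last exact: L2per_trig.
rewrite Re_scale Re_sum; congr (_ * _); apply: eq_big_seq => n ns.
by rewrite fourier_trig // ns Re_mulconj.
Qed.

Lemma bessel_eq u s : L2per L u -> uniq s ->
  fine (sqn L (fun x => u x - trig s (fourier L u) x)) =
  fine (sqn L u) - L * \sum_(n <- s) csq (fourier L u n).
Proof.
move=> Lu us; rewrite sqnB_cip //; last exact: L2per_trig.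
rewrite sqn_trig // cip_trig // Re_scale Re_sum.
rewrite (eq_bigr (fun n => csq (fourier L u n))); last by move=> n _; exact: Re_mulconj.
by rewrite [fine (_%:E)]/=; ring.
Qed.

Lemma bessel u s : L2per L u -> uniq s ->
  L * \sum_(n <- s) csq (fourier L u n) <= fine (sqn L u).
Proof.
move=> Lu us; rewrite -subr_ge0 -bessel_eq //.
by rewrite fine_ge0 // sqn_ge0.
Qed.
End Fourier.

(** * Uniqueness of Fourier coefficients *)

Section Uniqueness.
Context {R : realType}.
Local Notation mu := (@lebesgue_measure R).

Lemma bernoulli_ineq (y : R) (N : nat) : -1 <= y -> 1 + N%:R * y <= (1 + y) ^+ N.
Proof.
move=> y1; elim: N => [|N IH]; first by rewrite mul0r addr0 expr0.
have h : 0 <= 1 + y by lra.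
rewrite exprS; apply: le_trans (ler_wpM2l h IH).
rewrite -natr1; have : 0 <= N%:R * y ^+ 2 by rewrite mulr_ge0 ?sqr_ge0.
by nra.
Qed.

(* The polynomials of the Brosowski-Deutsch proof of the Stone-Weierstrass
   theorem: they converge to the indicator of [0, 1/2[ on [0, 1] minus 1/2. *)
Definition step_poly (n : nat) (s : R) : R := (1 - s ^+ n) ^+ (2 ^ n)%N.

Lemma step_poly_itv n s : 0 <= s <= 1 -> 0 <= step_poly n s <= 1.
Proof.
move=> /andP[s0 s1]; have sn0 : 0 <= s ^+ n by rewrite exprn_ge0.
have sn1 : s ^+ n <= 1 by rewrite exprn_ile1.
by rewrite exprn_ge0 ?subr_ge0 // exprn_ile1 // ?subr_ge0 // lerBlDr lerDl.
Qed.

(** Bernoulli gives (1 - s^n)^(2^n) >= 1 - (2s)^n, and 2s < 1. *)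
Lemma step_poly_cvg1 s : 0 <= s -> s < 2^-1 -> step_poly n s @[n --> \oo] --> (1 : R).
Proof.
move=> s0 s2.
apply: (@squeeze_cvgr _ _ _ _ (fun n => 1 - (2 * s) ^+ n) (fun=> 1)).
- near=> n; have s1 : s <= 1 by lra.
  have /andP[_ ->] : 0 <= step_poly n s <= 1 by apply: step_poly_itv; rewrite s0.
  rewrite andbT exprMn /step_poly -mulrN -natrX; apply: bernoulli_ineq.
  by rewrite lerN2 exprn_ile1.
- rewrite -[X in _ --> X]subr0; apply: cvgB; first exact: cvg_cst.
  by apply: cvg_expr; rewrite ger0_norm ?mulr_ge0 //; lra.
- exact: cvg_cst.
Unshelve. all: by end_near. Qed.

(** Multiplied by (1 + s^n)^(2^n) >= (2s)^n, the polynomial becomes (1 - s^(2n))^(2^n) <= 1; hence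
    it is at most (2s)^(-n). *)
Lemma step_poly_cvg0 s : 2^-1 < s -> s <= 1 -> step_poly n s @[n --> \oo] --> (0 : R).
Proof.
move=> s2 s1; have s0 : 0 <= s by lra.
apply: (@squeeze_cvgr _ _ _ _ (fun=> 0) (fun n => (2 * s)^-1 ^+ n)).
- near=> n.
  have /andP[-> _] : 0 <= step_poly n s <= 1 by apply: step_poly_itv; rewrite s0.
  rewrite /= exprVn -[leRHS]mul1r ler_pdivlMr ?exprn_gt0 //; last by lra.
  have sn0 : 0 <= s ^+ n by rewrite exprn_ge0.
  have sn1 : s ^+ n <= 1 by rewrite exprn_ile1.
  apply: (@le_trans _ _ (step_poly n s * (1 + s ^+ n) ^+ (2 ^ n)%N)).
    apply: ler_wpM2l; first by rewrite exprn_ge0 // subr_ge0.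
    apply: le_trans (bernoulli_ineq _ _); last by lra.
    by rewrite exprMn natrX lerDr.
  rewrite -exprMn exprn_ile1 //; first by rewrite mulr_ge0 ?subr_ge0 // addr_ge0.
  by have := sqr_ge0 (s ^+ n); lra.
- exact: cvg_cst.
- apply: cvg_expr; rewrite ger0_norm ?invr_ge0 ?mulr_ge0 //.
  by rewrite invf_lt1; lra.
Unshelve. all: by end_near. Qed.

Variable L : R.
Hypothesis L0 : 0 < L.
Local Notation D := (`[0, L]%classic : set R).

(** * Real functions orthogonal to every mode *)

Section Real.
Variable f : R -> R.
Hypothesis mf : measurable_fun setT f.
Hypothesis fi : mu.-integrable D (EFin \o f).
Hypothesis fcos : forall n : int, \int[mu]_(x in D) (f x * cos (freq L n * x)) = 0.
Hypothesis fsin : forall n : int, \int[mu]_(x in D) (f x * sin (freq L n * x)) = 0.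

(** Multipliers g for which f g is still orthogonal to every mode. The free phase a treats sines and
    cosines together, and boundedness keeps the products integrable. The class is a vector space
    stable under multiplication by modes, hence by polynomials in one of them. *)
Definition trig_null (g : R -> R) : Prop :=
  [/\ measurable_fun setT g, exists M, forall x, `|g x| <= M &
   forall (n : int) (a : R), \int[mu]_(x in D) (f x * (g x * cos (freq L n * x + a))) = 0].

Lemma integrable_fM (g : R -> R) (M : R) : measurable_fun setT g ->
  (forall x, `|g x| <= M) -> mu.-integrable D (EFin \o (fun x => f x * g x)).
Proof.
move=> mg gM.
rewrite (_ : EFin \o _ = ((EFin \o g) \* (EFin \o f))%E); last first.
  by apply/funext => x /=; rewrite -EFinM mulrC.
apply: integrableMr => //; first exact: measurable_funTS.
by exists M; split; [exact: num_real|move=> N MN x _; apply: (le_trans (gM x)); exact: ltW].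
Qed.

Lemma measurable_cos_affine (k a : R) : measurable_fun setT (fun x : R => cos (k * x + a)).
Proof.
apply: continuous_measurable_fun => x; apply: (@continuous_comp _ _ _ (fun y => k * y + a) cos).
  by apply: cvgD; [apply: cvgMl_tmp; exact: cvg_id|exact: cvg_cst].
exact: continuous_cos.
Qed.

Lemma integrable_fgcos (g : R -> R) k a : trig_null g ->
  mu.-integrable D (EFin \o (fun x => f x * (g x * cos (k * x + a)))).
Proof.
move=> [mg [M gM] _]; apply: (@integrable_fM _ M).
  by apply: measurable_funM => //; exact: measurable_cos_affine.
move=> x; rewrite normrM; apply: le_trans (gM x).
by rewrite ler_piMr // cos_max.
Qed.

Lemma trig_null1 : trig_null (cst 1).
Proof.
split; first exact: measurable_cst.
  by exists 1 => x; rewrite normr1.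
move=> n a.
have ic : mu.-integrable D (EFin \o (fun x => f x * cos (freq L n * x))).
  apply: (@integrable_fM _ 1).
    by have := measurable_cos_affine (freq L n) 0; under eq_fun do rewrite addr0.
  by move=> x; exact: cos_max.
have is_ : mu.-integrable D (EFin \o (fun x => f x * sin (freq L n * x))).
  apply: (@integrable_fM _ 1).
    have := measurable_cos_affine (freq L n) (- (pi / 2)).
    by under eq_fun do rewrite cosBpihalf.
  by move=> x; exact: sin_max.
transitivity (\int[mu]_(x in D)
    (cos a * (f x * cos (freq L n * x)) - sin a * (f x * sin (freq L n * x)))).
  by apply: eq_Rintegral => x _; rewrite /= mul1r cosD; ring.
rewrite RintegralB ?RintegralZl //; try exact: integrable_scale.
by rewrite fcos fsin !mulr0 subrr.
Qed.

Lemma trig_null_lin (a b : R) g h : trig_null g -> trig_null h ->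
  trig_null (fun x => a * g x + b * h x).
Proof.
move=> Zg Zh; move: (Zg) (Zh) => [mg [M gM] ig] [mh [N hN] ih]; split.
- by apply: measurable_funD; apply: measurable_funM => //; exact: measurable_cst.
- exists (`|a| * M + `|b| * N) => x; rewrite (le_trans (ler_normD _ _)) // !normrM.
  by rewrite lerD // ler_wpM2l.
- move=> n t.
  transitivity (\int[mu]_(x in D) (a * (f x * (g x * cos (freq L n * x + t)))
     + b * (f x * (h x * cos (freq L n * x + t))))).
    by apply: eq_Rintegral => x _ /=; ring.
  rewrite RintegralD ?RintegralZl // ?ig ?ih ?mulr0 ?addr0 //;
      try exact: integrable_fgcos; by apply: integrable_scale; exact: integrable_fgcos.
Qed.

Lemma trig_null_cos (m : int) (b : R) g : trig_null g ->
  trig_null (fun x => g x * cos (freq L m * x + b)).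
Proof.
move=> Zg; move: (Zg) => [mg [M gM] ig]; split.
- by apply: measurable_funM => //; exact: measurable_cos_affine.
- by exists M => x; rewrite normrM; apply: le_trans (gM x); rewrite ler_piMr // cos_max.
- move=> n a.
  transitivity (\int[mu]_(x in D)
      (2^-1 * (f x * (g x * cos (freq L (m + n) * x + (b + a))))
     + 2^-1 * (f x * (g x * cos (freq L (m - n) * x + (b - a)))))); last first.
    rewrite RintegralD ?RintegralZl // ?ig ?mulr0 ?addr0 //;
      try exact: integrable_fgcos; by apply: integrable_scale; exact: integrable_fgcos.
  apply: eq_Rintegral => x _ /=; rewrite !freqD freqN.
  have -> : (freq L m + freq L n) * x + (b + a) = (freq L m * x + b) + (freq L n * x + a) by ring.
  have -> : (freq L m - freq L n) * x + (b - a) = (freq L m * x + b) - (freq L n * x + a) by ring.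
  by move: (freq L m * x + b) (freq L n * x + a) => p q; rewrite cosD cosB; field.
Qed.

Section Arc.
Variable b : R.
Hypothesis b0 : 0 < b.
Hypothesis bL : b < L.

Let w := freq L 1.
(** An affine function of a single mode that stays in [0, 1], below 1/2 on ]0,
    b[ and above 1/2 on ]b, L[. Composed with [step_poly] it yields trigonometric polynomials
    tending to the indicator of the arc. *)
Definition arc_level (x : R) : R :=
  2^-1 - 4^-1 * (cos (w * x - w * b / 2) - cos (w * b / 2)).

Lemma arc_level_itv x : 0 <= arc_level x <= 1.
Proof.
rewrite /arc_level; set p := cos _; set q := cos _.
have := cos_le1 (w * x - w * b / 2); have := cos_geN1 (w * x - w * b / 2).
have := cos_le1 (w * b / 2); have := cos_geN1 (w * b / 2).
rewrite -/p -/q => *; lra.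
Qed.

Lemma trig_null_level g : trig_null g -> trig_null (fun x => g x * arc_level x).
Proof.
move=> Zg; have := trig_null_lin (2^-1 + 4^-1 * cos (w * b / 2)) (- 4^-1) Zg
  (trig_null_cos 1 (- (w * b / 2)) Zg).
by congr trig_null; apply/funext => x; rewrite /arc_level /w; ring.
Qed.

Lemma trig_null_levelX n g : trig_null g -> trig_null (fun x => g x * arc_level x ^+ n).
Proof.
elim: n => [|n IH] Zg; first by under eq_fun do rewrite expr0 mulr1.
by under eq_fun do rewrite exprSr mulrA; apply: trig_null_level; exact: IH.
Qed.

Lemma trig_null_step n m g : trig_null g ->
  trig_null (fun x => g x * (1 - arc_level x ^+ n) ^+ m).
Proof.
elim: m => [|m IH] Zg; first by under eq_fun do rewrite expr0 mulr1.
have := trig_null_lin 1 (-1) (IH Zg) (trig_null_levelX n (IH Zg)).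
by congr trig_null; apply/funext => x; rewrite exprSr; ring.
Qed.

Lemma Rintegral_step n : \int[mu]_(x in D) (f x * step_poly n (arc_level x)) = 0.
Proof.
have [_ _ /(_ 0 0) h] := trig_null_step n (2 ^ n)%N trig_null1.
rewrite -[RHS]h; apply: eq_Rintegral => x _.
by rewrite freq0 mul0r addr0 cos0 mulr1 /= mul1r.
Qed.

Lemma freq1_half : w * L / 2 = pi.
Proof. by rewrite /w /freq mulr1; field; rewrite gt_eqF. Qed.

Lemma w_gt0 : 0 < w.
Proof. by rewrite /w /freq mulr1 divr_gt0 // mulr_gt0 // pi_gt0. Qed.

(** A product form in which the sign of the deviation from 1/2 is visible: since w L / 2 = pi, the
    half angles stay where the sign of the sine is known. *)
Lemma arc_levelE x :
  arc_level x = 2^-1 - 2^-1 * (sin (w * x / 2) * sin (w * b / 2 - w * x / 2)).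
Proof.
rewrite /arc_level.
have -> : w * x - w * b / 2 = w * x / 2 - (w * b / 2 - w * x / 2) by field.
have -> : cos (w * b / 2) = cos (w * x / 2 + (w * b / 2 - w * x / 2)) by congr cos; ring.
by move: (w * x / 2) (w * b / 2 - _) => p q; rewrite cosB cosD; field.
Qed.

Lemma arc_level_in x : 0 < x < b -> arc_level x < 2^-1.
Proof.
move=> /andP[x0 xb]; rewrite arc_levelE.
have w0 := w_gt0; have wL := freq1_half.
have wxb : w * x < w * b by rewrite ltr_pM2l.
have wbL : w * b < w * L by rewrite ltr_pM2l.
have wx : 0 < w * x by rewrite mulr_gt0.
have s1 : 0 < sin (w * x / 2) by apply: sin_gt0_pi; lra.
have s2 : 0 < sin (w * b / 2 - w * x / 2) by apply: sin_gt0_pi; lra.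
by have := mulr_gt0 s1 s2; lra.
Qed.

Lemma arc_level_out x : b < x < L -> 2^-1 < arc_level x.
Proof.
move=> /andP[bx xL]; rewrite arc_levelE.
have w0 := w_gt0; have wL := freq1_half.
have wxb : w * b < w * x by rewrite ltr_pM2l.
have wbL : w * x < w * L by rewrite ltr_pM2l.
have wb : 0 < w * b by rewrite mulr_gt0.
have s1 : 0 < sin (w * x / 2) by apply: sin_gt0_pi; lra.
have s2 : 0 < sin (- (w * b / 2 - w * x / 2)) by apply: sin_gt0_pi; lra.
by rewrite sinN in s2; have := mulr_gt0 s1 s2; lra.
Qed.

Lemma measurable_arc_level : measurable_fun setT arc_level.
Proof.
apply: measurable_funB => //; apply: measurable_funM => //; apply: measurable_funB => //.
exact: measurable_cos_affine.
Qed.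

Lemma measurable_step_level n : measurable_fun setT (fun x => step_poly n (arc_level x)).
Proof.
apply: measurable_funX; apply: measurable_funB => //; apply: measurable_funX.
exact: measurable_arc_level.
Qed.

(** f is orthogonal to every [step_poly n (arc_level x)]; dominated convergence, with |f| as
    majorant, turns this into a vanishing integral over the arc. *)
Lemma Rintegral_arc : \int[mu]_(x in `[0, b]) f x = 0.
Proof.
pose F x := (f x * \1_(`]0, b[%classic : set R) x)%R.
have mstep n := measurable_step_level n.
have mF : measurable_fun setT F.
  by apply: measurable_funM => //; apply: measurable_indic.
have mfT (g : R -> R) : measurable_fun setT g -> measurable_fun D (EFin \o g).
  by move=> mg; apply/measurable_EFinP; exact: measurable_funTS.
have cv : {ae mu, forall x, D x -> (f x * step_poly n (arc_level x))%:E @[n --> \oo] --> (F x)%:E}.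
  (* At these three points the level is exactly 1/2, where the polynomials do not tend to the
     indicator. *)
  exists ([set 0] `|` [set b] `|` [set L]); split.
  - by apply: measurableU; [apply: measurableU|]; exact: measurable_set1.
  - apply: countable_lebesgue_measure0; apply: finite_set_countable.
    by rewrite !finite_setU; split => //; split.
  - move=> x; apply: contra_notP => /= /not_orP[/not_orP[x0 xb] xL].
    rewrite in_itv /= => /andP[le0x lexL].
    have {x0}lt0x : 0 < x by rewrite lt_neqAle le0x eq_sym andbT; apply/eqP.
    have {xL}ltxL : x < L by rewrite lt_neqAle lexL andbT; apply/eqP.
    apply: cvg_EFin; first by near=> n.
    apply: cvgM; first exact: cvg_cst.
    have /andP[a0 a1] := arc_level_itv x.
    have [xltb|bltx|//] := ltgtP x b.
    + rewrite indicE mem_set /=; last by rewrite in_itv /= lt0x.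
      by apply: step_poly_cvg1 => //; apply: arc_level_in; rewrite lt0x.
    + rewrite indicE memNset /=; last by rewrite in_itv /= lt0x ltNge (ltW bltx).
      by apply: step_poly_cvg0 => //; apply: arc_level_out; rewrite bltx.
have bnd : {ae mu, forall x n, D x -> (`|(f x * step_poly n (arc_level x))%:E| <= (`|f x|)%:E)%E}.
  apply: aeW => x n _; rewrite lee_fin normrM ler_piMr //.
  have /andP[p0 p1] := step_poly_itv n (arc_level_itv x).
  by rewrite ger0_norm.
have [_ _ h] := @dominated_convergence _ _ _ mu D (measurable_itv _)
  (fun n x => (f x * step_poly n (arc_level x))%:E) (EFin \o F) (fun x => `|f x|%:E)
  (fun n => mfT _ (measurable_funM mf (mstep n))) (mfT _ mF) cv (integrable_norm fi) bnd.
have h0 : (\int[mu]_(x in D) (F x)%:E = 0)%E.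
  apply: (@cvg_unique _ (@ereal_hausdorff R) _ _ _ _ h).
  rewrite (_ : (fun _ => _) = (fun=> 0%E)); first exact: cvg_cst.
  apply/funext => n /=; have := Rintegral_step n.
  rewrite /Rintegral => h1; rewrite -[LHS]fineK ?h1 //.
  apply: integrable_fin_num => //; apply: (@integrable_fM _ 1) => // x.
  by have /andP[p0 p1] := step_poly_itv n (arc_level_itv x); rewrite ger0_norm.
suff : (\int[mu]_(x in `[0%R, b]) (f x)%:E = \int[mu]_(x in D) (F x)%:E)%E.
  by rewrite h0 /Rintegral => ->.
rewrite integral_itv_bndoo; last by apply/measurable_EFinP; exact: measurable_funTS.
have -> : `]0, b[%classic = D `&` `]0, b[%classic.
  apply/esym/setIidPr => x /=; rewrite !in_itv /= => /andP[x0 xb].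
  by rewrite (ltW x0) ltW // (lt_trans xb).
rewrite integral_mkcondr; apply: eq_integral => x _.
by rewrite /F indicE /patch; case: (x \in _); rewrite ?mulr1 ?mulr0.
Unshelve. all: by end_near. Qed.
End Arc.

Lemma ae_not_countable (A : set R) : countable A -> {ae mu, forall x, ~ A x}.
Proof.
move=> cA; exists A; split; first exact: countable_measurable.
  exact: countable_lebesgue_measure0.
by move=> x /= /contrapT.
Qed.

(** The primitive of f vanishes on ]0, L[, and Lebesgue differentiation recovers f almost
    everywhere. *)
Lemma trig_null_ae0 : ae_eq mu D f (cst 0).
Proof.
pose g := f \_ D.
have ig : mu.-integrable setT (EFin \o g).
  by have := fi; rewrite integrable_mkcond // restrict_EFin.
have igy y : mu.-integrable [set` Interval (BLeft 0) (BRight y)] (EFin \o g).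
  by apply: integrableS ig.
have lg : locally_integrable setT g.
  split; [|exact: openT|].
  - by apply/measurable_EFinP; exact: measurable_int ig.
  - move=> K _ cK; have /integrableP[mg gfin] := ig.
    apply: le_lt_trans gfin; apply: ge0_subset_integral => //.
    + by apply: closed_measurable; apply: compact_closed cK; exact: Rhausdorff.
    + by rewrite (_ : (fun x => _) = (abse \o (EFin \o g))) //; exact: measurableT_comp.
have cfin : countable [set 0; L].
  by apply: finite_set_countable; rewrite finite_setU.
have := FTC1 igy lg; have := ae_not_countable cfin.
apply: (@filterS2 _ (almost_everywhere mu)) => x nx hx Dx.
have [x0 xL] : 0 < x /\ x < L.
  move: Dx; rewrite /= in_itv /= => /andP[x0 xL]; split.
    by rewrite lt_neqAle x0 andbT; apply/eqP => e; apply: nx; left.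
  by rewrite lt_neqAle xL andbT; apply/eqP => e; apply: nx; right.
move: hx => /=; rewrite (@lte_fin R) => /(_ x0)[_].
rewrite /g patchE mem_set // => <-.
rewrite derive1E (@near_eq_derive _ _ _ _ (cst 0)) ?derive_cst //; near=> y.
have y0 : 0 < y by near: y; exact: lt_nbhsr.
have yL : y < L by near: y; exact: lt_nbhsl.
rewrite -[RHS](Rintegral_arc y0 yL); apply: eq_Rintegral => z.
rewrite inE /= in_itv /= => /andP[z0 zy]; rewrite /g patchE mem_set //= in_itv /= z0.
by rewrite (le_trans zy) // ltW.
Unshelve. all: by end_near. Qed.
End Real.

Lemma Cintegral_fourier0 u : (forall n, fourier L u n = 0) ->
  forall n, Cintegral D (fun x => u x * (efun L n x)^*%C) = 0.
Proof.
move=> h n; have /eqP := h n; rewrite fourierE mulf_eq0 => /orP[|/eqP //].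
by rewrite eq_complex /= invr_eq0 (gt_eqF L0).
Qed.

Lemma Re_Cintegral (g : R -> R[i]) :
  complex.Re (Cintegral D g) = \int[mu]_(x in D) complex.Re (g x).
Proof. by []. Qed.

Lemma Im_Cintegral (g : R -> R[i]) :
  complex.Im (Cintegral D g) = \int[mu]_(x in D) complex.Im (g x).
Proof. by []. Qed.

Lemma conj_efunN n x : (efun L (- n) x)^*%C = efun L n x.
Proof. by rewrite -efunN opprK. Qed.

(** Sums and differences of the coefficients at n and -n isolate the integrals of u against cosines
    and sines; their real and imaginary parts reduce the claim to two real functions. *)
Lemma fourier_uniq u : L2per L u -> (forall n, fourier L u n = 0) -> ae_eq mu D u (cst 0).
Proof.
move=> Lu /Cintegral_fourier0 h.
have [mr mi] := L2per_meas Lu.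
have [ir ii] : cintegrable L u.
  have := fourier_integrable L0 0 Lu; congr (cintegrable _ _); apply/funext => x.
  by rewrite efun0 rmorph1 mulr1.
have Ic n : Cintegral D (fun x => u x * ((efun L n x)^*%C + (efun L (- n) x)^*%C)) = 0.
  rewrite (_ : (fun x => _) = (fun x => u x * (efun L n x)^*%C + u x * (efun L (- n) x)^*%C)); last first.
    by apply/funext => x; rewrite mulrDr.
  by rewrite CintegralD ?h ?addr0 //; exact: fourier_integrable.
have Is n : Cintegral D (fun x => u x * ((efun L n x)^*%C - (efun L (- n) x)^*%C)) = 0.
  rewrite (_ : (fun x => _) = (fun x => u x * (efun L n x)^*%C + (-1) * (u x * (efun L (- n) x)^*%C))); last first.
    by apply/funext => x; rewrite mulrBr mulN1r.
  rewrite CintegralD ?CintegralZ ?h ?mulr0 ?addr0 //; try exact: fourier_integrable.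
  by apply: cintegrableZ; exact: fourier_integrable.
have half (g : R -> R) : mu.-integrable D (EFin \o g) ->
    \int[mu]_(x in D) (2 * g x) = 0 -> \int[mu]_(x in D) g x = 0.
  by move=> ig; rewrite RintegralZl // => /eqP; rewrite mulf_eq0 pnatr_eq0 /= => /eqP.
have ic (g : R -> R) n : measurable_fun setT g -> mu.-integrable D (EFin \o g) ->
    mu.-integrable D (EFin \o (fun x => g x * cos (freq L n * x))).
  move=> mg ig; apply: (integrable_fM ig (M := 1)); last by move=> x; exact: cos_max.
  by have := measurable_cos_affine (freq L n) 0; under eq_fun do rewrite addr0.
have is_ (g : R -> R) n : measurable_fun setT g -> mu.-integrable D (EFin \o g) ->
    mu.-integrable D (EFin \o (fun x => g x * sin (freq L n * x))).
  move=> mg ig; apply: (integrable_fM ig (M := 1)); last by move=> x; exact: sin_max.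
  have := measurable_cos_affine (freq L n) (- (pi / 2)).
  by under eq_fun do rewrite cosBpihalf.
have rC n : \int[mu]_(x in D) (complex.Re (u x) * cos (freq L n * x)) = 0.
  apply: half; first exact: ic.
  have /eqP := Ic n; rewrite eq_complex => /andP[/eqP e _]; rewrite -[RHS]e ?Re_Cintegral ?Im_Cintegral.
  apply: eq_Rintegral => x _; rewrite conj_efunN /efun /expi; case: (u x) => p q /=; ring.
have iC n : \int[mu]_(x in D) (complex.Im (u x) * cos (freq L n * x)) = 0.
  apply: half; first exact: ic.
  have /eqP := Ic n; rewrite eq_complex => /andP[_ /eqP e]; rewrite -[RHS]e ?Re_Cintegral ?Im_Cintegral.
  apply: eq_Rintegral => x _; rewrite conj_efunN /efun /expi; case: (u x) => p q /=; ring.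
have iS n : \int[mu]_(x in D) (complex.Im (u x) * sin (freq L n * x)) = 0.
  apply: half; first exact: is_.
  have /eqP := Is n; rewrite eq_complex => /andP[/eqP e _]; rewrite -[RHS]e ?Re_Cintegral ?Im_Cintegral.
  apply: eq_Rintegral => x _; rewrite conj_efunN /efun /expi; case: (u x) => p q /=; ring.
have rS n : \int[mu]_(x in D) (complex.Re (u x) * sin (freq L n * x)) = 0.
  apply: half; first exact: is_.
  have /eqP := Is (- n); rewrite eq_complex => /andP[_ /eqP e]; rewrite -[RHS]e ?Re_Cintegral ?Im_Cintegral.
  apply: eq_Rintegral => x _; rewrite conj_efunN conj_efunN -conj_efunN efunN /efun /expi; case: (u x) => p q /=; ring.
have := trig_null_ae0 mr ir rC rS; have := trig_null_ae0 mi ii iC iS.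
apply: (@filterS2 _ (almost_everywhere mu)) => x h1 h2 Dx; move: (h1 Dx) (h2 Dx).
by case: (u x) => p q /= -> ->.
Qed.
End Uniqueness.

(** * Fast convergence in the mean *)

Section FastLimit.
Context {R : realType}.
Local Notation mu := (@lebesgue_measure R).

Lemma aeS (P Q : R -> Prop) : {ae mu, forall x, P x} ->
  (forall x, P x -> Q x) -> {ae mu, forall x, Q x}.
Proof. by move=> aP PQ; apply: (@filterS _ (almost_everywhere mu)) aP. Qed.

Lemma limn_einf_le (u : (\bar R)^nat) (e : \bar R) :
  (forall n, (u n <= e)%E) -> (limn_einf u <= e)%E.
Proof.
move=> ue; rewrite limn_einf_lim; apply: lime_le; first exact: is_cvg_einfs.
apply: nearW => n; apply: le_trans (ue n); apply: ereal_inf_lbound.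
by exists n => /=.
Qed.

Lemma measurable_limn_einf (D : set R) (g : nat -> R -> \bar R) :
  (forall n, measurable_fun D (g n)) -> measurable_fun D (fun x => limn_einf (g ^~ x)).
Proof.
move=> mg.
have m1 : measurable_fun D (fun x => limn_esup (fun n => - g n x)%E).
  apply: measurable_fun_limn_esup => n.
  rewrite (_ : (fun x => _) = (fun x => 0 - g n x)%E); first exact: emeasurable_funB.
  by apply/funext => x; rewrite sub0e.
rewrite (_ : (fun x => _) = (fun x => 0 - limn_esup (fun n => - g n x))%E).
  by apply: emeasurable_funB.
by apply/funext => x; rewrite sub0e.
Qed.

Lemma fatou_ae (D : set R) (g : nat -> R -> R) (h : R -> R) : measurable D ->
  (forall n, measurable_fun D (g n)) -> measurable_fun D h ->
  (forall n x, 0 <= g n x) -> (forall x, 0 <= h x) ->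
  {ae mu, forall x, D x -> g n x @[n --> \oo] --> h x} ->
  (\int[mu]_(x in D) (h x)%:E <= limn_einf (fun n => \int[mu]_(x in D) (g n x)%:E))%E.
Proof.
move=> mD mg mh g0 h0 gh.
have mgE n : measurable_fun D (fun x => (g n x)%:E) by apply/measurable_EFinP.
apply: le_trans (fatou mu mD mgE _); last by move=> n x _; rewrite lee_fin.
have ml : measurable_fun D (fun x => limn_einf (fun n => (g n x)%:E)).
  exact: measurable_limn_einf.
apply: ae_ge0_le_integral => //.
- by move=> x _; rewrite lee_fin.
- by apply/measurable_EFinP.
- move=> x _; rewrite limn_einf_lim; apply: lime_ge; first exact: is_cvg_einfs.
  by apply: nearW => n; apply: le_ereal_inf_tmp => _ [k _ <-]; rewrite lee_fin.
- apply: (aeS gh) => x + Dx => /(_ Dx) gx.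
  have : (g n x)%:E @[n --> \oo] --> (h x)%:E by apply: cvg_EFin => //; near=> n.
  by move=> /cvg_limn_einf_sup[-> _].
Unshelve. all: by end_near. Qed.

Lemma geometric_cauchy_cvg (a : nat -> R) (C : R) :
  (forall j, `|a j.+1 - a j| <= C * 2^-1 ^+ j) -> cvgn a.
Proof.
move=> h; have C0 : 0 <= C.
  by have := h 0%N; rewrite expr0 mulr1; apply: le_trans.
have : cvgn (series (telescope a)).
  apply: normed_cvg; apply: (@series_le_cvg _ _ (geometric C 2^-1)) => //.
  - by move=> n; rewrite /= normr_ge0.
  - by move=> n; rewrite /geometric /= mulr_ge0 // exprn_ge0 // invr_ge0.
  - by apply: is_cvg_geometric_series; rewrite ger0_norm ?invr_ge0 // invf_lt1 // ltr1n.
move=> ct; rewrite (_ : a = (fun n => a 0%N + series (telescope a) n)).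
  by apply: is_cvgD => //; exact: is_cvg_cst.
by apply/funext => n; rewrite -eq_sum_telescope.
Qed.

(** Upper limits give a value at every point, jointly measurable in (t, x) and periodic in x, even
    where the sequence diverges. *)
Definition climsup (a : nat -> R[i]) : R[i] :=
  fine (limn_esup (fun n => (complex.Re (a n))%:E)) +i*
  fine (limn_esup (fun n => (complex.Im (a n))%:E)).

Definition ccvg (a : nat -> R[i]) (l : R[i]) : Prop :=
  complex.Re (a n) @[n --> \oo] --> complex.Re l /\
  complex.Im (a n) @[n --> \oo] --> complex.Im l.

Lemma fine_limn_esup (a : nat -> R) : cvgn a ->
  a n @[n --> \oo] --> fine (limn_esup (fun n => (a n)%:E)).
Proof.
move=> ca; suff -> : limn_esup (fun n => (a n)%:E) = (limn a)%:E by [].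
by apply: (cvg_limn_einf_sup _).2; apply: cvg_EFin => //; near=> n.
Unshelve. all: by end_near. Qed.

Lemma ccvg_climsup (a : nat -> R[i]) : cvgn (fun n => complex.Re (a n)) ->
  cvgn (fun n => complex.Im (a n)) -> ccvg a (climsup a).
Proof. by move=> cr ci; split; exact: fine_limn_esup. Qed.

Lemma ccvg_csq (a : nat -> R[i]) (l z : R[i]) : ccvg a l ->
  csq (a n - z) @[n --> \oo] --> csq (l - z).
Proof.
move=> [cr ci]; rewrite /csq.
have Re_sub (p q : R[i]) : complex.Re (p - q) = complex.Re p - complex.Re q by case: p; case: q.
have Im_sub (p q : R[i]) : complex.Im (p - q) = complex.Im p - complex.Im q by case: p; case: q.
rewrite Re_sub Im_sub; under eq_cvg do rewrite Re_sub Im_sub.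
apply: cvgD; rewrite !expr2; (under eq_cvg do rewrite expr2); apply: cvgM;
  by apply: cvgB => //; exact: cvg_cst.
Qed.

Lemma ccvg_csq0 (a : nat -> R[i]) (l : R[i]) : ccvg a l ->
  csq (a n) @[n --> \oo] --> csq l.
Proof.
by move=> /(ccvg_csq (z := 0)); rewrite subr0; under eq_cvg do rewrite subr0.
Qed.

Lemma cmeasurable_climsup d (X : measurableType d) (f : nat -> X -> R[i]) :
  (forall n, cmeasurable_fun (f n)) -> cmeasurable_fun (fun x => climsup (f ^~ x)).
Proof.
move=> mf; split => /=.
- apply: (measurableT_comp (@fine_measurable R setT measurableT)).
  by apply: measurable_fun_limn_esup => n; apply/measurable_EFinP; exact: (mf n).1.
- apply: (measurableT_comp (@fine_measurable R setT measurableT)).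
  by apply: measurable_fun_limn_esup => n; apply/measurable_EFinP; exact: (mf n).2.
Qed.

Variable L : R.
Hypothesis L0 : 0 < L.
Local Notation D := (`[0, L]%classic : set R).

Lemma sqn_fatou (v : nat -> R -> R[i]) (u : R -> R[i]) (e : \bar R) :
  (forall n, cmeasurable_fun (v n)) -> cmeasurable_fun u ->
  {ae mu, forall x, D x -> ccvg (v ^~ x) (u x)} ->
  (forall n, (sqn L (v n) <= e)%E) -> (sqn L u <= e)%E.
Proof.
move=> mv mu_ vu ve; apply: le_trans (limn_einf_le ve).
apply: fatou_ae => //.
- by move=> n; exact: measurable_csq.
- exact: measurable_csq.
- by move=> n x; exact: csq_ge0.
- by move=> x; exact: csq_ge0.
- by apply: (aeS vu) => x + Dx => /(_ Dx) /ccvg_csq0.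
Qed.

(** Weighted by 4^(n+1), increments of squared norm at most 8^-(n+1) still have a summable integral,
    so almost everywhere |v_(n+1) - v_n| is bounded by a multiple of 2^-n. *)
Lemma fast_ae_cvg (v : nat -> R -> R[i]) : (forall n, cmeasurable_fun (v n)) ->
  (forall n, (sqn L (fun x => v n.+1 x - v n x)%R <= (8%:R^-1 ^+ n.+1)%:E)%E) ->
  {ae mu, forall x, D x -> ccvg (v ^~ x) (climsup (v ^~ x))}.
Proof.
move=> mv vn.
pose G n x := (4 ^+ n.+1 * csq (v n.+1 x - v n x))%:E.
have mG n : measurable_fun D (G n).
  apply/measurable_EFinP; apply: measurable_funM => //.
  by apply: measurable_csq; exact: cmeasurable_funB.
have G0 n x : (0 <= G n x)%E by rewrite lee_fin mulr_ge0 ?csq_ge0 // exprn_ge0.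
have iG : (\int[mu]_(x in D) (\sum_(0 <= n <oo) G n x) < +oo)%E.
  rewrite integral_nneseries //.
  apply: (@le_lt_trans _ _ (\sum_(0 <= n <oo) ((1 / (2 ^ (n + 1))%:R)%:E))%E).
    apply: lee_nneseries => [n _ _|n _]; first exact: integral_ge0.
    have mc : measurable_fun D (fun x => (csq (v n.+1 x - v n x))%:E).
      by apply/measurable_EFinP; apply: measurable_csq; exact: cmeasurable_funB.
    rewrite /G; under eq_integral do rewrite EFinM.
    rewrite ge0_integralZl_EFin ?exprn_ge0 //; last by move=> x _; rewrite lee_fin csq_ge0.
    apply: (@le_trans _ _ ((4 ^+ n.+1)%:E * (8%:R^-1 ^+ n.+1)%:E)%E).
      by apply: lee_wpmul2l; rewrite ?lee_fin ?exprn_ge0 //; exact: vn.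
    rewrite -EFinM lee_fin -exprMn addn1 natrX div1r -exprVn.
    by rewrite (_ : 4 * 8^-1 = 2^-1 :> R) //; field.
  have -> : (\sum_(0 <= n <oo) (1 / (2 ^ (n + 1))%:R : R)%:E)%E = (1 / 2 ^+ 0 : R)%:E.
    by apply/cvg_lim => //; exact: cvg_geometric_eseries_half.
  exact: ltry.
have intG : mu.-integrable D (fun x => \sum_(0 <= n <oo) G n x)%E.
  apply/integrableP; split.
    by apply: ge0_emeasurable_sum => [n x _ _|n _]; [exact: G0|exact: mG].
  apply: le_lt_trans iG; rewrite le_eqVlt; apply/orP; left; apply/eqP.
  by apply: eq_integral => x _; rewrite gee0_abs //; apply: nneseries_ge0.
have aeG : {ae mu, forall x, D x -> (\sum_(0 <= n <oo) G n x)%E \is a fin_num}.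
  by apply: integrable_ae intG.
apply: aeS aeG _ => x + Dx => /(_ Dx) Gfin.
pose S := fine (\sum_(0 <= n <oo) G n x)%E.
have S0 : 0 <= S by apply: fine_ge0; apply: nneseries_ge0.
have GS n : 4 ^+ n.+1 * csq (v n.+1 x - v n x) <= S.
  rewrite -lee_fin /S fineK //; apply: le_trans (@nneseries_lim_ge _ (G ^~ x) xpredT 0 n.+1 _) => //.
  by rewrite big_nat_recr //= leeDr // sume_ge0.
have key n : csq (v n.+1 x - v n x) <= ((1 + S) * 2^-1 ^+ n) ^+ 2.
  have p0 : 0 < (4 : R) ^+ n by rewrite exprn_gt0.
  have e : ((1 + S) * 2^-1 ^+ n) ^+ 2 * 4 ^+ n = (1 + S) ^+ 2.
    rewrite exprMn -mulrA -exprM mulnC exprM -exprMn.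
    by rewrite (_ : 2^-1 ^+ 2 * 4 = 1 :> R) ?expr1n ?mulr1 //; field.
  rewrite -(ler_pM2r p0) e; have := GS n; rewrite exprS.
  have := csq_ge0 (v n.+1 x - v n x); set c := csq _ => c0 cS.
  have : 0 <= c * 4 ^+ n by rewrite mulr_ge0 // ltW.
  by nra.
have C0 n : 0 <= (1 + S) * 2^-1 ^+ n.
  by rewrite mulr_ge0 // ?addr_ge0 // exprn_ge0 // invr_ge0.
apply: ccvg_climsup; apply: (@geometric_cauchy_cvg _ (1 + S)) => n.
- rewrite -(ler_pXn2r (n := 2)) ?nnegrE ?C0 // real_normK ?num_real //.
  apply: le_trans (key n); apply: le_trans (csq_Re _).
  by case: (v n.+1 x) => p q; case: (v n x).
- rewrite -(ler_pXn2r (n := 2)) ?nnegrE ?C0 // real_normK ?num_real //.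
  apply: le_trans (key n); apply: le_trans (csq_Im _).
  by case: (v n.+1 x) => p q; case: (v n x).
Qed.
End FastLimit.

(** * Construction of the free evolution *)

Section Wave.
Context {R : realType}.
Local Notation mu := (@lebesgue_measure R).
Variable L : R.
Hypothesis L0 : 0 < L.
Local Notation D := (`[0, L]%classic : set R).
Implicit Types (u v : R -> R[i]) (s : seq int) (c : int -> R[i]) (W : R -> R -> R[i]).

Definition zrange (N : nat) : seq int := [seq i%:Z - N%:Z | i <- iota 0 (2 * N).+1].

Lemma zrange_uniq N : uniq (zrange N).
Proof.
rewrite map_inj_uniq ?iota_uniq // => i j /(congr1 (fun z => z + N%:Z)).
by rewrite !subrK => -[].
Qed.

Lemma mem_zrange N n : (n \in zrange N) = (`|n| <= N)%N.
Proof.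
apply/mapP/idP => [[k]|nN].
  by rewrite mem_iota => kN ->; lia.
exists (absz (n + N%:Z)); last by lia.
by rewrite mem_iota; lia.
Qed.

Definition phase (t : R) (n : int) : R[i] := expi (- (freq L n ^+ 2 * t)).

Definition msum c N : R := \sum_(n <- zrange N) csq (c n).

Lemma csq_phase t n : csq (phase t n) = 1.
Proof. exact: csq_expi. Qed.

Lemma eq_trig s c c' : {in s, c =1 c'} -> trig L s c = trig L s c'.
Proof. by move=> h; apply/funext => x; apply: eq_big_seq => n /h ->. Qed.

Lemma sqn_partial_sub c M N : (N <= M)%N ->
  sqn L (fun x => trig L (zrange M) c x - trig L (zrange N) c x) =
  (L * (msum c M - msum c N))%:E.
Proof.
move=> NM; pose u := trig L (zrange M) c.
have Lu : L2per L u by exact: L2per_trig.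
have e n : n \in zrange N -> fourier L u n = c n.
  by move=> h; rewrite fourier_trig ?zrange_uniq // ifT // mem_zrange (leq_trans _ NM) // -mem_zrange.
have -> : trig L (zrange N) c = trig L (zrange N) (fourier L u).
  by apply: eq_trig => n /e.
rewrite -[LHS]fineK; last by apply: L2per_fin; apply: L2perB => //; exact: L2per_trig.
rewrite bessel_eq ?zrange_uniq // sqn_trig ?zrange_uniq // mulrBr; congr ((_ - _ * _)%:E).
by apply: eq_big_seq => n /e ->.
Qed.

Lemma msum_ge0 c N : 0 <= msum c N.
Proof. by apply: sumr_ge0 => n _; exact: csq_ge0. Qed.

Lemma msum_homo c : {homo msum c : N M / (N <= M)%N >-> N <= M}.
Proof.
move=> N M NM; have := sqn_ge0 L (fun x => trig L (zrange M) c x - trig L (zrange N) c x).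
by rewrite sqn_partial_sub // lee_fin pmulr_rge0 // subr_ge0.
Qed.

(** The mass of partial sums does not see the time, so one subsequence serves all t. *)
Lemma msum_phase c t N : msum (fun n => phase t n * c n) N = msum c N.
Proof. by apply: eq_bigr => n _; rewrite csqM csq_phase mul1r. Qed.

Lemma msum_tail c B : (forall N, msum c N <= B) -> forall e, 0 < e ->
  exists N, forall M, (N <= M)%N -> msum c M - msum c N <= e.
Proof.
move=> cB e e0.
have cv : cvgn (msum c).
  apply: nondecreasing_is_cvgn; first exact: msum_homo.
  by exists B => _ [N _ <-].
have ub N : msum c N <= limn (msum c).
  by apply: nondecreasing_cvgn_le => //; exact: msum_homo.
have : \forall N \near \oo, `|limn (msum c) - msum c N| < e.
  by move/cvgrPdist_lt : cv; exact.
case=> N _ hN; exists N => M NM; have := hN N (leqnn N); have := ub M; have := ub N.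
by move=> h1 h2; rewrite ger0_norm ?subr_ge0 // => h3; lra.
Qed.

(* A subsequence of partial sums along which the convergence is so fast that
   it holds almost everywhere, whatever the time. *)
Lemma fast_subsequence c B : (forall N, msum c N <= B) ->
  exists psi : nat -> nat, forall j M, (psi j <= M)%N ->
    L * (msum c M - msum c (psi j)) <= 8%:R^-1 ^+ j.+1.
Proof.
move=> cB.
have e0 j : 0 < L^-1 * 8%:R^-1 ^+ j.+1 :> R.
  by rewrite mulr_gt0 ?invr_gt0 // exprn_gt0 // invr_gt0.
have /choice[phi phiP] : forall j, exists N, forall M, (N <= M)%N ->
    msum c M - msum c N <= L^-1 * 8%:R^-1 ^+ j.+1.
  by move=> j; exact: msum_tail cB _ (e0 j).
exists phi => j M jM.
by rewrite -ler_pdivlMl //; exact: phiP.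
Qed.

(** Running maxima make the subsequence monotone; j <= psi j ensures that every mode is eventually
    included. *)
Lemma fast_subsequence_homo c B : (forall N, msum c N <= B) ->
  exists psi : nat -> nat, [/\ {homo psi : i j / (i <= j)%N}, forall j, (j <= psi j)%N &
  forall j M, (psi j <= M)%N -> L * (msum c M - msum c (psi j)) <= 8%:R^-1 ^+ j.+1].
Proof.
move=> /fast_subsequence[phi phiP].
exists (fun j => maxn j (\max_(i < j.+1) phi i))%N; split.
- move=> i j ij; rewrite geq_max leq_max ij /= leq_max; apply/orP; right.
  apply/bigmax_leqP => k _.
  have kj : (k < j.+1)%N by rewrite (leq_trans (ltn_ord k)).
  exact: (@leq_bigmax _ (fun i : 'I_j.+1 => phi i) (Ordinal kj)).
- by move=> j; rewrite leq_maxl.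
- move=> j M; set N := maxn _ _ => jM.
  have pN : (phi j <= N)%N.
    rewrite leq_max; apply/orP; right.
    exact: (@leq_bigmax _ (fun i : 'I_j.+1 => phi i) ord_max).
  apply: le_trans (phiP j M (leq_trans pN jM)).
  by rewrite ler_pM2l // lerB // msum_homo.
Qed.

Lemma expr8_small (e : R) : 0 < e -> exists j0, forall j, (j0 <= j)%N -> 8%:R^-1 ^+ j.+1 <= e.
Proof.
move=> e0; have : (8%:R^-1 : R) ^+ n @[n --> \oo] --> 0.
  by apply: cvg_expr; rewrite ger0_norm ?invr_ge0 // invf_lt1 // ltr1n.
move/cvgrPdist_lt => /(_ e e0)[N _ hN]; exists N => j Nj.
have := hN j.+1 (leq_trans Nj (leqnSn j)); rewrite sub0r normrN ger0_norm; first exact: ltW.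
by rewrite exprn_ge0 // invr_ge0.
Qed.

Lemma shift_cvg (a : nat -> R) (j : nat) (l : R) :
  a n @[n --> \oo] --> l -> a (j + n)%N @[n --> \oo] --> l.
Proof.
rewrite -(cvg_shiftn j); apply: cvg_trans; apply: near_eq_cvg; near=> n.
by rewrite addnC.
Unshelve. all: by end_near. Qed.

Definition partial_wave c N (t x : R) : R[i] := trig L (zrange N) (fun n => phase t n * c n) x.

Lemma partial_wave_meas c N : cmeasurable_fun (fun p : R * R => partial_wave c N p.1 p.2).
Proof.
apply: cmeasurable_sum => n; apply: cmeasurable_funM.
  apply: cmeasurable_funM; last exact: cmeasurable_cst.
  apply: cmeasurable_expi; apply: measurable_funN; apply: measurable_funM => //.
apply: cmeasurable_expi; apply: measurable_funM => //.
Qed.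

(** A pointwise [climsup] in (t, x) provides joint measurability. [sqn_fatou] then recovers the rate
    in norm at each t; square integrability follows, and the coefficients by Bessel's inequality on
    a single mode. *)
Lemma wave_exists c B : (forall N, msum c N <= B) ->
  exists (W : R -> R -> R[i]) (psi : nat -> nat),
  [/\ cmeasurable_fun (fun p : R * R => W p.1 p.2),
      forall t, L2per L (W t),
      forall t n, fourier L (W t) n = phase t n * c n,
      forall t, {ae mu, forall x, D x -> ccvg (fun j => partial_wave c (psi j) t x) (W t x)} &
      forall t j, (sqn L (fun x => W t x - partial_wave c (psi j) t x)%R <= (8%:R^-1 ^+ j.+1)%:E)%E].
Proof.
move=> cB; have [psi [hpsi psige psiP]] := fast_subsequence_homo cB.
pose w j t x := partial_wave c (psi j) t x.
have Lw j t : L2per L (w j t) by exact: L2per_trig.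
have mw j t := L2per_meas (Lw j t).
have wsub j k t : (j <= k)%N ->
    (sqn L (fun x => w k t x - w j t x)%R <= (8%:R^-1 ^+ j.+1)%:E)%E.
  move=> jk; rewrite sqn_partial_sub ?hpsi // !msum_phase lee_fin.
  by apply: psiP; exact: hpsi.
pose W t x := climsup (fun j => w j t x).
have aeW t : {ae mu, forall x, D x -> ccvg (fun j => w j t x) (W t x)}.
  by apply: fast_ae_cvg => // j; exact: wsub.
have mW t : cmeasurable_fun (W t) by exact: cmeasurable_climsup.
have Wsub t j : (sqn L (fun x => W t x - w j t x)%R <= (8%:R^-1 ^+ j.+1)%:E)%E.
  apply: (@sqn_fatou _ L (fun k x => w (j + k)%N t x - w j t x)).
  - by move=> k; exact: cmeasurable_funB.
  - exact: cmeasurable_funB.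
  - apply: aeS (aeW t) _ => x + Dx => /(_ Dx)[cr ci].
    have Re_sub (p q : R[i]) : complex.Re (p - q) = complex.Re p - complex.Re q by case: p; case: q.
    have Im_sub (p q : R[i]) : complex.Im (p - q) = complex.Im p - complex.Im q by case: p; case: q.
    split.
    + rewrite Re_sub; under eq_cvg do rewrite Re_sub.
      by apply: cvgB; [exact: (@shift_cvg (fun n => complex.Re (w n t x)))|exact: cvg_cst].
    + rewrite Im_sub; under eq_cvg do rewrite Im_sub.
      by apply: cvgB; [exact: (@shift_cvg (fun n => complex.Im (w n t x)))|exact: cvg_cst].
  - by move=> k; apply: wsub; rewrite leq_addr.
have LW t : L2per L (W t).
  apply/L2perE; split => //.
    by move=> x; rewrite /W; congr climsup; apply/funext => j; have [_ -> _] := Lw j t.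
  have -> : W t = (fun x => (W t x - w 0%N t x) + w 0%N t x) by apply/funext => x; rewrite subrK.
  have mWw : cmeasurable_fun (fun x => W t x - w 0%N t x) by exact: cmeasurable_funB.
  apply: (le_lt_trans (sqnD_le L mWw (mw 0%N t))).
  apply: lte_add_pinfty; apply: lte_mul_pinfty => //.
    exact: le_lt_trans (Wsub t 0%N) (ltry _).
  exact: L2per_sqn.
exists W, psi; split => //.
- apply: cmeasurable_climsup => j; exact: partial_wave_meas.
- move=> t n; apply/eqP; rewrite -subr_eq0; apply/eqP; apply: csq_eq0.
  have small e : 0 < e -> L * csq (fourier L (W t) n - phase t n * c n) <= e.
    move=> e0.
    have [j [nj je]] : exists j, (n \in zrange (psi j)) /\ 8%:R^-1 ^+ j.+1 <= e :> R.
      have [j0 hj0] := expr8_small e0.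
      exists (maxn j0 `|n|%N); split; last by apply: hj0; rewrite leq_maxl.
      by rewrite mem_zrange (leq_trans _ (psige _)) // leq_maxr.
    have := bessel L0 (s := [:: n]) (L2perB (LW t) (Lw j t)) isT.
    rewrite big_seq1 fourierB // [fourier L (w j t) n]fourier_trig ?zrange_uniq // nj.
    move=> h; apply: le_trans je; apply: le_trans h _.
    by rewrite -lee_fin fineK ?Wsub //; apply: L2per_fin; exact: L2perB.
  apply/eqP; rewrite eq_le csq_ge0 andbT -(ler_pM2l L0) mulr0.
  by apply/ler_addgt0Pr => e e0; rewrite add0r; exact: small.
Qed.
End Wave.

(** * The space-time quartic integral *)

Section Propagation.
Context {R : realType}.
Local Notation mu := (@lebesgue_measure R).
Variable L : R.
Hypothesis L0 : 0 < L.
Local Notation D := (`[0, L]%classic : set R).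
Local Notation I := (`[0, 1]%classic : set R).
Implicit Types (u v : R -> R[i]) (s : seq int) (c : int -> R[i]) (W Z : R -> R -> R[i]).

Lemma msum_bessel u N : L2per L u -> msum (fourier L u) N <= L^-1 * fine (sqn L u).
Proof. by move=> Lu; rewrite ler_pdivlMl //; apply: bessel => //; exact: zrange_uniq. Qed.

Lemma propagation_exists u : L2per L u -> exists W (psi : nat -> nat),
  [/\ is_propagation L u W,
    forall t, {ae mu, forall x, D x ->
      ccvg (fun j => partial_wave L (fourier L u) (psi j) t x) (W t x)} &
    forall t j, (sqn L (fun x => W t x - partial_wave L (fourier L u) (psi j) t x)%R
                 <= (8%:R^-1 ^+ j.+1)%:E)%E].
Proof.
move=> Lu.
have [W [psi [mW LW fW aeW sW]]] := wave_exists L0 (fun N => msum_bessel N Lu).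
by exists W, psi; split.
Qed.

Lemma T_propagation u : L2per L u -> is_propagation L u (fun t => T L t u).
Proof.
move=> /propagation_exists[W [psi [pW _ _]]].
exact: (xgetPex (fun _ _ => 0) (ex_intro _ W pW)).
Qed.

Lemma fourier_ae_eq u v : L2per L u -> L2per L v ->
  (forall n, fourier L u n = fourier L v n) -> ae_eq mu D u v.
Proof.
move=> Lu Lv uv.
have h : ae_eq mu D (fun x => u x - v x) (cst 0).
  apply: (fourier_uniq L0); first exact: L2perB.
  by move=> n; rewrite fourierB // uv subrr.
by apply: (aeS h) => x + Dx => /(_ Dx) /eqP; rewrite subr_eq0 => /eqP.
Qed.

(** Two representatives differ at each time on a null set only: quantities built on [T] do not
    depend on the choice made by [xget]. *)
Lemma propagation_ae u W Z : is_propagation L u W -> is_propagation L u Z ->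
  forall t, ae_eq mu D (W t) (Z t).
Proof.
move=> [_ LW fW] [_ LZ fZ] t; apply: fourier_ae_eq => // n.
by rewrite fW fZ.
Qed.

Lemma propagationD u v W Z : L2per L u -> L2per L v ->
  is_propagation L u W -> is_propagation L v Z ->
  is_propagation L (fun x => u x + v x) (fun t x => W t x + Z t x).
Proof.
move=> Lu Lv [mW LW fW] [mZ LZ fZ]; split.
- exact: cmeasurable_funD.
- by move=> t; exact: L2perD.
- by move=> t n; rewrite !fourierD // fW fZ mulrDr.
Qed.

Lemma propagationZ z u W : L2per L u -> is_propagation L u W ->
  is_propagation L (fun x => z * u x) (fun t x => z * W t x).
Proof.
move=> Lu [mW LW fW]; split.
- by apply: cmeasurable_funM => //; exact: cmeasurable_cst.
- by move=> t; exact: L2perZ.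
- by move=> t n; rewrite !fourierZ // fW mulrCA.
Qed.

Lemma propagation_trig s c : uniq s ->
  is_propagation L (trig L s c) (fun t => trig L s (fun n => phase L t n * c n)).
Proof.
move=> us; split.
- apply: cmeasurable_sum => n; apply: cmeasurable_funM.
    apply: cmeasurable_funM; last exact: cmeasurable_cst.
    by apply: cmeasurable_expi; apply: measurable_funN; apply: measurable_funM.
  by apply: cmeasurable_expi; apply: measurable_funM.
- by move=> t; exact: L2per_trig.
- by move=> t n; rewrite !fourier_trig //; case: ifP => _ //; rewrite mulr0.
Qed.

(** Set on the product space, so that Tonelli links [H], whose inner integral is in time, to the
    computation on finite sums, whose inner integral is in space. *)
Definition quart W : \bar R :=
  (\int[(mu \x mu)%E]_(p in I `*` D) (csq (W p.1 p.2) ^+ 2)%:E)%E.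

Local Notation joint W := (cmeasurable_fun (fun p : R * R => W p.1 p.2)).

Lemma measurable_csq2 d (X : measurableType d) (A : set X) (f : X -> R[i]) :
  cmeasurable_fun f -> measurable_fun A (fun x => csq (f x) ^+ 2).
Proof. by move=> mf; apply: measurable_funX; exact: measurable_csq. Qed.

Lemma tonelli_restrict (f : R * R -> R) (A B : set R) : measurable A -> measurable B ->
  measurable_fun setT f -> (forall p, 0 <= f p) ->
  (\int[(mu \x mu)%E]_(p in A `*` B) (f p)%:E =
   \int[mu]_(t in A) \int[mu]_(x in B) (f (t, x))%:E)%E /\
  (\int[(mu \x mu)%E]_(p in A `*` B) (f p)%:E =
   \int[mu]_(x in B) \int[mu]_(t in A) (f (t, x))%:E)%E.
Proof.
move=> mA mB mf f0; pose g := (fun p => (f p)%:E) \_ (A `*` B).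
have mg : measurable_fun setT g.
  apply/(measurable_restrictT _ _).1 => //; first exact: measurableX.
  by apply/measurable_EFinP; exact: measurable_funTS.
have g0 p : (0 <= g p)%E by rewrite /g patchE; case: ifP => _ //; rewrite lee_fin.
have gE t x : g (t, x) = if (t \in A) && (x \in B) then (f (t, x))%:E else 0%E.
  by rewrite /g patchE in_setX.
rewrite integral_mkcond -/g; split.
- rewrite fubini_tonelli1; [|exact: mg|exact: g0]; rewrite [RHS]integral_mkcond; apply: eq_integral => t _.
  rewrite /fubini_F patchE; case: ifPn => tA.
    rewrite [RHS]integral_mkcond; apply: eq_integral => x _.
    by rewrite gE tA patchE.
  by rewrite integral0_eq // => x _; rewrite gE (negbTE tA).
- rewrite fubini_tonelli2; [|exact: mg|exact: g0]; rewrite [RHS]integral_mkcond; apply: eq_integral => x _.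
  rewrite /fubini_G patchE; case: ifPn => xB.
    rewrite [RHS]integral_mkcond; apply: eq_integral => t _.
    by rewrite gE xB andbT patchE.
  by rewrite integral0_eq // => t _; rewrite gE (negbTE xB) andbF.
Qed.

Lemma quart_tx W : joint W ->
  (quart W = \int[mu]_(t in I) \int[mu]_(x in D) (csq (W t x) ^+ 2)%:E)%E.
Proof.
move=> mW; have mf := measurable_csq2 (A := setT) mW.
exact: (@tonelli_restrict (fun p => csq (W p.1 p.2) ^+ 2) I D
  (measurable_itv _) (measurable_itv _) mf (fun p => sqr_ge0 _)).1.
Qed.

Lemma quart_xt W : joint W ->
  (quart W = \int[mu]_(x in D) \int[mu]_(t in I) (csq (W t x) ^+ 2)%:E)%E.
Proof.
move=> mW; have mf := measurable_csq2 (A := setT) mW.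
exact: (@tonelli_restrict (fun p => csq (W p.1 p.2) ^+ 2) I D
  (measurable_itv _) (measurable_itv _) mf (fun p => sqr_ge0 _)).2.
Qed.

Lemma joint_slice W t : joint W -> cmeasurable_fun (W t).
Proof.
move=> [mr mi]; split.
- exact: (measurableT_comp mr (pair1_measurable t)).
- exact: (measurableT_comp mi (pair1_measurable t)).
Qed.

Lemma quart_ge0 W : (0 <= quart W)%E.
Proof. by apply: integral_ge0 => p _; rewrite lee_fin sqr_ge0. Qed.

Lemma quart_ae W Z : joint W -> joint Z -> (forall t, ae_eq mu D (W t) (Z t)) ->
  quart W = quart Z.
Proof.
move=> mW mZ WZ; rewrite (quart_tx mW) (quart_tx mZ); apply: eq_integral => t _.
apply: ge0_ae_eq_integral => //.
- by apply/measurable_EFinP; apply: measurable_csq2; exact: joint_slice.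
- by apply/measurable_EFinP; apply: measurable_csq2; exact: joint_slice.
- by move=> x _; rewrite lee_fin sqr_ge0.
- by move=> x _; rewrite lee_fin sqr_ge0.
- by apply: (aeS (WZ t)) => x + Dx => /(_ Dx) ->.
Qed.

Lemma quart_propagation u W Z : is_propagation L u W -> is_propagation L u Z ->
  quart W = quart Z.
Proof.
by move=> pW pZ; apply: quart_ae; [case: pW|case: pZ|exact: propagation_ae pW pZ].
Qed.

Lemma H_quart u W : L2per L u -> is_propagation L u W ->
  H L u = - (2 * pi / L) * fine (quart W).
Proof.
move=> Lu pW; have pT := T_propagation Lu.
have [jT _ _] := pT; rewrite (quart_propagation pW pT) (quart_xt jT).
apply: (congr1 (fun z => - (2 * pi / L) * fine z)); apply: eq_integral => x _; apply: eq_integral => t _.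
by rewrite cabs4.
Qed.

Lemma quart_young (s : R) W Z : 0 < s -> s <= 1 -> joint W -> joint Z ->
  (quart (fun t x => W t x + Z t x)%R <=
   (1 + 7 * s)%:E * quart W + (8 * s ^- 3)%:E * quart Z)%E.
Proof.
move=> s0 s1 mW mZ; rewrite /quart.
have a0 : 0 <= 1 + 7 * s by lra.
have b0 : 0 <= 8 * s ^- 3 by rewrite mulr_ge0 // invr_ge0 exprn_ge0 // ltW.
have mE (X : R -> R -> R[i]) : joint X -> measurable_fun (I `*` D) (fun p => (csq (X p.1 p.2) ^+ 2)%:E).
  by move=> mX; apply/measurable_EFinP; exact: measurable_csq2.
have mID : measurable (I `*` D) by apply: measurableX; exact: measurable_itv.
have p0 (X : R -> R -> R[i]) p : (0 <= (csq (X p.1 p.2 : R[i]) ^+ 2)%:E)%E by rewrite lee_fin sqr_ge0.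
rewrite -!ge0_integralZl_EFin //; try exact: mE.
rewrite -ge0_integralD //; first last.
- by apply: measurable_funeM; exact: mE.
- by move=> p _; rewrite -EFinM lee_fin mulr_ge0 // sqr_ge0.
- by apply: measurable_funeM; exact: mE.
- by move=> p _; rewrite -EFinM lee_fin mulr_ge0 // sqr_ge0.
apply: ge0_le_integral => //.
- by move=> p _; rewrite lee_fin sqr_ge0.
- by apply: (mE (fun t x => W t x + Z t x)); exact: cmeasurable_funD.
- by apply: emeasurable_funD; apply: measurable_funeM; exact: mE.
- by move=> p _; rewrite -!EFinM -EFinD lee_fin; exact: csqD_young4.
Qed.

Lemma quartZ z W : joint W -> (quart (fun t x => z * W t x)%R = (csq z ^+ 2)%:E * quart W)%E.
Proof.
move=> mW; rewrite /quart.
have mID : measurable (I `*` D) by apply: measurableX; exact: measurable_itv.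
rewrite -ge0_integralZl_EFin ?sqr_ge0 //.
- by apply: eq_integral => p _; rewrite csqM exprMn EFinM.
- by move=> p _; rewrite lee_fin sqr_ge0.
- by apply/measurable_EFinP; exact: measurable_csq2.
Qed.

(** Almost everywhere convergence is known for each t separately, so Fatou's lemma is applied in x
    and then in t. Any bound common to the partial sums passes to u. *)
Lemma quart_fatou u W (K : \bar R) : L2per L u -> is_propagation L u W ->
  (forall N, (quart (partial_wave L (fourier L u) N) <= K)%E) -> (quart W <= K)%E.
Proof.
move=> Lu pW hK; have [Z [psi [pZ aeZ _]]] := propagation_exists Lu.
rewrite (quart_propagation pW pZ); have [mZ LZ _] := pZ.
pose w j t x := partial_wave L (fourier L u) (psi j) t x.
have mw j : joint (w j) by exact: partial_wave_meas.
apply: le_trans (limn_einf_le (fun j => hK (psi j))).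
rewrite quart_tx //.
have -> : (fun j => quart (partial_wave L (fourier L u) (psi j))) =
    (fun j => \int[mu]_(t in I) \int[mu]_(x in D) (csq (w j t x) ^+ 2)%:E)%E.
  by apply/funext => j; rewrite quart_tx //; exact: mw.
have mF (X : R -> R -> R[i]) : joint X -> measurable_fun I (fun t => \int[mu]_(x in D) (csq (X t x) ^+ 2)%:E)%E.
  move=> mX; apply: measurable_funTS.
  pose g := (fun p : R * R => (csq (X p.1 p.2) ^+ 2)%:E) \_ (setT `*` D).
  have mg : measurable_fun setT g.
    apply/(measurable_restrictT _ _).1 => //; first exact: measurableX.
    by apply/measurable_EFinP; exact: measurable_csq2.
  have g0 p : (0 <= g p)%E by rewrite /g patchE; case: ifP => _ //; rewrite lee_fin sqr_ge0.
  have := @measurable_fun_fubini_tonelli_F _ _ _ _ _ mu g mg g0.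
  congr (measurable_fun _ _); apply/funext => t; rewrite /fubini_F [RHS]integral_mkcond.
  by apply: eq_integral => x _; rewrite /g !patchE in_setX in_setT.
apply: (@le_trans _ _ (\int[mu]_(t in I) limn_einf (fun j => \int[mu]_(x in D) (csq (w j t x) ^+ 2)%:E))%E); last first.
  apply: fatou => //; first by move=> j; exact: mF.
  by move=> j t _; apply: integral_ge0 => x _; rewrite lee_fin sqr_ge0.
apply: ge0_le_integral => //.
- by move=> t _; apply: integral_ge0 => x _; rewrite lee_fin sqr_ge0.
- exact: mF.
- by apply: measurable_limn_einf => j; exact: mF.
- move=> t _; apply: fatou_ae => //.
  + by move=> j; apply: measurable_csq2; exact: joint_slice.
  + by apply: measurable_csq2; exact: joint_slice.
  + by move=> j x; exact: sqr_ge0.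
  + by move=> x; exact: sqr_ge0.
  + apply: (aeS (aeZ t)) => x + Dx => /(_ Dx) /ccvg_csq0 h.
    by rewrite expr2; under eq_cvg do rewrite expr2; exact: cvgM.
Qed.
End Propagation.

(** * Quartic sums over parallelograms *)

Section QuarticSums.
Context {R : realType}.
Implicit Types (s : seq int) (F G : int -> int -> int -> int -> R).

Definition S4 s F : R :=
  \sum_(n1 <- s) \sum_(n2 <- s) \sum_(n3 <- s) \sum_(n4 <- s) F n1 n2 n3 n4.

Lemma eq_S4 s F G : (forall n1 n2 n3 n4, F n1 n2 n3 n4 = G n1 n2 n3 n4) -> S4 s F = S4 s G.
Proof. by move=> FG; do 4 (apply: eq_bigr => ? _); exact: FG. Qed.

Lemma le_S4 s F G : (forall n1 n2 n3 n4, n1 \in s -> n2 \in s -> n3 \in s -> n4 \in s ->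
  F n1 n2 n3 n4 <= G n1 n2 n3 n4) -> S4 s F <= S4 s G.
Proof.
move=> FG; rewrite /S4 big_seq [leRHS]big_seq; apply: ler_sum => n1 h1.
rewrite big_seq [leRHS]big_seq; apply: ler_sum => n2 h2.
rewrite big_seq [leRHS]big_seq; apply: ler_sum => n3 h3.
by rewrite big_seq [leRHS]big_seq; apply: ler_sum => n4 h4; exact: FG.
Qed.

Lemma S4D s F G : S4 s (fun a b c d => F a b c d + G a b c d) = S4 s F + S4 s G.
Proof.
rewrite /S4 -big_split; apply: eq_bigr => ? _; rewrite -big_split; apply: eq_bigr => ? _.
by rewrite -big_split; apply: eq_bigr => ? _; rewrite -big_split.
Qed.

Lemma S4Z s k F : S4 s (fun a b c d => k * F a b c d) = k * S4 s F.
Proof.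
rewrite /S4 mulr_sumr; apply: eq_bigr => ? _; rewrite mulr_sumr; apply: eq_bigr => ? _.
by rewrite mulr_sumr; apply: eq_bigr => ? _; rewrite mulr_sumr.
Qed.

Lemma S4N s F : S4 s (fun a b c d => - F a b c d) = - S4 s F.
Proof. by rewrite -mulN1r -S4Z; apply: eq_S4 => *; rewrite mulN1r. Qed.

Lemma S4_cyc s F : S4 s F = S4 s (fun a b c d => F b c d a).
Proof.
rewrite /S4 [RHS]exchange_big; apply: eq_bigr => n1 _.
rewrite [RHS]exchange_big; apply: eq_bigr => n2 _.
by rewrite [RHS]exchange_big.
Qed.

Lemma ler_sum_subset (I : eqType) (s t : seq I) (f : I -> R) : uniq s ->
  {subset s <= t} -> (forall i, 0 <= f i) -> \sum_(i <- s) f i <= \sum_(i <- t) f i.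
Proof.
move=> + + f0; elim: s t => [|i s IH] t.
  by move=> _ _; rewrite big_nil sumr_ge0.
move=> /= /andP[is_ us] st; have it : i \in t by apply: st; exact: mem_head.
rewrite big_cons (big_rem i it) /= lerD2l; apply: IH => // j js.
have ji : j != i by apply: contraNneq is_ => <-.
have : j \in t by apply: st; rewrite inE js orbT.
by rewrite (perm_mem (perm_to_rem it)) inE (negbTE ji).
Qed.

(** Telescoping, from 1/n^2 <= 2/n - 2/(n+1) for n >= 1. *)
Lemma sum_invsq_nat (D : nat) (t : seq nat) : uniq t ->
  \sum_(k <- t) (D < k)%N%:R * (k%:R ^- 2) <= 2 / D.+1%:R :> R.
Proof.
move=> ut.
have [N tN] : exists N, {subset t <= iota 0 N}.
  exists (\max_(k <- t) k).+1 => k kt; rewrite mem_iota /= add0n ltnS.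
  by rewrite (big_rem k) //= leq_max leqnn.
apply: (@le_trans _ _ (\sum_(k <- iota 0 N) (D < k)%N%:R * (k%:R ^- 2))).
  by apply: ler_sum_subset => // k; rewrite mulr_ge0 ?ler0n // invr_ge0 exprn_ge0.
have key n : \sum_(k <- iota 0 n) (D < k)%N%:R * (k%:R ^- 2) <=
    2 / D.+1%:R - 2 / (maxn n D.+1)%:R :> R.
  elim: n => [|n IH]; first by rewrite big_nil max0n subrr.
  rewrite -addn1 iotaD big_cat /= big_seq1 add0n addn1.
  have [Dn|nD] := ltnP D n; last first.
    by rewrite mul0r addr0 (maxn_idPr _) ?ltnS //; move: IH; rewrite (maxn_idPr _) // ltnW.
  rewrite (maxn_idPl _) ?ltnS 1?ltnW //; move: IH; rewrite (maxn_idPl _) // => IH.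
  apply: le_trans (lerD IH (lexx _)) _; rewrite mul1r.
  have n0 : 0 < n%:R :> R by rewrite ltr0n (leq_trans _ Dn).
  have n1 : 1 <= n%:R :> R by rewrite ler1n (leq_trans _ Dn).
  have nS : n.+1%:R = n%:R + 1 :> R by rewrite -natr1.
  rewrite -subr_ge0 nS.
  have -> : 2 / D.+1%:R - 2 / (n%:R + 1) - (2 / D.+1%:R - 2 / n%:R + n%:R ^- 2) =
    (n%:R - 1) / (n%:R ^+ 2 * (n%:R + 1)) :> R.
    by field; rewrite !gt_eqF //=; lra.
  by rewrite divr_ge0 ?subr_ge0 // mulr_ge0 ?sqr_ge0 // addr_ge0.
apply: le_trans (key N) _; rewrite gerDl oppr_le0 divr_ge0 //.
Qed.

Definition idist (m n : int) : R := `|(m - n)%:~R|.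

Lemma idistC m n : idist m n = idist n m.
Proof. by rewrite /idist -normrN -mulrNz opprB. Qed.

Lemma idistE m n : idist m n = `|m - n|%N%:R.
Proof. by rewrite /idist -intr_norm -abszE. Qed.

Lemma idist_ge1 m n : m != n -> 1 <= idist m n.
Proof. by move=> mn; rewrite idistE ler1n absz_gt0 subr_eq0. Qed.

(** At most two values of n share a distance to m, hence twice the one-sided bound. *)
Lemma sum_invsq (D : nat) s m : uniq s ->
  \sum_(n <- s) (D < `|m - n|)%N%:R * idist m n ^- 2 <= 4 / D.+1%:R :> R.
Proof.
move=> us; rewrite (bigID (fun n => 0 <= m - n)) /=.
have -> : 4 / D.+1%:R = 2 / D.+1%:R + 2 / D.+1%:R :> R by rewrite -mulrDl; congr (_ / _); ring.
have half (P : pred int) : {in [pred n | P n] &, injective (fun n => `|m - n|%N)} ->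
    \sum_(n <- s | P n) (D < `|m - n|)%N%:R * idist m n ^- 2 <= 2 / D.+1%:R :> R.
  move=> injP; rewrite -big_filter.
  rewrite (eq_bigr (fun n => (fun k : nat => (D < k)%N%:R * (k%:R ^- 2)) `|m - n|%N)); last first.
    by move=> n _; rewrite idistE.
  rewrite -(big_map (fun n => `|m - n|%N) xpredT (fun k : nat => (D < k)%N%:R * (k%:R ^- 2))).
  apply: sum_invsq_nat; rewrite map_inj_in_uniq ?filter_uniq //.
  move=> a b; rewrite !mem_filter => /andP[Pa _] /andP[Pb _]; exact: injP.
by apply: lerD; apply: half => a b; rewrite !inE => *; lia.
Qed.

Lemma sum_eq_le1 s (f : int -> bool) : uniq s ->
  (forall m n, f m -> f n -> m = n) -> \sum_(n <- s) (f n)%:R <= 1 :> R.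
Proof.
move=> us hf; have [/hasP[n ns fn]|/hasPn nf] := boolP (has f s).
  rewrite (big_rem n) //= fn big1_seq ?addr0 // => m /andP[_ ms].
  rewrite (_ : f m = false) //; apply/negbTE/negP => fm.
  by move: ms; rewrite (hf _ _ fm fn) mem_rem_uniq // inE eqxx.
by rewrite big1_seq // => m /andP[_ ms]; rewrite (negbTE (nf _ ms)).
Qed.

Lemma sum_delta s (n : int) (f : int -> R) : uniq s -> n \in s ->
  \sum_(m <- s) (n == m)%:R * f m = f n.
Proof.
move=> us ns; rewrite (big_rem n) //= eqxx mul1r big1_seq ?addr0 // => m /andP[_ ms].
rewrite (_ : n == m = false) ?mul0r //; apply/negbTE/eqP => nm.
by move: ms; rewrite -nm mem_rem_uniq // inE eqxx.
Qed.

(* The quadruples in par are the vertices, in cyclic order, of the parallelograms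
   contributing to the fourth power; they are determined by n1 and the sides. *)
Definition par (n1 n2 n3 n4 : int) : bool := n1 + n3 == n2 + n4.

Variables (s : seq int) (A : int -> R).
Hypothesis us : uniq s.
Hypothesis A0 : forall n, 0 <= A n.

Let m2 := \sum_(n <- s) A n ^+ 2.

(** n4 is determined by n1, n2, n3; the sum over n2 is a tail of inverse squares, and the free
    indices n1 and n3 give m2^2. *)
Lemma S4_diagonals (D : nat) :
  S4 s (fun n1 n2 n3 n4 => (par n1 n2 n3 n4)%:R * ((D < `|n1 - n2|)%N%:R * idist n1 n2 ^- 2)
          * (A n1 * A n3) ^+ 2) <= 4 / D.+1%:R * m2 ^+ 2.
Proof.
have w0 n1 n2 : 0 <= (D < `|n1 - n2|)%N%:R * idist n1 n2 ^- 2 :> R.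
  by rewrite mulr_ge0 // invr_ge0 exprn_ge0 // /idist normr_ge0.
apply: (@le_trans _ _ (\sum_(n1 <- s) \sum_(n2 <- s) \sum_(n3 <- s)
    ((D < `|n1 - n2|)%N%:R * idist n1 n2 ^- 2) * (A n1 * A n3) ^+ 2)).
  apply: ler_sum => n1 _; apply: ler_sum => n2 _; apply: ler_sum => n3 _.
  under eq_bigr do rewrite -mulrA.
  rewrite -mulr_suml -[leRHS]mul1r; apply: ler_wpM2r.
    by rewrite mulr_ge0 ?sqr_ge0.
  by apply: sum_eq_le1 => // a b /eqP h1 /eqP h2; lia.
rewrite expr2 /m2 mulr_suml mulr_sumr; apply: ler_sum => n1 _.
rewrite exchange_big !mulr_sumr; apply: ler_sum => n3 _.
rewrite -mulr_suml -exprMn; apply: ler_wpM2r; first exact: sqr_ge0.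
exact: sum_invsq.
Qed.

(** Inverse product of the sides of a nondegenerate parallelogram; divided by (2 pi / L)^2 it
    dominates the time average. *)
Definition pker (n1 n2 n3 n4 : int) : R :=
  [&& par n1 n2 n3 n4, n1 != n2 & n1 != n4]%:R * ((idist n1 n2)^-1 * (idist n1 n4)^-1).

Lemma pker_ge0 n1 n2 n3 n4 : 0 <= pker n1 n2 n3 n4.
Proof. by rewrite /pker mulr_ge0 // mulr_ge0 // invr_ge0 normr_ge0. Qed.

Definition A4 (n1 n2 n3 n4 : int) : R := A n1 * A n2 * A n3 * A n4.

Lemma A4_ge0 n1 n2 n3 n4 : 0 <= A4 n1 n2 n3 n4.
Proof. by rewrite /A4 !mulr_ge0. Qed.

Let X D n1 n2 n3 n4 : R := (par n1 n2 n3 n4)%:R * ((D < `|n1 - n2|)%N%:R * idist n1 n2 ^- 2)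
          * (A n1 * A n3) ^+ 2.
Let Y D n1 n2 n3 n4 : R := X D n4 n1 n2 n3.

Let S4Y D : S4 s (Y D) = S4 s (X D).
Proof. by rewrite (S4_cyc s (Y D)). Qed.

Let XS4 D : S4 s (X D) <= 4 / D.+1%:R * m2 ^+ 2.
Proof. exact: S4_diagonals. Qed.

(* Parallelograms with a long side: |n1 n3| and |n2 n4| are the two diagonals;
   AM-GM between A1 A3 / |n1 - n2| and A2 A4 / |n1 - n4|. *)
Lemma S4_far (k : nat) : (0 < k)%N ->
  S4 s (fun n1 n2 n3 n4 => ((k ^ 2 <= `|n1 - n2|) || (k ^ 2 <= `|n1 - n4|))%N%:R *
     (pker n1 n2 n3 n4 * A4 n1 n2 n3 n4)) <= 8 / k%:R * m2 ^+ 2.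
Proof.
move=> k0; pose D := (k ^ 2).-1.
have DS : D.+1 = (k ^ 2)%N by rewrite prednK // expn_gt0 k0.
have kR : 0 < k%:R :> R by rewrite ltr0n.
(* The sum truncated at sides of length k^2 is at most 4/k^2 times m2^2, the full one 4 times m2^2;
   with these weights each of the four terms contributes 2/k. *)
pose th : R := k%:R / 2; pose th' : R := k%:R^-1 / 2.
apply: (@le_trans _ _ (S4 s (fun a b c d =>
    (th * X D a b c d + th' * Y 0%N a b c d) + (th' * X 0%N a b c d + th * Y D a b c d)))).
  apply: le_S4 => n1 n2 n3 n4 _ _ _ _.
  have Xge0 E a b c d : 0 <= X E a b c d.
    by rewrite /X !mulr_ge0 ?sqr_ge0 // invr_ge0 exprn_ge0 // /idist normr_ge0.
  have rhs1 : 0 <= th * X D n1 n2 n3 n4 + th' * Y 0%N n1 n2 n3 n4.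
    by rewrite addr_ge0 // mulr_ge0 ?Xge0 // /th /th' divr_ge0 // ?invr_ge0 ltW.
  have rhs2 : 0 <= th' * X 0%N n1 n2 n3 n4 + th * Y D n1 n2 n3 n4.
    by rewrite addr_ge0 // mulr_ge0 ?Xge0 // /th /th' divr_ge0 // ?invr_ge0 ltW.
  rewrite /pker; have [/and3P[p12 n12 n14]|_] := boolP [&& _, _ & _]; last first.
    by rewrite !(mul0r, mulr0) addr_ge0.
  have p4 : par n4 n1 n2 n3 by move: p12; rewrite /par => /eqP h; apply/eqP; lia.
  have i0 : 0 < idist n1 n2 by rewrite (lt_le_trans ltr01) // idist_ge1.
  have j0 : 0 < idist n1 n4 by rewrite (lt_le_trans ltr01) // idist_ge1.
  have amgm (t x y : R) : 0 < t -> x * y <= t / 2 * x ^+ 2 + t^-1 / 2 * y ^+ 2.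
    move=> t0; rewrite -subr_ge0.
    have -> : t / 2 * x ^+ 2 + t^-1 / 2 * y ^+ 2 - x * y = t / 2 * (x - t^-1 * y) ^+ 2.
      by field; rewrite gt_eqF.
    by rewrite mulr_ge0 ?sqr_ge0 // divr_ge0 // ltW.
  pose x := (idist n1 n2)^-1 * (A n1 * A n3); pose y := (idist n1 n4)^-1 * (A n2 * A n4).
  have -> : true%:R * ((idist n1 n2)^-1 / idist n1 n4) * A4 n1 n2 n3 n4 = x * y.
    by rewrite /x /y /A4 mul1r; ring.
  have g0 : (0 < `|n1 - n2|)%N by rewrite absz_gt0 subr_eq0.
  have g1 : (0 < `|n4 - n1|)%N by rewrite absz_gt0 subr_eq0 eq_sym.
  have Xx E : (E < `|n1 - n2|)%N -> X E n1 n2 n3 n4 = x ^+ 2.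
    by move=> h; rewrite /X p12 h !mul1r /x [RHS]exprMn exprVn.
  have Yy E : (E < `|n4 - n1|)%N -> Y E n1 n2 n3 n4 = y ^+ 2.
    by move=> h; rewrite /Y /X p4 h !mul1r /y [RHS]exprMn exprVn idistC [A n4 * _]mulrC.
  have d14 : `|n1 - n4|%N = `|n4 - n1|%N by rewrite -abszN opprB.
  have [f1|_] := boolP (k ^ 2 <= `|n1 - n2|)%N.
    rewrite mul1r -[leLHS]addr0; apply: lerD => //.
    by rewrite Xx ?DS // Yy //; exact: amgm.
  have [f2|_] := boolP (k ^ 2 <= `|n1 - n4|)%N; last by rewrite mul0r addr_ge0.
  rewrite mul1r -[leLHS]add0r; apply: lerD => //.
  rewrite Xx // Yy ?DS -?d14 // mulrC [leRHS]addrC; exact: amgm.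
rewrite !S4D !S4Z !S4Y.
have h1 := XS4 D; have h2 := XS4 0.
rewrite DS natrX in h1.
have t0 : 0 <= th by rewrite divr_ge0 // ltW.
have t0' : 0 <= th' by rewrite divr_ge0 // invr_ge0 ltW.
have e1 := ler_wpM2l t0 h1; have e2 := ler_wpM2l t0' h2.
have -> : 8 / k%:R * m2 ^+ 2 = (th * (4 / k%:R ^+ 2 * m2 ^+ 2) + th' * (4 / 1%:R * m2 ^+ 2))
   + (th' * (4 / 1%:R * m2 ^+ 2) + th * (4 / k%:R ^+ 2 * m2 ^+ 2)).
  by rewrite /th /th'; field; rewrite gt_eqF.
by do 2 apply: lerD => //.
Qed.

(** For sides p, r <= k^2, 1/(pr) <= k^4/(p^2 r^2), and the inverse squares sum to at most 4 for
    each side. The product over one diagonal is at most eta, which leaves a bound linear in the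
    mass. *)
Lemma S4_near (k : nat) (eta : R) : (0 < k)%N -> (forall n, n \in s -> A n ^+ 2 <= eta) ->
  S4 s (fun n1 n2 n3 n4 => (~~ ((k ^ 2 <= `|n1 - n2|) || (k ^ 2 <= `|n1 - n4|)))%N%:R *
     (pker n1 n2 n3 n4 * A4 n1 n2 n3 n4)) <= 16 * k%:R ^+ 4 * (eta * m2).
Proof.
move=> k0 Aeta.
pose Z n1 n2 n3 n4 : R := (par n1 n2 n3 n4)%:R * (((0 < `|n1 - n2|)%N%:R * idist n1 n2 ^- 2) *
   ((0 < `|n1 - n4|)%N%:R * idist n1 n4 ^- 2)) * A n1 ^+ 2.
have Zle : S4 s Z <= 16 * m2.
  have w0 n1 n2 : 0 <= (0 < `|n1 - n2|)%N%:R * idist n1 n2 ^- 2 :> R.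
    by rewrite mulr_ge0 // invr_ge0 exprn_ge0 // /idist normr_ge0.
  rewrite mulr_sumr /S4; apply: ler_sum => n1 _.
  under eq_bigr do rewrite exchange_big /=.
  apply: (@le_trans _ _ (\sum_(n2 <- s) \sum_(n4 <- s) ((0 < `|n1 - n2|)%N%:R * idist n1 n2 ^- 2) *
   ((0 < `|n1 - n4|)%N%:R * idist n1 n4 ^- 2) * A n1 ^+ 2)).
    apply: ler_sum => n2 _; apply: ler_sum => n4 _; rewrite /Z.
    under eq_bigr do rewrite -mulrA.
    rewrite -mulr_suml -[leRHS]mul1r; apply: ler_wpM2r.
      by rewrite mulr_ge0 ?sqr_ge0 // mulr_ge0 ?w0.
    by apply: sum_eq_le1 => // a b /eqP h1 /eqP h2; lia.
  under eq_bigr do rewrite -mulr_suml -mulr_sumr.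
  rewrite -mulr_suml -mulr_suml; apply: ler_wpM2r; first exact: sqr_ge0.
  have h := sum_invsq 0 n1 us; rewrite divr1 in h.
  have s0 : 0 <= \sum_(n <- s) (0 < `|n1 - n|)%N%:R * idist n1 n ^- 2 :> R by exact: sumr_ge0.
  have -> : 16 = 4 * 4 :> R by ring.
  by apply: ler_pM.
apply: (@le_trans _ _ (S4 s (fun n1 n2 n3 n4 =>
    (k%:R ^+ 4 * eta / 2) * (Z n1 n2 n3 n4 + Z n3 n4 n1 n2)))); last first.
  rewrite S4Z S4D (_ : S4 s (fun a b c d => Z c d a b) = S4 s Z); last first.
    by rewrite (S4_cyc s Z) (S4_cyc s (fun a b c d => Z b c d a)).
  have [s0|s0] := eqVneq s [::].
    by rewrite /m2 /S4 s0 !big_nil !(mulr0, addr0).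
  have eta0 : 0 <= eta.
    case: (s) s0 Aeta => // n s' _ /(_ n (mem_head _ _)); apply: le_trans; exact: sqr_ge0.
  have c0 : 0 <= k%:R ^+ 4 * eta / 2 by rewrite divr_ge0 // mulr_ge0 // exprn_ge0.
  apply: le_trans (ler_wpM2l c0 (lerD Zle Zle)) _.
  by rewrite le_eqVlt; apply/orP; left; apply/eqP; field.
apply: le_S4 => n1 n2 n3 n4 h1 h2 h3 h4.
have eta0 : 0 <= eta by apply: le_trans (Aeta _ h1); exact: sqr_ge0.
have Z0 a b c d : 0 <= Z a b c d.
  by rewrite /Z !mulr_ge0 ?sqr_ge0 // invr_ge0 exprn_ge0 // /idist normr_ge0.
have rhs : 0 <= k%:R ^+ 4 * eta / 2 * (Z n1 n2 n3 n4 + Z n3 n4 n1 n2).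
  by rewrite mulr_ge0 // ?addr_ge0 // divr_ge0 // mulr_ge0 // exprn_ge0.
have [_|] := boolP (_ || _); first by rewrite mul0r.
rewrite negb_or -!ltnNge => /andP[near1 near2]; rewrite mul1r /pker.
have [/and3P[p12 n12 n14]|_] := boolP [&& _, _ & _]; last by rewrite !mul0r.
have p3 : par n3 n4 n1 n2 by move: p12; rewrite /par => /eqP h; apply/eqP; clear -h; lia.
have d34 : (n3 - n4 = - (n1 - n2)) by move: p12; rewrite /par => /eqP; clear; lia.
have d32 : (n3 - n2 = - (n1 - n4)) by move: p12; rewrite /par => /eqP; clear; lia.
have i0 : 0 < idist n1 n2 by rewrite (lt_le_trans ltr01) // idist_ge1.
have j0 : 0 < idist n1 n4 by rewrite (lt_le_trans ltr01) // idist_ge1.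
have ik : idist n1 n2 <= k%:R ^+ 2 by rewrite idistE -natrX ler_nat ltnW.
have jk : idist n1 n4 <= k%:R ^+ 2 by rewrite idistE -natrX ler_nat ltnW.
have g0 : (0 < `|n1 - n2|)%N by rewrite absz_gt0 subr_eq0.
have g1 : (0 < `|n1 - n4|)%N by rewrite absz_gt0 subr_eq0.
have -> : Z n1 n2 n3 n4 + Z n3 n4 n1 n2 =
    idist n1 n2 ^- 2 * idist n1 n4 ^- 2 * (A n1 ^+ 2 + A n3 ^+ 2).
  rewrite /Z p12 p3 d34 d32 !abszN g0 g1 !mul1r /idist d34 d32 !mulrNz !normrN; ring.
set p := idist n1 n2 in i0 ik *; set r := idist n1 n4 in j0 jk *.
have e1 : p^-1 * r^-1 <= k%:R ^+ 4 * (p ^- 2 * r ^- 2).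
  have -> : k%:R ^+ 4 * (p ^- 2 * r ^- 2) = (k%:R ^+ 2 * k%:R ^+ 2 / (p * r)) * (p^-1 * r^-1).
    by field; rewrite !gt_eqF.
  rewrite ler_peMl ?mulr_ge0 ?invr_ge0 ?(ltW i0) ?(ltW j0) //.
  rewrite ler_pdivlMr ?mulr_gt0 // mul1r; apply: ler_pM => //; exact: ltW.
have e2 : A4 n1 n2 n3 n4 <= eta / 2 * (A n1 ^+ 2 + A n3 ^+ 2).
  have a24 : A n2 * A n4 <= eta.
    have := Aeta _ h2; have := Aeta _ h4; have := sqr_ge0 (A n2 - A n4); lra.
  have a13 : A n1 * A n3 <= (A n1 ^+ 2 + A n3 ^+ 2) / 2.
    have := sqr_ge0 (A n1 - A n3); lra.
  rewrite /A4 (_ : _ * _ * _ * _ = (A n2 * A n4) * (A n1 * A n3)); last by ring.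
  rewrite (_ : eta / 2 * _ = eta * ((A n1 ^+ 2 + A n3 ^+ 2) / 2)); last by ring.
  by apply: ler_pM => //; rewrite mulr_ge0.
rewrite mul1r (_ : _ * _ / 2 * _ = k%:R ^+ 4 * (p ^- 2 * r ^- 2) * (eta / 2 * (A n1 ^+ 2 + A n3 ^+ 2))); last by ring.
apply: ler_pM => //; last exact: A4_ge0.
by rewrite mulr_ge0 // invr_ge0 ltW.
Qed.
End QuarticSums.

(** * The quartic form of a trigonometric polynomial *)

Section QuarticForm.
Context {R : realType}.
Local Notation mu := (@lebesgue_measure R).
Variable L : R.
Hypothesis L0 : 0 < L.
Local Notation D := (`[0, L]%classic : set R).
Local Notation I := (`[0, 1]%classic : set R).
Implicit Types (s : seq int) (c : int -> R[i]).

Definition prod4 c (n1 n2 n3 n4 : int) : R[i] := c n1 * (c n2)^*%C * c n3 * (c n4)^*%C.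

Definition disp4 (n1 n2 n3 n4 : int) : R :=
  freq L n1 ^+ 2 - freq L n2 ^+ 2 + freq L n3 ^+ 2 - freq L n4 ^+ 2.

(* The time average of expi (- a t) over [0, 1]. *)
Definition kap (a : R) : R[i] := if a == 0 then 1 else (sin a / a) -i* ((1 - cos a) / a).

Definition qterm c n1 n2 n3 n4 : R :=
  (par n1 n2 n3 n4)%:R * complex.Re (prod4 c n1 n2 n3 n4 * kap (disp4 n1 n2 n3 n4)).

Definition qform s c : R := S4 s (qterm c).

Definition mass s c : R := \sum_(n <- s) csq (c n).

Lemma Rintegral_sumE (A : set R) (J : Type) (s : seq J) (F : J -> R -> R) : measurable A ->
  (forall i, mu.-integrable A (EFin \o F i)) ->
  mu.-integrable A (EFin \o (fun x => \sum_(i <- s) F i x)) /\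
  \int[mu]_(x in A) (\sum_(i <- s) F i x) = \sum_(i <- s) \int[mu]_(x in A) F i x.
Proof.
move=> mA iF; elim: s => [|i s [IH1 IH2]].
  rewrite big_nil; split.
    rewrite (_ : EFin \o _ = cst 0%E); first exact: integrable0.
    by apply/funext => x /=; rewrite big_nil.
  rewrite /Rintegral (_ : (fun x => _) = cst 0%E) ?integral0 //.
  by apply/funext => x /=; rewrite big_nil.
have e : (fun x => \sum_(j <- i :: s) F j x) = (fun x => F i x + \sum_(j <- s) F j x).
  by apply/funext => x; rewrite big_cons.
split.
  rewrite e (_ : EFin \o _ = ((EFin \o F i) \+ (EFin \o (fun x => (\sum_(j <- s) F j x)%R)))%E) //.
  exact: integrableD.
by rewrite e RintegralD // IH2 big_cons.
Qed.

Lemma Rintegral_S4 (A : set R) s (F : int -> int -> int -> int -> R -> R) : measurable A ->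
  (forall a b d e, mu.-integrable A (EFin \o F a b d e)) ->
  mu.-integrable A (EFin \o (fun x => S4 s (fun a b d e => F a b d e x))) /\
  \int[mu]_(x in A) (S4 s (fun a b d e => F a b d e x)) =
  S4 s (fun a b d e => \int[mu]_(x in A) F a b d e x).
Proof.
move=> mA iF.
have i1 a b d := @Rintegral_sumE A _ s (F a b d) mA (iF a b d).
have i2 a b := @Rintegral_sumE A _ s _ mA (fun d => (i1 a b d).1).
have i3 a := @Rintegral_sumE A _ s _ mA (fun b => (i2 a b).1).
have i4 := @Rintegral_sumE A _ s _ mA (fun a => (i3 a).1).
split; first exact: i4.1.
rewrite /S4 i4.2; apply: eq_bigr => a _; rewrite (i3 a).2; apply: eq_bigr => b _.
by rewrite (i2 a b).2; apply: eq_bigr => d _; rewrite (i1 a b d).2.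
Qed.

Lemma Re_S4 s (F : int -> int -> int -> int -> R[i]) :
  complex.Re (\sum_(n1 <- s) \sum_(n2 <- s) \sum_(n3 <- s) \sum_(n4 <- s) F n1 n2 n3 n4) =
  S4 s (fun a b d e => complex.Re (F a b d e)).
Proof.
rewrite Re_sum; apply: eq_bigr => a _; rewrite Re_sum; apply: eq_bigr => b _.
by rewrite Re_sum; apply: eq_bigr => d _; rewrite Re_sum.
Qed.

Lemma conjM (x y : R[i]) : (x * y)^*%C = x^*%C * y^*%C.
Proof. exact: rmorphM. Qed.

Lemma conj_sum J (t : seq J) (f : J -> R[i]) :
  (\sum_(j <- t) f j)^*%C = \sum_(j <- t) (f j)^*%C.
Proof. exact: rmorph_sum. Qed.

Lemma csq_trig2 s c x : csq (trig L s c x) ^+ 2 =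
  S4 s (fun a b d e => complex.Re (prod4 c a b d e * efun L (a - b + d - e) x)).
Proof.
rewrite -Re_S4.
have h (z : R[i]) : (csq z ^+ 2) = complex.Re (z * (z^*%C * (z * z^*%C))).
  by case: z => p q; rewrite /csq /=; ring.
rewrite h; congr complex.Re.
rewrite {1}/trig mulr_suml; apply: eq_bigr => a _.
rewrite {1}/trig conj_sum mulr_suml mulr_sumr; apply: eq_bigr => b _.
rewrite {1}/trig mulr_suml !mulr_sumr; apply: eq_bigr => d _.
rewrite !mulr_sumr; apply: eq_bigr => e _.
by rewrite !conjM -!efunN /prod4 !efunD; ring.
Qed.

Lemma Rintegral_efun (z : R[i]) (m : int) :
  mu.-integrable D (EFin \o (fun x => complex.Re (z * efun L m x))) /\
  \int[mu]_(x in D) complex.Re (z * efun L m x) = L * ((m == 0)%:R * complex.Re z).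
Proof.
have ie : cintegrable L (efun L m).
  have := fourier_integrable L0 0 (L2per_efun L0 m); congr cintegrable.
  by apply/funext => x; rewrite efun0 rmorph1 mulr1.
split; first exact: (cintegrableZ z ie).1.
transitivity (complex.Re (Cintegral D (fun x => z * efun L m x))) => //.
rewrite CintegralZ // Cintegral_efun //.
by case: z => p q /=; case: eqP => _ /=; ring.
Qed.

Lemma Rintegral_cst01 (a : R) : \int[mu]_(t in I) a = a.
Proof.
by rewrite Rintegral_cst // -[RHS]mulr1; congr (_ * _); exact: (congr1 fine (mu_D ltr01)).
Qed.

Lemma continuous_integrable01 (f : R -> R) : continuous f -> mu.-integrable I (EFin \o f).
Proof.
move=> cf; apply: continuous_compact_integrable; first exact: segment_compact.
by apply: continuous_subspaceT => x; exact: cf.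
Qed.

Lemma Rintegral_phase (z : R[i]) (a : R) :
  mu.-integrable I (EFin \o (fun t => complex.Re (z * expi (- (a * t))))) /\
  \int[mu]_(t in I) complex.Re (z * expi (- (a * t))) = complex.Re (z * kap a).
Proof.
have e t : complex.Re (z * expi (- (a * t))) =
    complex.Re z * cos (a * t) + complex.Im z * sin (a * t).
  by rewrite expiN /expi; case: z => p q /=; ring.
have cc : continuous (fun t : R => cos (a * t)).
  by apply: continuous_scale_comp; exact: continuous_cos.
have cs : continuous (fun t : R => sin (a * t)).
  by apply: continuous_scale_comp; exact: continuous_sin.
have ic : mu.-integrable I (EFin \o (fun t => complex.Re z * cos (a * t))).
  apply: continuous_integrable01 => t; apply: cvgM; first exact: cvg_cst.
  exact: cc.
have is_ : mu.-integrable I (EFin \o (fun t => complex.Im z * sin (a * t))).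
  apply: continuous_integrable01 => t; apply: cvgM; first exact: cvg_cst.
  exact: cs.
split.
  rewrite (_ : (fun t => _) = (fun t => complex.Re z * cos (a * t) + complex.Im z * sin (a * t))).
    rewrite (_ : EFin \o _ = ((EFin \o (fun t => complex.Re z * cos (a * t))%R) \+
       (EFin \o (fun t => complex.Im z * sin (a * t))%R))%E) //.
    exact: integrableD.
  by apply/funext => t; exact: e.
transitivity (\int[mu]_(t in I) (complex.Re z * cos (a * t) + complex.Im z * sin (a * t))).
  by apply: eq_Rintegral => t _; exact: e.
rewrite RintegralD // /kap; have [->|a0] := eqVneq a 0.
  rewrite (@eq_Rintegral _ _ _ _ _ (cst (complex.Re z))) ?Rintegral_cst01; last first.
    by move=> t _; rewrite mul0r cos0 mulr1.
  rewrite (@eq_Rintegral _ _ _ _ _ (cst 0)) ?Rintegral_cst01 ?addr0 ?mulr1 //.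
  by move=> t _; rewrite mul0r sin0 mulr0.
have ic1 : mu.-integrable I (EFin \o (fun t => cos (a * t))).
  exact: continuous_integrable01.
have is1 : mu.-integrable I (EFin \o (fun t => sin (a * t))).
  exact: continuous_integrable01.
rewrite !RintegralZl // Rintegral_cos // Rintegral_sin // mulr1.
by case: z {e ic is_} => p q /=; ring.
Qed.

Lemma prod4_phase c t n1 n2 n3 n4 :
  prod4 (fun n => phase L t n * c n) n1 n2 n3 n4 =
  prod4 c n1 n2 n3 n4 * expi (- (disp4 n1 n2 n3 n4 * t)).
Proof.
rewrite /prod4 /phase; cbv beta; rewrite !conjM -!expiN.
have -> : expi (- (disp4 n1 n2 n3 n4 * t)) = expi (- (freq L n1 ^+ 2 * t)) *
    expi (- - (freq L n2 ^+ 2 * t)) * expi (- (freq L n3 ^+ 2 * t)) * expi (- - (freq L n4 ^+ 2 * t)).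
  by rewrite -!expiD; congr expi; rewrite /disp4; ring.
ring.
Qed.

(** Orthogonality in x retains only the parallelograms; integration in t turns the phase of each
    into a factor [kap]. *)
Lemma quart_trig s c : quart L (fun t => trig L s (fun n => phase L t n * c n)) =
  (L * qform s c)%:E.
Proof.
have mW : cmeasurable_fun (fun p : R * R => trig L s (fun n => phase L p.1 n * c n) p.2).
  apply: cmeasurable_sum => n; apply: cmeasurable_funM.
    apply: cmeasurable_funM; last exact: cmeasurable_cst.
    by apply: cmeasurable_expi; apply: measurable_funN; apply: measurable_funM.
  by apply: cmeasurable_expi; apply: measurable_funM.
rewrite quart_tx //.
have inner t : (\int[mu]_(x in D) (csq (trig L s (fun n => phase L t n * c n) x) ^+ 2)%:E =
   (S4 s (fun a b d e => L * ((par a b d e)%:R *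
      complex.Re (prod4 c a b d e * expi (- (disp4 a b d e * t))))))%:E)%E.
  have [i1 i2] := @Rintegral_S4 D s (fun a b d e x =>
      complex.Re (prod4 (fun n => phase L t n * c n) a b d e * efun L (a - b + d - e) x))
      (measurable_itv _) (fun a b d e => (Rintegral_efun _ _).1).
  under eq_integral do rewrite csq_trig2.
  rewrite -[LHS]fineK; last by apply: (integrable_fin_num _ i1).
  congr EFin; rewrite -/(Rintegral _ _ _) i2; apply: eq_S4 => a b d e.
  rewrite (Rintegral_efun _ _).2 prod4_phase; congr (_ * (_%:R * _)).
  by rewrite /par; congr nat_of_bool; apply/eqP/eqP; lia.
under eq_integral do rewrite inner.
have [i1 i2] := @Rintegral_S4 I s (fun a b d e t => L * ((par a b d e)%:R *
      complex.Re (prod4 c a b d e * expi (- (disp4 a b d e * t)))))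
      (measurable_itv _) (fun a b d e => integrable_scale L (integrable_scale _ (Rintegral_phase _ _).1)).
rewrite -[LHS]fineK; last by apply: (integrable_fin_num _ i1).
congr EFin; rewrite -/(Rintegral _ _ _) i2 /qform -S4Z; apply: eq_S4 => a b d e.
have ip := (Rintegral_phase (prod4 c a b d e) (disp4 a b d e)).1.
by rewrite RintegralZl ?RintegralZl ?(Rintegral_phase _ _).2 //; exact: integrable_scale.
Qed.
End QuarticForm.

(** * Bounds on the quartic form *)

Section QuarticBounds.
Context {R : realType}.
Variable L : R.
Hypothesis L0 : 0 < L.
Implicit Types (s : seq int) (c : int -> R[i]) (P : pred int).

Definition tau : R := freq L 1 ^+ 2.

Lemma tau_gt0 : 0 < tau.
Proof. by rewrite /tau exprn_gt0 // /freq mulr1 divr_gt0 // mulr_gt0 // pi_gt0. Qed.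

Lemma freqE n : freq L n = freq L 1 * n%:~R.
Proof. by rewrite /freq mulr1; ring. Qed.

(** The dispersion factors through the sides of the parallelogram: this is the source of all decay
    in the form. *)
Lemma disp4_par n1 n2 n3 n4 : par n1 n2 n3 n4 ->
  disp4 L n1 n2 n3 n4 = tau * (2 * ((n1 - n2)%:~R * (n1 - n4)%:~R)).
Proof.
rewrite /par => /eqP h; have -> : n3 = n2 + n4 - n1 by lia.
rewrite /disp4 !(freqE n1) !(freqE n2) !(freqE n4) !(freqE (n2 + n4 - n1)) /tau.
by rewrite !(intrD, intrB, mulrNz); ring.
Qed.

Lemma csq_kap (a : R) : a != 0 -> csq (kap a) <= (2 / `|a|) ^+ 2.
Proof.
move=> a0; rewrite /kap (negbTE a0) /csq /= sqrrN !exprMn -mulrDl !exprVn real_normK ?num_real //.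
apply: ler_wpM2r; first by rewrite invr_ge0 sqr_ge0.
by have := cos2Dsin2 a; have := cos_geN1 a; lra.
Qed.

Definition nterm c n1 n2 n3 n4 : R := [&& par n1 n2 n3 n4, n1 != n2 & n1 != n4]%:R *
  complex.Re (prod4 c n1 n2 n3 n4 * kap (disp4 L n1 n2 n3 n4)).

Definition nform s c : R := S4 s (nterm c).

Lemma cabs_prod4 c n1 n2 n3 n4 :
  cabs (prod4 c n1 n2 n3 n4) = A4 (fun n => cabs (c n)) n1 n2 n3 n4.
Proof.
have cj (z : R[i]) : cabs z^*%C = cabs z.
  by case: z => a b; rewrite /cabs /= sqrrN.
by rewrite /prod4 /A4 !cabsM !cj.
Qed.

Lemma norm_Re_le (z : R[i]) : `|complex.Re z| <= cabs z.
Proof.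
rewrite -(ler_pXn2r (n := 2)) ?nnegrE ?cabs_ge0 // cabs2 real_normK ?num_real //.
exact: csq_Re.
Qed.

Lemma nterm_abs c n1 n2 n3 n4 : `|nterm c n1 n2 n3 n4| <=
  tau^-1 * (pker n1 n2 n3 n4 * A4 (fun n => cabs (c n)) n1 n2 n3 n4).
Proof.
rewrite /nterm /pker; have [/and3P[p12 n12 n14]|_] := boolP [&& _, _ & _]; last first.
  by rewrite !mul0r normr0 mulr0.
rewrite !mul1r; apply: le_trans (norm_Re_le _) _; rewrite cabsM cabs_prod4.
rewrite mulrA mulrC; apply: ler_wpM2r; first by apply: A4_ge0 => n; exact: cabs_ge0.
have t0 := tau_gt0.
have i0 : 0 < idist n1 n2 :> R by rewrite (lt_le_trans ltr01) // idist_ge1.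
have j0 : 0 < idist n1 n4 :> R by rewrite (lt_le_trans ltr01) // idist_ge1.
apply: cabs_le_csq; first by rewrite !mulr_ge0 ?invr_ge0 // ltW.
rewrite disp4_par //; apply: le_trans (csq_kap _) _.
  apply: mulf_neq0; first by rewrite gt_eqF.
  by apply: mulf_neq0 => //; apply: mulf_neq0; rewrite intr_eq0 subr_eq0.
have -> : `|tau * (2 * ((n1 - n2)%:~R * (n1 - n4)%:~R))| = tau * (2 * (idist n1 n2 * idist n1 n4)).
  by rewrite normrM (ger0_norm (ltW t0)) normrM (ger0_norm (ler0n _ 2)) normrM.
rewrite le_eqVlt; apply/orP; left; apply/eqP; congr (_ ^+ 2).
by field; rewrite !gt_eqF.
Qed.

(** Degenerate parallelograms form two families, n1 = n2 and n1 = n4, both with zero dispersion so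
    that [kap] is 1. Their intersection, where the four vertices coincide, is counted twice and
    therefore subtracted. *)
Lemma qterm_split c n1 n2 n3 n4 : qterm L c n1 n2 n3 n4 =
  ((n1 == n2)%:R * (n3 == n4)%:R * (csq (c n1) * csq (c n3)) +
   (n1 == n4)%:R * (n2 == n3)%:R * (csq (c n1) * csq (c n3)) +
   - ((n1 == n2)%:R * ((n1 == n3)%:R * ((n1 == n4)%:R * csq (c n1) ^+ 2)))) + nterm c n1 n2 n3 n4.
Proof.
have Rez (z w : R[i]) : complex.Re (z * z^*%C * w * w^*%C) = csq z * csq w.
  by case: z => p q; case: w => x y; rewrite /csq /=; ring.
rewrite /qterm /nterm; have [p4|p4] := boolP (par n1 n2 n3 n4); last first.
  have f1 : (n1 == n2)%:R * (n3 == n4)%:R = 0 :> R.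
    rewrite -natrM mulnb; case: andP => // -[/eqP e1 /eqP e2].
    by move: p4; rewrite /par e1 e2 eqxx.
  have f2 : (n1 == n4)%:R * (n2 == n3)%:R = 0 :> R.
    rewrite -natrM mulnb; case: andP => // -[/eqP e1 /eqP e2].
    by move: p4; rewrite /par e1 e2 addrC eqxx.
  have f3 : (n1 == n2)%:R * ((n1 == n3)%:R * ((n1 == n4)%:R * csq (c n1) ^+ 2)) = 0.
    have [e1|] := eqVneq n1 n2; last by rewrite mul0r.
    have [e2|] := eqVneq n1 n3; last by rewrite mul0r mulr0.
    have [e3|] := eqVneq n1 n4; last by rewrite mul0r !mulr0.
    by move: p4; rewrite /par -e1 -e2 -e3 eqxx.
  by rewrite /= f1 f2 f3 !mul0r oppr0 !addr0.
have h : n1 + n3 = n2 + n4 by move: p4; rewrite /par => /eqP.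
rewrite mul1r /=; have [e12|n12] := eqVneq n1 n2.
  have e34 : n4 = n3 by lia.
  rewrite -e12 e34 eqxx /= !(mul0r, mul1r) addr0.
  rewrite /kap /disp4 subrr add0r subrr eqxx mulr1 Rez.
  by case: eqVneq => [<-|_] /=; ring.
have [e14|n14] := eqVneq n1 n4.
  have e23 : n3 = n2 by lia.
  rewrite -e14 e23 eqxx /= !(mul0r, mul1r) add0r oppr0 !addr0.
  rewrite /kap (_ : disp4 L n1 n2 n2 n1 = 0) ?eqxx ?mulr1; last by rewrite /disp4; ring.
  by rewrite -Rez; congr complex.Re; rewrite /prod4; ring.
by rewrite !(mul0r, mul1r) oppr0 !add0r.
Qed.

Lemma qform_split s c : uniq s ->
  qform L s c = 2 * mass s c ^+ 2 - \sum_(n <- s) csq (c n) ^+ 2 + nform s c.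
Proof.
move=> us; rewrite /qform (eq_S4 _ (qterm_split c)) S4D; congr (_ + _).
rewrite S4D S4N S4D.
have d1 : S4 s (fun n1 n2 n3 n4 => (n1 == n2)%:R * (n3 == n4)%:R * (csq (c n1) * csq (c n3))) = mass s c ^+ 2.
  rewrite expr2 {1}/mass mulr_suml; apply: eq_big_seq => n1 h1.
  rewrite -[RHS](sum_delta (fun _ => csq (c n1) * mass s c) us h1); apply: eq_bigr => n2 _.
  rewrite /mass !mulr_sumr; apply: eq_big_seq => n3 h3.
  rewrite -(sum_delta (fun _ => (n1 == n2)%:R * (csq (c n1) * csq (c n3))) us h3).
  by apply: eq_bigr => n4 _; ring.
have d2 : S4 s (fun n1 n2 n3 n4 => (n1 == n4)%:R * (n2 == n3)%:R * (csq (c n1) * csq (c n3))) = mass s c ^+ 2.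
  rewrite expr2 {1}/mass mulr_suml; apply: eq_big_seq => n1 h1.
  rewrite /mass mulr_sumr; apply: eq_big_seq => n2 h2.
  rewrite -(sum_delta (fun n3 => csq (c n1) * csq (c n3)) us h2); apply: eq_bigr => n3 _.
  rewrite -(sum_delta (fun n4 => (n2 == n3)%:R * (csq (c n1) * csq (c n3))) us h1).
  by apply: eq_bigr => n4 _; ring.
have d3 : S4 s (fun n1 n2 n3 n4 => (n1 == n2)%:R * ((n1 == n3)%:R * ((n1 == n4)%:R * csq (c n1) ^+ 2))) =
   \sum_(n <- s) csq (c n) ^+ 2.
  apply: eq_big_seq => n1 h1.
  rewrite -[RHS](sum_delta (fun _ => csq (c n1) ^+ 2) us h1); apply: eq_bigr => n2 _.
  rewrite -[X in _ * X](sum_delta (fun _ => csq (c n1) ^+ 2) us h1) mulr_sumr; apply: eq_bigr => n3 _.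
  rewrite -[X in _ * (_ * X)](sum_delta (fun _ => csq (c n1) ^+ 2) us h1) !mulr_sumr.
  by apply: eq_bigr.
by rewrite d1 d2 d3; ring.
Qed.

Lemma mass_ge0 s c : 0 <= mass s c.
Proof. by apply: sumr_ge0 => n _; exact: csq_ge0. Qed.

Lemma massE s c : mass s c = \sum_(n <- s) cabs (c n) ^+ 2.
Proof. by apply: eq_bigr => n _; rewrite cabs2. Qed.

Lemma nform_far s c (k : nat) : uniq s -> (0 < k)%N ->
  S4 s (fun n1 n2 n3 n4 => ((k ^ 2 <= `|n1 - n2|) || (k ^ 2 <= `|n1 - n4|))%N%:R *
     (tau^-1 * (pker n1 n2 n3 n4 * A4 (fun n => cabs (c n)) n1 n2 n3 n4))) <=
  tau^-1 * (8 / k%:R * mass s c ^+ 2).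
Proof.
move=> us k0; rewrite massE.
rewrite (_ : S4 s _ = tau^-1 * S4 s (fun n1 n2 n3 n4 =>
   ((k ^ 2 <= `|n1 - n2|) || (k ^ 2 <= `|n1 - n4|))%N%:R *
     (pker n1 n2 n3 n4 * A4 (fun n => cabs (c n)) n1 n2 n3 n4))); last first.
  by rewrite -S4Z; apply: eq_S4 => *; rewrite mulrCA.
apply: ler_wpM2l; first by rewrite invr_ge0 ltW // tau_gt0.
by apply: S4_far => // n; exact: cabs_ge0.
Qed.

(** With k = 1 every nondegenerate parallelogram is far, so [nform_far] covers the whole of
    [nform]. *)
Lemma qform_strichartz s c : uniq s -> qform L s c <= (2 + 8 / tau) * mass s c ^+ 2.
Proof.
move=> us; rewrite qform_split //.
have h := nform_far c us (ltnSn 0).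
have e : nform s c <= tau^-1 * (8 / 1%:R * mass s c ^+ 2).
  apply: le_trans h; apply: le_S4 => n1 n2 n3 n4 _ _ _ _.
  apply: le_trans (ler_norm _) _; apply: le_trans (nterm_abs _ _ _ _ _) _.
  rewrite /pker; have [/and3P[p12 n12 n14]|_] := boolP [&& _, _ & _]; last first.
    by rewrite !mul0r !mulr0.
  by rewrite exp1n (_ : (1 <= `|n1 - n2|)%N) ?mul1r // absz_gt0 subr_eq0.
have s0 : 0 <= \sum_(n <- s) csq (c n) ^+ 2 by apply: sumr_ge0 => n _; exact: sqr_ge0.
have -> : (2 + 8 / tau) * mass s c ^+ 2 = 2 * mass s c ^+ 2 + tau^-1 * (8 / 1%:R * mass s c ^+ 2).
  by rewrite divr1; ring.
lra.
Qed.

(** The far parallelograms are made small by a large k, the near ones, once k is fixed, by a small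
    eta; the resonant 2 m^2 remains. *)
Lemma qform_spread s c (k : nat) (eta : R) : uniq s -> (0 < k)%N ->
  (forall n, n \in s -> csq (c n) <= eta) ->
  qform L s c <= 2 * mass s c ^+ 2 +
    tau^-1 * (8 / k%:R * mass s c ^+ 2 + 16 * k%:R ^+ 4 * (eta * mass s c)).
Proof.
move=> us k0 ceta; rewrite qform_split //.
have s0 : 0 <= \sum_(n <- s) csq (c n) ^+ 2 by apply: sumr_ge0 => n _; exact: sqr_ge0.
suff e : nform s c <= tau^-1 * (8 / k%:R * mass s c ^+ 2 + 16 * k%:R ^+ 4 * (eta * mass s c)) by lra.
have h1 := nform_far c us k0.
have h2 : S4 s (fun n1 n2 n3 n4 => (~~ ((k ^ 2 <= `|n1 - n2|) || (k ^ 2 <= `|n1 - n4|)))%N%:R *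
     (pker n1 n2 n3 n4 * A4 (fun n => cabs (c n)) n1 n2 n3 n4)) <= 16 * k%:R ^+ 4 * (eta * mass s c).
  rewrite massE; apply: S4_near => // n; first exact: cabs_ge0.
  by rewrite cabs2; exact: ceta.
have t0 : 0 <= tau^-1 by rewrite invr_ge0 ltW // tau_gt0.
rewrite mulrDr; apply: le_trans (lerD h1 (ler_wpM2l t0 h2)).
rewrite -S4Z -S4D; apply: le_S4 => n1 n2 n3 n4 _ _ _ _.
apply: le_trans (ler_norm _) _; apply: le_trans (nterm_abs _ _ _ _ _) _.
by case: (_ || _); rewrite /= !(mul1r, mul0r, mulr0, addr0, add0r).
Qed.

Definition crestr P c n : R[i] := if P n then c n else 0.

(** The degenerate part contributes 2(a + b)^2 - 2a^2 - 2b^2 = 4ab. A nondegenerate parallelogram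
    with vertices in both groups has an edge from one to the other, long by hypothesis, so it is
    counted in [nform_far]. *)
Lemma qform_decouple s c P (k : nat) : uniq s -> (0 < k)%N ->
  (forall n m, n \in s -> m \in s -> P n -> ~~ P m -> c n != 0 -> c m != 0 ->
     (k ^ 2 <= `|n - m|)%N) ->
  qform L s c <= qform L s (crestr P c) + qform L s (crestr (predC P) c)
    + 4 * (mass s (crestr P c) * mass s (crestr (predC P) c))
    + tau^-1 * (8 / k%:R * mass s c ^+ 2).
Proof.
move=> us k0 sep; rewrite !qform_split //.
have hc n : csq (c n) = csq (crestr P c n) + csq (crestr (predC P) c n).
  by rewrite /crestr /=; case: (P n) => /=; rewrite csq0 ?addr0 ?add0r.
have hc2 n : csq (c n) ^+ 2 = csq (crestr P c n) ^+ 2 + csq (crestr (predC P) c n) ^+ 2.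
  by rewrite /crestr /=; case: (P n) => /=; rewrite csq0 expr0n ?addr0 ?add0r.
have hm : mass s c = mass s (crestr P c) + mass s (crestr (predC P) c).
  by rewrite /mass -big_split; apply: eq_bigr => n _; exact: hc.
have h2 : \sum_(n <- s) csq (c n) ^+ 2 = \sum_(n <- s) csq (crestr P c n) ^+ 2 +
    \sum_(n <- s) csq (crestr (predC P) c n) ^+ 2.
  by rewrite -big_split; apply: eq_bigr => n _; exact: hc2.
suff e : nform s c <= nform s (crestr P c) + nform s (crestr (predC P) c) +
    tau^-1 * (8 / k%:R * mass s c ^+ 2) by move: e; rewrite h2 hm; lra.
apply: le_trans (lerD (lexx _) (nform_far c us k0)).
rewrite -!S4D; apply: le_S4 => n1 n2 n3 n4 h1 h2' h3 h4.
have R0 : 0 <= tau^-1 * (pker n1 n2 n3 n4 * A4 (fun n => cabs (c n)) n1 n2 n3 n4).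
  have a4 := A4_ge0 (A := fun n => cabs (c n)) (fun n => cabs_ge0 _) n1 n2 n3 n4.
  have t0 : 0 <= tau^-1 by rewrite invr_ge0 ltW // tau_gt0.
  by rewrite mulr_ge0 // mulr_ge0 // pker_ge0.
have RR0 := mulr_ge0 (ler0n R ((k ^ 2 <= `|n1 - n2|) || (k ^ 2 <= `|n1 - n4|))%N) R0.
have c0A : forall c', [|| c' n1 == 0, c' n2 == 0, c' n3 == 0 | c' n4 == 0] ->
    nterm c' n1 n2 n3 n4 = 0.
  move=> c' h; suff e : prod4 c' n1 n2 n3 n4 = 0 by rewrite /nterm e mul0r mulr0.
  case/or4P: h => /eqP e; rewrite /prod4 e ?rmorph0; by rewrite !(mul0r, mulr0).
have [z|] := boolP [|| c n1 == 0, c n2 == 0, c n3 == 0 | c n4 == 0].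
  have z1 Q : [|| crestr Q c n1 == 0, crestr Q c n2 == 0, crestr Q c n3 == 0 | crestr Q c n4 == 0].
    have cr0 n : c n == 0 -> crestr Q c n == 0.
      by rewrite /crestr => /eqP ->; rewrite if_same.
    by apply/or4P; case/or4P: z => /cr0 z; [constructor 1|constructor 2|constructor 3|constructor 4].
  rewrite (c0A c) // (c0A _ (z1 P)) (c0A _ (z1 (predC P))) !add0r.
  exact: RR0.
rewrite !negb_or => /and4P[c1 c2 c3 c4].
have [/and4P[p1 p2 p3 p4]|np] := boolP [&& P n1, P n2, P n3 & P n4].
  have -> : nterm c n1 n2 n3 n4 = nterm (crestr P c) n1 n2 n3 n4.
    by rewrite /nterm /prod4 /crestr p1 p2 p3 p4.
  rewrite (c0A (crestr (predC P) c)) ?addr0 ?lerDl ?RR0 //.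
  by rewrite /crestr /= p1 eqxx.
have zP : nterm (crestr P c) n1 n2 n3 n4 = 0.
  apply: c0A; move: np; rewrite !negb_and /crestr => /or4P[] /negbTE ->; by rewrite eqxx ?orbT.
have [/and4P[p1 p2 p3 p4]|np'] := boolP [&& ~~ P n1, ~~ P n2, ~~ P n3 & ~~ P n4].
  have -> : nterm c n1 n2 n3 n4 = nterm (crestr (predC P) c) n1 n2 n3 n4.
    by rewrite /nterm /prod4 /crestr /= p1 p2 p3 p4.
  by rewrite zP add0r lerDl.
have zP' : nterm (crestr (predC P) c) n1 n2 n3 n4 = 0.
  apply: c0A; move: np'; rewrite !negb_and !negbK /crestr /= => /or4P[] ->; by rewrite eqxx ?orbT.
rewrite zP zP' !add0r; apply: le_trans (ler_norm _) _; apply: le_trans (nterm_abs _ _ _ _ _) _.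
have [par4|npar] := boolP (par n1 n2 n3 n4); last by rewrite /pker (negbTE npar) /= !mul0r !mulr0.
rewrite (_ : (_ || _) = true) ?mul1r //.
have side n m : n \in s -> m \in s -> c n != 0 -> c m != 0 -> P n != P m -> (k ^ 2 <= `|n - m|)%N.
  move=> hn hm' cn cm; have [Pn|Pn] := boolP (P n); have [Pm|Pm] := boolP (P m) => // _.
    exact: sep.
  by rewrite -abszN opprB; exact: sep.
have [e12|n12] := eqVneq (P n1) (P n2); last by rewrite side.
have [e14|n14] := eqVneq (P n1) (P n4); last by rewrite (side n1 n4) ?orbT.
(* When n1 agrees with both neighbours the odd vertex is n3; its edge to n2 is opposite to the edge
   n1 n4 and as long. *)
have n23 : P n2 != P n3.
  by move: np np'; rewrite -e12 -e14; case: (P n1); case: (P n3).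
have -> : n1 - n4 = n2 - n3 by move: par4; clear; rewrite /par => /eqP; lia.
by rewrite (side n2 n3) ?orbT.
Qed.

(** Galilean invariance: parallelograms and their sides involve differences of indices only. *)
Lemma qform_shift s c (m : int) :
  qform L s (fun n => c (n + m)) = qform L [seq n + m | n <- s] c.
Proof.
rewrite /qform /S4 big_map; apply: eq_bigr => n1 _; rewrite big_map; apply: eq_bigr => n2 _.
rewrite big_map; apply: eq_bigr => n3 _; rewrite big_map; apply: eq_bigr => n4 _.
have e : par (n1 + m) (n2 + m) (n3 + m) (n4 + m) = par n1 n2 n3 n4 by apply/eqP/eqP; lia.
rewrite /qterm e; have [p4|_] := boolP (par n1 n2 n3 n4); last by rewrite !mul0r.
rewrite !disp4_par ?e //; congr (_ * complex.Re (_ * kap (_ * (_ * (_%:~R * _%:~R))))); lia.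
Qed.

End QuarticBounds.

(** * A test function beating the plane waves *)

Section Trigonometry.
Context {R : realType}.
Implicit Types (x y : R).

Lemma deriv_ge0_le (f f' : R -> R) (a b : R) :
  (forall x, is_derive x 1 f (f' x)) -> (forall x, a <= x -> 0 <= f' x) ->
  a <= b -> f a <= f b.
Proof.
move=> df f0; rewrite le_eqVlt => /orP[/eqP -> //|ab].
have cf : {within `[a, b]%classic, continuous f}.
  apply: continuous_subspaceT => x; apply: differentiable_continuous.
  by apply/derivable1_diffP; exact: (@ex_derive _ _ _ _ _ _ _ (df x)).
have [x + e] := MVT ab (fun x _ => df x) cf.
rewrite in_itv /= => /andP[ax _].
by rewrite -subr_ge0 e mulr_ge0 ?f0 ?(ltW ax)// subr_ge0 ltW.
Qed.

Lemma sin_lipschitz x y : `|sin x - sin y| <= `|x - y|.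
Proof.
wlog xy : x y / y <= x => [hw|].
  by case: (leP y x) => [/hw //|/ltW /hw]; rewrite distrC [X in _ <= X]distrC.
rewrite (ger0_norm (_ : 0 <= x - y)) ?subr_ge0// ler_norml; apply/andP; split.
  have := @deriv_ge0_le (fun z => z + sin z) (fun z => 1 + cos z) y x.
  move=> /(_ _ _ xy) H; have {H} : y + sin y <= x + sin x.
    by apply: H => z _; have := cos_geN1 z; lra.
  lra.
have := @deriv_ge0_le (fun z => z - sin z) (fun z => 1 - cos z) y x.
move=> /(_ _ _ xy) H; have {H} : y - sin y <= x - sin x.
  by apply: H => z _; have := cos_le1 z; lra.
lra.
Qed.

Lemma sin_le_id x : 0 <= x -> sin x <= x.
Proof.
move=> x0; have := @deriv_ge0_le (fun z => z - sin z) (fun z => 1 - cos z) 0 x.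
move=> /(_ _ _ x0) H; have {H} : 0 - sin 0 <= x - sin x.
  by apply: H => z _; have := cos_le1 z; lra.
by rewrite sin0; lra.
Qed.

(** This bound and the next ones come from one another by integration: the difference of the two
    sides is monotone because its derivative is the previous bound. *)
Lemma cos_ge_taylor2 x : 0 <= x -> 1 - x ^+ 2 / 2 <= cos x.
Proof.
move=> x0.
have := @deriv_ge0_le (fun z => cos z + z ^+ 2 / 2) (fun z => z - sin z) 0 x.
move=> /(_ _ _ x0) H; have {H} : cos 0 + 0 ^+ 2 / 2 <= cos x + x ^+ 2 / 2.
  apply: H => [z|z /sin_le_id]; last lra.
  by apply: is_derive_eq; rewrite /GRing.scale /=; field.
by rewrite cos0 expr0n /=; lra.
Qed.

Lemma sin_ge_taylor3 x : 0 <= x -> x - x ^+ 3 / 6 <= sin x.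
Proof.
move=> x0.
have := @deriv_ge0_le (fun z => sin z - z + z ^+ 3 / 6)
  (fun z => cos z - (1 - z ^+ 2 / 2)) 0 x.
move=> /(_ _ _ x0) H; have {H} : sin 0 - 0 + 0 ^+ 3 / 6 <= sin x - x + x ^+ 3 / 6.
  apply: H => [z|z /cos_ge_taylor2]; last lra.
  by apply: is_derive_eq; rewrite /GRing.scale /=; field.
by rewrite sin0 expr0n /=; lra.
Qed.

Lemma cos_le_taylor4 x : 0 <= x -> cos x <= 1 - x ^+ 2 / 2 + x ^+ 4 / 24.
Proof.
move=> x0.
have := @deriv_ge0_le (fun z => 1 - z ^+ 2 / 2 + z ^+ 4 / 24 - cos z)
  (fun z => sin z - (z - z ^+ 3 / 6)) 0 x.
move=> /(_ _ _ x0) H.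
have {H} : 1 - 0 ^+ 2 / 2 + 0 ^+ 4 / 24 - cos 0 <= 1 - x ^+ 2 / 2 + x ^+ 4 / 24 - cos x.
  apply: H => [z|z /sin_ge_taylor3]; last lra.
  by apply: is_derive_eq; rewrite /GRing.scale /=; field.
by rewrite cos0 !expr0n /=; lra.
Qed.

Lemma sin_le_taylor5 x : 0 <= x -> sin x <= x - x ^+ 3 / 6 + x ^+ 5 / 120.
Proof.
move=> x0.
have := @deriv_ge0_le (fun z => z - z ^+ 3 / 6 + z ^+ 5 / 120 - sin z)
  (fun z => 1 - z ^+ 2 / 2 + z ^+ 4 / 24 - cos z) 0 x.
move=> /(_ _ _ x0) H.
have {H} : 0 - 0 ^+ 3 / 6 + 0 ^+ 5 / 120 - sin 0 <= x - x ^+ 3 / 6 + x ^+ 5 / 120 - sin x.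
  apply: H => [z|z /cos_le_taylor4]; last lra.
  by apply: is_derive_eq; rewrite /GRing.scale /=; field.
by rewrite sin0 !expr0n /=; lra.
Qed.

Lemma cabsD (x y : R[i]) : cabs (x + y) <= cabs x + cabs y.
Proof. exact: le_normcD. Qed.

Lemma cabs_expi x : cabs (expi x) = 1.
Proof.
by apply/eqP; rewrite -(@eqrXn2 _ 2) ?cabs_ge0// cabs2 csq_expi expr1n.
Qed.

End Trigonometry.

(** * Binary integers as real numbers *)

Section IntegerArithmetic.
Context {R : realType}.

(** Binary integers serve because the numerical check is evaluated on them by [vm_compute]. *)
Definition zr (z : Z) : R := (int_of_Z z)%:~R.

Implicit Types x y k : Z.

Lemma zrD x y : zr (Z.add x y) = zr x + zr y.
Proof. by rewrite /zr -rmorphD /=; congr (_%:~R); lia. Qed.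

Lemma zrM x y : zr (Z.mul x y) = zr x * zr y.
Proof. by rewrite /zr -rmorphM /=; congr (_%:~R); lia. Qed.

Lemma zrB x y : zr (Z.sub x y) = zr x - zr y.
Proof. by rewrite /zr -rmorphB /=; congr (_%:~R); lia. Qed.

Lemma zr_nat n : zr (Z.of_nat n) = n%:R.
Proof. by rewrite /zr -[RHS]/(n%:Z%:~R); congr (_%:~R); lia. Qed.

Lemma zr_le x y : Z.le x y -> zr x <= zr y.
Proof. by move=> xy; rewrite /zr ler_int; lia. Qed.

Lemma zr_lt x y : Z.lt x y -> zr x < zr y.
Proof. by move=> xy; rewrite /zr ltr_int; lia. Qed.

Lemma zr0 : zr Z0 = 0. Proof. by []. Qed.

Lemma zr_div x k : Z.lt Z0 k -> zr x / zr k - 1 <= zr (Z.div x k) <= zr x / zr k.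
Proof.
move=> k0; have zk : 0 < zr k by rewrite -zr0; exact: zr_lt.
have e : x = Z.add (Z.mul k (Z.div x k)) (Z.modulo x k) by apply: Z.div_mod; lia.
have [m0 m1] := Z.mod_pos_bound x k k0.
have : zr x = zr k * zr (Z.div x k) + zr (Z.modulo x k) by rewrite {1}e zrD zrM.
have := zr_le m0; have := zr_lt m1; rewrite zr0 => h1 h2 ->.
rewrite mulrDl (mulrC (zr k)) mulfK ?gt_eqF//.
have : 0 <= zr (Z.modulo x k) / zr k by rewrite divr_ge0 ?(ltW zk).
have : zr (Z.modulo x k) / zr k <= 1 by rewrite ler_pdivrMr ?mul1r// ltW.
lra.
Qed.

End IntegerArithmetic.

(** * Sine sums in fixed-point arithmetic *)

Section SineSums.

Variable fixS : Z.
Hypothesis fS : Z.lt Z0 fixS.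

(** Complex multiplication of numbers stored as multiples of 1/[fixS], both parts rounded down. *)
Definition mulZ (x y : Z * Z) : Z * Z :=
  (Z.div (Z.sub (Z.mul x.1 y.1) (Z.mul x.2 y.2)) fixS,
   Z.div (Z.add (Z.mul x.1 y.2) (Z.mul x.2 y.1)) fixS).

(* [p] and [w] stand for [e^{iky}] and [e^{iy}]. *)
Fixpoint sinsumZ (C : seq Z) (k : Z) (p w : Z * Z) : Z :=
  if C is c :: C' then
    Z.add (Z.div (Z.mul c p.2) k) (sinsumZ C' (Z.succ k) (mulZ p w) w)
  else Z0.

Context {R : realType}.
Local Notation S := (zr fixS : R).
Implicit Types (x y : R).

Definition cz (p : Z * Z) : R[i] := (zr p.1 / S) +i* (zr p.2 / S).

Lemma fixS_gt0 : 0 < S.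
Proof. by rewrite -zr0; exact: (zr_lt fS). Qed.

Lemma cz_mulZ (p w : Z * Z) : cabs (cz (mulZ p w) - cz p * cz w) <= 2 / S.
Proof.
have S0 := fixS_gt0.
apply: cabs_le_csq; first by rewrite divr_ge0// ltW.
case: p w => [a b] [c d].
rewrite /csq /cz /mulZ /=.
have /andP[] := @zr_div R (Z.sub (Z.mul a c) (Z.mul b d)) _ fS.
have /andP[] := @zr_div R (Z.add (Z.mul a d) (Z.mul b c)) _ fS.
rewrite zrB zrD !zrM.
set X := zr (Z.div _ _); set Y := zr (Z.div _ _).
set u := (_ + _) / S; set v := (_ - _) / S => h1 h2 h3 h4.
have -> : Y / S - (zr a / S * (zr c / S) - zr b / S * (zr d / S)) = (Y - v) / S.
  by rewrite /v; field; rewrite gt_eqF.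
have -> : X / S - (zr a / S * (zr d / S) + zr b / S * (zr c / S)) = (X - u) / S.
  by rewrite /u; field; rewrite gt_eqF.
rewrite !expr_div_n -mulrDl ler_pM2r ?invr_gt0 ?exprn_gt0//.
have : (Y - v) ^+ 2 <= 1 by nra.
have : (X - u) ^+ 2 <= 1 by nra.
lra.
Qed.

(** As long as e <= 1 the approximant p has modulus at most 2, so errors add up linearly over
    iterated products instead of being multiplied. *)
Lemma mulZ_err (p w : Z * Z) x y (e d : R) : e <= 1 ->
  cabs (cz p - expi x) <= e -> cabs (cz w - expi y) <= d ->
  cabs (cz (mulZ p w) - expi (x + y)) <= e + (2 * d + 2 / S).
Proof.
move=> e1 pe wd.
have -> : cz (mulZ p w) - expi (x + y) =
  (cz (mulZ p w) - cz p * cz w) + (cz p * (cz w - expi y) + (cz p - expi x) * expi y).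
  by rewrite expiD; ring.
have p2 : cabs (cz p) <= 2.
  have -> : cz p = (cz p - expi x) + expi x by rewrite subrK.
  by apply: le_trans (cabsD _ _) _; rewrite cabs_expi; lra.
have := cabsD (cz (mulZ p w) - cz p * cz w) (cz p * (cz w - expi y) + (cz p - expi x) * expi y).
have := cabsD (cz p * (cz w - expi y)) ((cz p - expi x) * expi y).
rewrite !cabsM cabs_expi mulr1.
have := cz_mulZ p w.
have : cabs (cz p) * cabs (cz w - expi y) <= 2 * d by apply: ler_pM; rewrite ?cabs_ge0.
lra.
Qed.

Lemma norm_Im_le (z : R[i]) : `|complex.Im z| <= cabs z.
Proof.
rewrite -(@ler_pXn2r _ 2) ?nnegrE ?cabs_ge0 ?normr_ge0// cabs2.
by rewrite real_normK ?num_real// csq_Im.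
Qed.

(** The computed value, less its error, bounds the true sum from below. In this direction the
    rounding down in the division by k costs nothing, and nonnegative coefficients let the errors of
    the sines be summed. *)
Lemma sinsumZ_le (C : seq Z) (k : nat) (p w : Z * Z) y (e d : R) : (0 < k)%N ->
  all (Z.leb Z0) C ->
  cabs (cz w - expi y) <= d -> cabs (cz p - expi (k%:R * y)) <= e ->
  e + (size C)%:R * (2 * d + 2 / S) <= 1 ->
  zr (sinsumZ C (Z.of_nat k) p w) / S <=
   \sum_(j < size C) zr (nth Z0 C j) * (sin ((k + j)%:R * y) / (k + j)%:R) +
   (e + (size C)%:R * (2 * d + 2 / S)) * \sum_(j < size C) zr (nth Z0 C j).
Proof.
move=> + + wd; have S0 := fixS_gt0.
have d0 : 0 <= d := le_trans (cabs_ge0 _) wd.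
have D0 : 0 <= 2 * d + 2 / S by apply: addr_ge0; [exact: mulr_ge0 | apply: divr_ge0 => //; exact: ltW].
elim: C k p e => [|c C IH] k p e k0.
  by move=> _ _ _; rewrite /= !big_ord0 mulr0 addr0 zr0 mul0r.
rewrite [all _ _]/= [size _]/= => /andP[c0 C0] pe.
have e0 : 0 <= e := le_trans (cabs_ge0 _) pe.
have ip : zr p.2 / S <= sin (k%:R * y) + e.
  have := le_trans (norm_Im_le _) pe.
  rewrite ler_norml => /andP[_]; set X := complex.Im _.
  rewrite (_ : X = zr p.2 / S - sin (k%:R * y))//; lra.
have s0 : 0 <= (size C)%:R * (2 * d + 2 / S) by rewrite mulr_ge0// ler0n.
rewrite -[(size C).+1%:R]natr1 [(_ + 1) * (2 * d + _)]mulrDl mul1r.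
set F := _%:R * _; set D := 2 * d + _ => e1.
have e1' : e <= 1 by rewrite /F /D in e1; lra.
have := IH k.+1 (mulZ p w) (e + D) isT C0.
rewrite -[k.+1%:R]natr1 [(_ + 1) * y]mulrDl mul1r => /(_ (mulZ_err e1' pe wd)).
rewrite -/F -/D; have -> : e + D + F = e + (F + D) by ring.
move=> /(_ e1); set E := e + _.
rewrite 2!big_ord_recl [sinsumZ (c :: C) _ _ _]/= -Znat.Nat2Z.inj_succ zrD.
rewrite [nth _ _ (ord0 : 'I__)]/= [(k + (ord0 : 'I__))%N]addn0.
have -> : \sum_(i < size C) zr (nth Z0 C i) * (sin ((k.+1 + i)%:R * y) / (k.+1 + i)%:R)
 = \sum_(i < size C) zr (nth Z0 (c :: C) (lift ord0 i)) *
     (sin ((k + lift ord0 i)%:R * y) / (k + lift ord0 i)%:R) :> R.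
  by apply: eq_bigr => i _; rewrite lift0 addnS addSn.
have -> : \sum_(i < size C) zr (nth Z0 (c :: C) (lift ord0 i)) = \sum_(i < size C) zr (nth Z0 C i) :> R.
  by apply: eq_bigr.
set A := \sum_(i < _) _; set B := \sum_(i < _) _; set X := zr (sinsumZ _ _ _ _).
have zc0 : 0 <= zr c :> R by rewrite -zr0; apply: zr_le; clear -c0; lia.
have k0' : (0 : R) < k%:R by rewrite ltr0n.
have : zr (Z.div (Z.mul c p.2) (Z.of_nat k)) / S <= zr c * (sin (k%:R * y) / k%:R) + E * zr c.
  have /andP[_] := @zr_div R (Z.mul c p.2) (Z.of_nat k) ltac:(clear -k0; lia).
  rewrite zrM zr_nat => h.
  apply: (@le_trans _ _ (zr c * ((sin (k%:R * y) + e) / k%:R))).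
    rewrite ler_pdivrMr// (le_trans h)//.
    rewrite -mulrA -[leRHS]mulrA ler_wpM2l// mulrAC ler_wpM2r ?invr_ge0 ?ler0n//.
    by rewrite -ler_pdivrMr.
  rewrite [(_ + e) / _]mulrDl mulrDr lerD2l mulrC ler_wpM2r//.
  rewrite ler_pdivrMr// (@le_trans _ _ E)//; first by rewrite /E /F /D; lra.
  by rewrite ler_peMr ?ler1n// /E /F /D; lra.
rewrite [E * (zr c + B)]mulrDr [(zr _ + X) / S]mulrDl.
lra.
Qed.

End SineSums.

(** * Integer coefficients of the sine sum *)

Section ChirpCoefficients.
Local Open Scope nat_scope.

Fixpoint natsumZ (f : nat -> Z) n : Z :=
  if n is m.+1 then Z.add (natsumZ f m) (f m) else Z0.

Definition natdist m n := (m - n) + (n - m).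

Variable b : seq Z.

(** The product of two adjacent sides, which is the frequency at which a parallelogram enters the
    sine sum. *)
Definition key (n1 n2 n4 : nat) := natdist n1 n2 * natdist n1 n4.

(** The fourth vertex is forced to be n1 + n3 - n2; the two comparisons guard the truncated
    subtraction and the range of the support. *)
Definition quadZ (k n1 n2 n3 : nat) : Z :=
  if n2 <= n1 + n3 then
    if n1 + n3 - n2 < size b then
      if key n1 n2 (n1 + n3 - n2) == k then
        Z.mul (Z.mul (nth Z0 b n1) (nth Z0 b n2))
              (Z.mul (nth Z0 b n3) (nth Z0 b (n1 + n3 - n2)))
      else Z0
    else Z0
  else Z0.

Definition coefZ k : Z :=
  natsumZ (fun n1 => natsumZ (fun n2 => natsumZ (fun n3 =>
    quadZ k n1 n2 n3) (size b)) (size b)) (size b).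

Definition keys_le K : bool :=
  all (fun n1 => all (fun n2 => all (fun n4 =>
    if n1 <= n2 + n4 then if n2 + n4 - n1 < size b then key n1 n2 n4 <= K else true else true)
  (iota 0 (size b))) (iota 0 (size b))) (iota 0 (size b)).

End ChirpCoefficients.

(** * The quartic form on modes with a quadratic phase *)

Section Chirp.
Context {R : realType}.
Variable L : R.
Hypothesis L0 : 0 < L.
Local Notation tau := (tau L).
Variable b : seq Z.
Local Notation N := (size b).

Definition chirp_support : seq int := [seq n%:Z | n <- iota 0 N].

(** The free evolution moves the parameter y linearly, from y at time 0 to y - 2 tau at time 1, so y
    sets the instant at which the phases line up. With y1 + y2 = 2 tau the range is from y1 to -y2,
    and the time average produces sines at y1 and y2. *)
Definition chirp (y : R) (n : int) : R[i] :=
  (zr (nth Z0 b `|n|%N))%:C * expi (y / 2 * n%:~R ^+ 2).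

Definition sinsum K (y : R) : R :=
  \sum_(j < K) zr (coefZ b j.+1) * (sin (j.+1%:R * y) / j.+1%:R).

Lemma chirp_support_uniq : uniq chirp_support.
Proof. by rewrite map_inj_uniq ?iota_uniq// => m n []. Qed.

Lemma zr_natsumZ f n : zr (natsumZ f n) = \sum_(i < n) zr (f i) :> R.
Proof. by elim: n => [|n IH]; rewrite ?big_ord0// big_ord_recr /= zrD IH. Qed.

Lemma sum_chirp_support (F : int -> R) : \sum_(n <- chirp_support) F n = \sum_(i < N) F i%:Z.
Proof. by rewrite /chirp_support big_map -(big_mkord xpredT (fun i : nat => F i%:Z)) /index_iota subn0. Qed.

Lemma S4_chirp_support (F : int -> int -> int -> int -> R) : S4 chirp_support F =
  \sum_(n1 < N) \sum_(n2 < N) \sum_(n3 < N) \sum_(n4 < N) F n1%:Z n2%:Z n3%:Z n4%:Z.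
Proof.
rewrite /S4; do 4 (rewrite sum_chirp_support; apply: eq_bigr => ? _).
by [].
Qed.

Lemma key_absz (n1 n2 n4 : nat) :
  key n1 n2 n4 = absz ((n1%:Z - n2%:Z) * (n1%:Z - n4%:Z)).
Proof. by rewrite abszM /key /natdist; congr (_ * _)%N; lia. Qed.

(** sin(q y)/q is even in q: the signs of the sides drop out and only the product of their lengths
    is left. *)
Lemma sin_sum_even (y1 y2 : R) (q : int) : q != 0 -> 0 < tau ->
  (sin (y1 * q%:~R) + sin (y2 * q%:~R)) / (tau * (2 * q%:~R)) =
  (sin (`|q|%N%:R * y1) / `|q|%N%:R + sin (`|q|%N%:R * y2) / `|q|%N%:R) / (2 * tau).
Proof.
move=> q0 t0.
have qR : q%:~R != 0 :> R by rewrite intr_eq0.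
have tt : tau != 0 by rewrite gt_eqF.
have [h|h] := leP 0 q.
  have -> : `|q|%N%:R = q%:~R :> R by rewrite -[in RHS](gez0_abs h).
  by rewrite !(mulrC q%:~R); field; rewrite tt qR.
have -> : `|q|%N%:R = - q%:~R :> R.
  by rewrite -mulrNz -[in RHS](@gez0_abs (- q)) ?abszN//; lia.
by rewrite !mulNr !sinN !(mulrC q%:~R); field; rewrite tt qR.
Qed.

(** The four phases combine into y1 q, with q the signed product of the sides, and the dispersion is
    (y1 + y2) q; the real part is the average of the cosine between -y2 q and y1 q. *)
Lemma nterm_chirp (y1 y2 : R) (n1 n2 n3 n4 : nat) : y1 + y2 = 2 * tau ->
  nterm L (chirp y1) n1%:Z n2%:Z n3%:Z n4%:Z =
  [&& par n1%:Z n2%:Z n3%:Z n4%:Z, n1 != n2 & n1 != n4]%:R *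
  (zr (nth Z0 b n1) * zr (nth Z0 b n2) * (zr (nth Z0 b n3) * zr (nth Z0 b n4)) *
  ((sin ((key n1 n2 n4)%:R * y1) / (key n1 n2 n4)%:R +
    sin ((key n1 n2 n4)%:R * y2) / (key n1 n2 n4)%:R) / (2 * tau))).
Proof.
move=> y12; rewrite /nterm !eqz_nat; case: (boolP [&& _, _ & _]); last by rewrite !mul0r.
move=> /and3P[pq h2 h4]; rewrite !mul1r.
have t0 := tau_gt0 L0.
set q : int := (n1%:Z - n2%:Z) * (n1%:Z - n4%:Z).
have q0 : q != 0 by rewrite mulf_eq0 !subr_eq0 !eqz_nat negb_or h2.
rewrite key_absz -/q -sin_sum_even// disp4_par// -rmorphM/= -/q.
set B := zr _ * zr _ * _.
have -> : prod4 (chirp y1) n1%:Z n2%:Z n3%:Z n4%:Z = B%:C * expi (y1 * q%:~R).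
  rewrite /prod4 /chirp !absz_nat !conjM -!expiN.
  have cr (x : R) : x%:C^*%C = x%:C by rewrite /= oppr0.
  rewrite !cr.
  have e : y1 * q%:~R = y1 / 2 * n1%:~R ^+ 2 + (- (y1 / 2 * n2%:~R ^+ 2)) +
     y1 / 2 * n3%:~R ^+ 2 + (- (y1 / 2 * n4%:~R ^+ 2)).
    have h : n3 = n2%:Z + n4%:Z - n1%:Z :> int by move: pq; rewrite /par => /eqP; lia.
    by rewrite h /q rmorphM !rmorphB rmorphD /=; field.
  rewrite e !expiD /B !rmorphM /=; ring.
set a := tau * _.
have a0 : a != 0 by apply: mulf_neq0; [rewrite gt_eqF | apply: mulf_neq0; rewrite ?pnatr_eq0 ?intr_eq0].
rewrite /kap (negPf a0) /=.
have -> : y2 * q%:~R = a - y1 * q%:~R.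
  have -> : y2 = 2 * tau - y1 by rewrite -y12; ring.
  by rewrite /a; ring.
by rewrite sinB; field.
Qed.

Lemma zr_coefZ k (x : R) : zr (coefZ b k) * x =
  \sum_(n1 < N) \sum_(n2 < N) \sum_(n3 < N) zr (quadZ b k n1 n2 n3) * x.
Proof.
rewrite /coefZ zr_natsumZ mulr_suml; apply: eq_bigr => n1 _.
rewrite zr_natsumZ mulr_suml; apply: eq_bigr => n2 _.
by rewrite zr_natsumZ mulr_suml.
Qed.

(** Given n1, n2, n3, at most one n4 and one key contribute. Key 0 marks a degenerate parallelogram
    and is excluded on both sides, the sine sum starting at frequency 1. *)
Lemma sum4_sinsum K (y : R) : keys_le b K ->
  \sum_(n1 < N) \sum_(n2 < N) \sum_(n3 < N) \sum_(n4 < N)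
   ([&& par n1%:Z n2%:Z n3%:Z n4%:Z, n1 != n2 :> nat & n1 != n4 :> nat]%:R *
   (zr (nth Z0 b n1) * zr (nth Z0 b n2) * (zr (nth Z0 b n3) * zr (nth Z0 b n4)) *
    (sin ((key n1 n2 n4)%:R * y) / (key n1 n2 n4)%:R))) = sinsum K y.
Proof.
move=> kb; rewrite /sinsum.
under [RHS]eq_bigr do rewrite zr_coefZ.
rewrite [RHS]exchange_big; apply: eq_bigr => n1 _.
rewrite [RHS]exchange_big; apply: eq_bigr => n2 _.
rewrite [RHS]exchange_big; apply: eq_bigr => n3 _.
have pE (n4 : nat) : par n1%:Z n2%:Z n3%:Z n4%:Z = (n1 + n3 == n2 + n4)%N.
  by rewrite /par -!PoszD eqz_nat.
have [le24|lt24] := leqP n2 (n1 + n3); last first.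
  rewrite [RHS]big1 => [|j _]; last by rewrite /quadZ leqNgt lt24 zr0 mul0r.
  apply: big1 => n4 _; rewrite pE; case: eqP => [e|_]; last by rewrite mul0r.
  by move: lt24; rewrite e ltnNge leq_addr.
have [ltN|leN] := ltnP (n1 + n3 - n2) N; last first.
  rewrite [RHS]big1 => [|j _]; last by rewrite /quadZ le24 ltnNge leN zr0 mul0r.
  apply: big1 => n4 _; rewrite pE; case: eqP => [e|_]; last by rewrite mul0r.
  by move: leN; rewrite e addKn leqNgt ltn_ord.
pose n4 := Ordinal ltN.
have e : (n1 + n3 = n2 + n4)%N by rewrite /= subnKC.
rewrite (bigD1 n4)//= [X in _ + X]big1 ?addr0 => [|n4' ne]; last first.
  rewrite pE; case: eqP => [e'|_]; last by rewrite mul0r.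
  by case/eqP: ne; apply: val_inj; rewrite /= e' addKn.
rewrite pE /quadZ le24 ltN subnKC// eqxx /= -[(n1 + n3 - n2)%N]/(nat_of_ord n4).
have kE : (n1 != n2 :> nat) && (n1 != n4 :> nat) = (0 < key n1 n2 n4)%N.
  by rewrite /key muln_gt0; congr andb; rewrite /natdist; lia.
rewrite kE; case: (posnP (key n1 n2 n4)) => [->|k0].
  by rewrite mul0r big1// => j _; rewrite zr0 mul0r.
have kK : (key n1 n2 n4 <= K)%N.
  move/allP: kb => /(_ n1); rewrite mem_iota add0n ltn_ord => /(_ isT).
  move=> /allP /(_ n2); rewrite mem_iota add0n ltn_ord => /(_ isT).
  move=> /allP /(_ n4); rewrite mem_iota add0n ltn_ord => /(_ isT).
  by rewrite -e leq_addr addKn ltn_ord.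
have k1 : ((key n1 n2 n4).-1 < K)%N by rewrite prednK.
rewrite (bigD1 (Ordinal k1))//= prednK// eqxx mul1r !zrM big1 ?addr0// => j jk.
case: eqP => [ek|_]; last by rewrite zr0 mul0r.
by case/eqP: jk; apply: val_inj; rewrite /= ek.
Qed.

(** Q - 2 m^2 is the sum of the two sine sums over 2 tau, minus the fourth powers of [qform_split];
    the hypothesis is its positivity multiplied by 2 tau. *)
Lemma qform_chirp K (y1 y2 : R) : keys_le b K -> y1 + y2 = 2 * tau ->
  (\sum_(n < N) zr (nth Z0 b n) ^+ 4) * (y1 + y2) < sinsum K y1 + sinsum K y2 ->
  2 * mass chirp_support (chirp y1) ^+ 2 < qform L chirp_support (chirp y1).
Proof.
move=> kb y12; rewrite y12 => hlt.
have t0 : 0 < 2 * tau by rewrite mulr_gt0// tau_gt0.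
rewrite qform_split ?chirp_support_uniq// sum_chirp_support.
under eq_bigr do rewrite /chirp csqM csq_real csq_expi mulr1 -exprM.
rewrite /nform S4_chirp_support.
set X := \sum_(i < N) \sum_(j < N) _.
suff : X = (sinsum K y1 + sinsum K y2) / (2 * tau).
  by move=> ->; move: hlt; rewrite -ltr_pdivlMr//; lra.
rewrite /X -!(sum4_sinsum _ kb) -!big_split mulr_suml; apply: eq_bigr => n1 _.
rewrite -!big_split mulr_suml; apply: eq_bigr => n2 _.
rewrite -!big_split mulr_suml; apply: eq_bigr => n3 _.
rewrite -!big_split mulr_suml; apply: eq_bigr => n4 _.
rewrite (nterm_chirp _ _ _ _ y12) /=; ring.
Qed.

End Chirp.

(** * Lower bound of a sine sum on a grid of step 1/64 *)

Section Grid.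

Definition grid_scale : Z := Z.pow_pos 2 30.

(** e^(i/64) at scale 2^30: 1 - x^2/2 and x - x^3/6 at x = 1/64, with 2^12/6 rounded to 683. *)
Definition grid_base : Z * Z :=
  (Z.sub grid_scale (Z.pow_pos 2 17),
   Z.sub (Z.pow_pos 2 24) (Z.of_nat 683)).

Definition grid_pt i : Z * Z :=
  iter i (fun w => mulZ grid_scale w grid_base) (grid_scale, Z0).

(** At scale 2^30, the sine sum minus c0 y at y = i/64; the factor 2^24 is 2^30/64. *)
Definition psiZ (C : seq Z) (c0 : Z) (w : Z * Z) i : Z :=
  Z.sub (sinsumZ grid_scale C (Z.of_nat 1) w w)
        (Z.mul (Z.mul c0 (Z.of_nat i)) (Z.pow_pos 2 24)).

Definition grid_psi (C : seq Z) (c0 : Z) i : Z := psiZ C c0 (grid_pt i) i.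

Fixpoint psi_scan (C : seq Z) (c0 bound : Z) (w : Z * Z) i len : bool :=
  if len is l.+1 then
    if Z.ltb bound (psiZ C c0 w i)
    then psi_scan C c0 bound (mulZ grid_scale w grid_base) i.+1 l else false
  else true.

Lemma psi_scanP C c0 bound i len j : psi_scan C c0 bound (grid_pt i) i len ->
  j \in iota i len -> Z.lt bound (grid_psi C c0 j).
Proof.
elim: len i => [//|l IH] i /=; case: (Z.ltb_spec bound _) => // h.
move=> /(IH i.+1) H; rewrite inE => /orP[/eqP ->|] //.
Qed.

Definition sumZ (C : seq Z) : Z := foldr Z.add Z0 C.

Definition pow4Z z := Z.mul (Z.mul z z) (Z.mul z z).

(** The 2^24 term is one grid step times [sumZ C] + c0, which bounds the loss between grid points.
    The 2^21 term, 1/512 of the scale, covers the rounding errors of both evaluations. *)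
Definition grid_check (C : seq Z) (c0 : Z) i1 i2 len : bool :=
  all (Z.leb Z0) C &&
  psi_scan C c0 (Z.sub (Z.add (Z.mul (Z.add (sumZ C) c0) (Z.pow_pos 2 24))
                              (Z.mul (sumZ C) (Z.pow_pos 2 21)))
                       (grid_psi C c0 i1)) (grid_pt i2) i2 len.

Context {R : realType}.
Local Notation S := (zr grid_scale : R).

Lemma zr_pow2 n : zr (Z.pow_pos 2 n) = 2 ^+ (Pos.to_nat n) :> R.
Proof.
rewrite Zpower.Zpower_pos_nat; elim: (Pos.to_nat n) => [|m IH]; first by rewrite expr0.
by rewrite Zpower.Zpower_nat_succ_r zrM IH exprS; congr (_ * _); rewrite -[2%:R]zr_nat.
Qed.

Lemma grid_scaleE : S = 2 ^+ 30.
Proof. by rewrite zr_pow2; congr (_ ^+ _); lia. Qed.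

Lemma grid_scale_gt0 : Z.lt Z0 grid_scale.
Proof. by []. Qed.

Lemma grid_base_err : cabs (cz grid_scale grid_base - expi (64^-1 : R)) <= 3 / 10 ^+ 9.
Proof.
apply: cabs_le_csq; first by rewrite divr_ge0// exprn_ge0.
have x0 : (0 : R) <= 64^-1 by rewrite invr_ge0.
have := cos_ge_taylor2 x0; have := cos_le_taylor4 x0.
have := sin_ge_taylor3 x0; have := sin_le_taylor5 x0.
have -> : csq (cz grid_scale grid_base - expi (64^-1 : R)) =
   ((zr grid_base.1 / S) - cos (64^-1 : R)) ^+ 2 + ((zr grid_base.2 / S) - sin (64^-1 : R)) ^+ 2 by [].
have -> : zr grid_base.1 = 2 ^+ 30 - 2 ^+ 17 :> R.
  transitivity (zr grid_scale - zr (Z.pow_pos 2 17) : R); first exact: zrB.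
  by congr (_ - _); rewrite zr_pow2; congr (_ ^+ _); lia.
have -> : zr grid_base.2 = 2 ^+ 24 - 683 :> R.
  rewrite -[683]zr_nat.
  transitivity (zr (Z.pow_pos 2 24) - zr (Z.of_nat 683) : R).
    exact: zrB.
  by congr (_ - _); rewrite zr_pow2; congr (_ ^+ _); lia.
rewrite grid_scaleE.
set c := cos _; set s := sin _.
have -> : (2 ^+ 30 - 2 ^+ 17) / 2 ^+ 30 = 1 - (64^-1) ^+ 2 / 2 :> R by field.
set X := (_ - _) / _.
have : `|X - (64^-1 - (64^-1) ^+ 3 / 6)| <= (10 ^+ 9)^-1 by rewrite ler_norml /X; lra.
rewrite ler_norml => /andP[X1 X2] s1 s2 c1 c2.
have h1 : - (25 / 10 ^+ 10) <= 1 - 64^-1 ^+ 2 / 2 - c <= 0 by apply/andP; split; lra.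
have h2 : - (11 / 10 ^+ 10) <= X - s <= 11 / 10 ^+ 10 by apply/andP; split; lra.
move: h1 h2; set A := _ - c; set B := _ - s => h1 h2.
have : A ^+ 2 <= (25 / 10 ^+ 10) ^+ 2 by nra.
have : B ^+ 2 <= (11 / 10 ^+ 10) ^+ 2 by nra.
lra.
Qed.

(* Unification would otherwise evaluate the power. *)
Opaque grid_scale.

(** Each product adds twice the error 3/10^9 of [grid_base] and a rounding 2/2^30, together below
    8/10^9. Indices up to 311 cover the grid that is scanned. *)
Lemma grid_pt_err i : (i <= 311)%N ->
  cabs (cz grid_scale (grid_pt i) - expi (i%:R * (64^-1 : R))) <= i%:R * (8 / 10 ^+ 9).
Proof.
have S0 := fixS_gt0 (R := R) grid_scale_gt0.
elim: i => [_|i IH ilt].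
  rewrite mul0r expi0 mul0r (_ : grid_pt 0 = (grid_scale, Z0))//.
  have -> : cz grid_scale (grid_scale, Z0) = 1 :> R[i].
    have S1 : S != 0 by rewrite (gt_eqF S0).
    by rewrite /cz [fst _]/= [snd _]/= zr0 mul0r (divff S1).
  by rewrite subrr; apply: cabs_le_csq => //; rewrite csq0 expr0n.
have ile : (i <= 311)%N by exact: ltnW.
have iR : i%:R <= 311 :> R by rewrite ler_nat.
have := mulZ_err grid_scale_gt0 _ (IH ile) grid_base_err.
have e1 : i%:R * (8 / 10 ^+ 9) <= 1 :> R by lra.
move=> /(_ e1) h.
have -> : i.+1%:R * 64^-1 = i%:R * 64^-1 + 64^-1 :> R by rewrite -natr1 mulrDl mul1r.
have -> : i.+1%:R * (8 / 10 ^+ 9) = i%:R * (8 / 10 ^+ 9) + 8 / 10 ^+ 9 :> R.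
  by rewrite -natr1 mulrDl mul1r.
apply: (le_trans h); rewrite lerD2l grid_scaleE; lra.
Qed.

Lemma zr_sumZ C : zr (sumZ C) = \sum_(j < size C) zr (nth Z0 C j) :> R.
Proof. by elim: C => [|c C IH]; rewrite ?big_ord0// big_ord_recl /= zrD IH. Qed.

Definition sinC (C : seq Z) (y : R) : R :=
  \sum_(j < size C) zr (nth Z0 C j) * (sin (j.+1%:R * y) / j.+1%:R).

Lemma grid_psi_le (C : seq Z) (c0 : Z) i : (i <= 311)%N -> (size C <= 90)%N ->
  all (Z.leb Z0) C ->
  zr (grid_psi C c0 i) / S <=
  sinC C (i%:R * 64^-1) - zr c0 * (i%:R * 64^-1) + (10 ^+ 3)^-1 / 2 * zr (sumZ C).
Proof.
move=> i3 sC C0.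
have iR : i%:R <= 311 :> R by rewrite ler_nat.
have sR : (size C)%:R <= 90 :> R by rewrite ler_nat.
have i0 : 0 <= i%:R :> R by exact: ler0n.
have s0 : 0 <= (size C)%:R :> R by exact: ler0n.
have sum0 : 0 <= zr (sumZ C) :> R.
  rewrite zr_sumZ; apply: sumr_ge0 => j _; rewrite -zr0; apply: zr_le.
  by move/all_nthP: C0 => /(_ Z0 j (ltn_ord j)); lia.
have w : cabs (cz grid_scale (grid_pt i) - expi (i%:R * (64^-1 : R))) <= 25 / 10 ^+ 7.
  by apply: le_trans (grid_pt_err i3) _; lra.
have w1 : cabs (cz grid_scale (grid_pt i) - expi (1%:R * (i%:R * (64^-1 : R)))) <= 25 / 10 ^+ 7.
  by rewrite mul1r.
have := sinsumZ_le (k := 1) grid_scale_gt0 isT C0 w w1.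
have SE : 2 / S <= (10 ^+ 8)^-1 by rewrite grid_scaleE; lra.
have S0 : 0 <= 2 / S by rewrite grid_scaleE; apply: divr_ge0; rewrite ?exprn_ge0.
set D := 2 * _ + 2 / S; set E := _ + _ * D.
have D0 : 0 <= D by rewrite /D; lra.
have D1 : D <= 501 / 10 ^+ 8 by rewrite /D; lra.
have sD : (size C)%:R * D <= 90 * (501 / 10 ^+ 8) by apply: ler_pM.
have E1 : E <= 1 by rewrite /E; lra.
have E2 : E <= (10 ^+ 3)^-1 / 2 by rewrite /E; lra.
move=> /(_ E1) h.
have : zr (Z.pow_pos 2 24) = 2 ^+ 24 :> R by rewrite zr_pow2; congr (_ ^+ _); lia.
rewrite /grid_psi /psiZ; move: (Z.pow_pos 2 24) => p pE.
rewrite zrB (zrM _ p) (zrM c0) zr_nat pE mulrBl.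
have -> : zr c0 * i%:R * 2 ^+ 24 / S = zr c0 * (i%:R * 64^-1) :> R.
  by rewrite grid_scaleE; field.
have : E * zr (sumZ C) <= (10 ^+ 3)^-1 / 2 * zr (sumZ C) by apply: ler_wpM2r.
move: h; rewrite -zr_sumZ /sinC.
under eq_bigr do rewrite add1n.
lra.
Qed.

(** The division by j makes every sin(j y)/j 1-Lipschitz, so the constant is the plain sum of the
    coefficients. *)
Lemma sinC_lipschitz (C : seq Z) (x y : R) : all (Z.leb Z0) C -> x <= y ->
  sinC C x - zr (sumZ C) * (y - x) <= sinC C y.
Proof.
move=> C0 xy; rewrite lerBlDr /sinC zr_sumZ mulr_suml -big_split /=.
apply: ler_sum => j _.
have cj : 0 <= zr (nth Z0 C j) :> R.
  rewrite -zr0; apply: zr_le.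
  by move/all_nthP: C0 => /(_ Z0 j (ltn_ord j)); lia.
rewrite -mulrDr ler_wpM2l// -lerBlDl -mulrBl ler_pdivrMr ?ltr0Sn//.
apply: le_trans (ler_norm _) _; apply: le_trans (sin_lipschitz _ _) _.
rewrite -mulrBr normrM ger0_norm ?ler0n// mulrC distrC ger0_norm ?subr_ge0//.
Qed.

(** From the grid point just below y, the sine sum falls by at most [sumZ C]/64 and c0 y grows by at
    most c0/64, a loss included in the check. *)
Lemma grid_check_gt0 (C : seq Z) (c0 : Z) i1 i2 len (y : R) :
  grid_check C c0 i1 i2 len -> Z.le Z0 c0 ->
  (i1 <= 311)%N -> (i2 + len <= 312)%N -> (size C <= 90)%N ->
  i2%:R <= 64 * y < (i2 + len)%:R ->
  zr c0 * (i1%:R * 64^-1 + y) < sinC C (i1%:R * 64^-1) + sinC C y.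
Proof.
move=> /andP[C0 /psi_scanP chk] c00 h1 h2 sC /andP[y1 y2].
pose i := Num.truncn (64 * y).
have y0 : 0 <= 64 * y by apply: le_trans y1; exact: ler0n.
have /andP[i_le i_gt] : i%:R <= 64 * y < i.+1%:R by exact: truncn_itv.
have i2i : (i2 <= i)%N by rewrite -ltnS -(ltr_nat R); exact: le_lt_trans i_gt.
have ii2 : (i < i2 + len)%N by rewrite -(ltr_nat R); exact: le_lt_trans y2.
have /chk : i \in iota i2 len by rewrite mem_iota i2i.
move=> /(zr_lt (R := R)); rewrite zrB.
have := zr_pow2 24; have := zr_pow2 21; move: (Z.pow_pos 2 24) (Z.pow_pos 2 21) => p q.
have -> : Pos.to_nat 24 = 24%N by lia.
have -> : Pos.to_nat 21 = 21%N by lia.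
move=> qE pE; rewrite [zr (Z.add _ _)]zrD !zrM zrD pE qE.
have i3 : (i <= 311)%N by lia.
have := grid_psi_le c0 i3 sC C0; have := grid_psi_le c0 h1 sC C0.
have S0 := fixS_gt0 (R := R) grid_scale_gt0.
rewrite !ler_pdivrMr// grid_scaleE.
have iy : i%:R * 64^-1 <= y by lra.
have := sinC_lipschitz C0 iy.
have sum0 : 0 <= zr (sumZ C) :> R.
  rewrite zr_sumZ; apply: sumr_ge0 => j _; rewrite -zr0; apply: zr_le.
  by move/all_nthP: C0 => /(_ Z0 j (ltn_ord j)); lia.
have c0R : 0 <= zr c0 :> R by rewrite -zr0; exact: zr_le.
have iy' : y - i%:R * 64^-1 <= 64^-1 by rewrite (_ : i.+1%:R = i%:R + 1 :> R) -?[in LHS]natr1// in i_gt; lra.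
have : zr (sumZ C) * (y - i%:R * 64^-1) <= zr (sumZ C) * 64^-1 by apply: ler_wpM2l.
have : zr c0 * (y - i%:R * 64^-1) <= zr c0 * 64^-1 by apply: ler_wpM2l.
lra.
Qed.

End Grid.

(** * Data above the resonant value *)

Section StrictInequality.
Context {R : realType}.
Variable L : R.
Hypothesis L0 : 0 < L.
Local Notation tau := (tau L).

(* Approximate maximisers found numerically. *)
Definition bell3 : seq Z := [seq Z.of_nat n | n <- [:: 5; 6; 5]].

Definition bell13 : seq Z :=
  [seq Z.of_nat n | n <- [:: 4; 5; 6; 6; 7; 7; 7; 7; 7; 6; 6; 5; 4]].

(** 36 = 6 * 6 is the largest product of adjacent sides of a parallelogram within thirteen
    consecutive integers. The first phase is fixed at 22/64, so that only the second varies with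
    tau. *)
Lemma grid_check_bell13 : keys_le bell13 36 &&
  grid_check [seq coefZ bell13 j.+1 | j <- iota 0 36] (sumZ (map pow4Z bell13)) 22 106 204.
Proof. by vm_compute. Qed.

Lemma zr_pow4Z z : zr (pow4Z z) = zr z ^+ 4 :> R.
Proof. by rewrite /pow4Z !zrM; ring. Qed.

Lemma sum_pow4 b : zr (sumZ (map pow4Z b)) = \sum_(n < size b) zr (nth Z0 b n) ^+ 4 :> R.
Proof.
rewrite zr_sumZ size_map; apply: eq_bigr => n _.
by rewrite (nth_map Z0)// zr_pow4Z.
Qed.

Lemma sinsumE b K (y : R) : sinsum b K y = sinC [seq coefZ b j.+1 | j <- iota 0 K] y.
Proof.
rewrite /sinC size_map size_iota; apply: eq_bigr => j _.
by rewrite (nth_map 0%N) ?size_iota// nth_iota.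
Qed.

Lemma qform_bell13 : 1 <= tau -> tau <= 259 / 100 ->
  2 * mass (chirp_support bell13) (chirp bell13 (22%:R * 64^-1)) ^+ 2 <
  qform L (chirp_support bell13) (chirp bell13 (22%:R * 64^-1)).
Proof.
move=> t1 t2.
have c0 : Z.le Z0 (sumZ (map pow4Z bell13)) by apply: Zbool.Zle_bool_imp_le.
have sC : (size [seq coefZ bell13 j.+1 | j <- iota 0 36] <= 90)%N by rewrite size_map size_iota.
(* 64 y2 = 128 tau - 22 runs over [106, 309.52] when tau runs over [1, 2.59]. *)
have yi : 106%:R <= 64 * (2 * tau - 22%:R * 64^-1) < (106 + 204)%:R by apply/andP; split; lra.
have /andP[kb chk] := grid_check_bell13.
apply: (@qform_chirp _ _ L0 _ 36 _ (2 * tau - 22%:R * 64^-1) kb); first by ring.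
rewrite !sinsumE -sum_pow4.
exact: (grid_check_gt0 chk c0 isT isT sC yi).
Qed.

(** With the symmetric phases y1 = y2 = tau the only key is 1, with coefficient 3600, against a sum
    of fourth powers 2546; sin tau >= 5 tau/6 suffices because 3000 > 2546. *)
Lemma qform_bell3 : tau <= 1 ->
  2 * mass (chirp_support bell3) (chirp bell3 tau) ^+ 2 <
  qform L (chirp_support bell3) (chirp bell3 tau).
Proof.
move=> t1; have t0 := tau_gt0 L0.
apply: (@qform_chirp _ _ L0 _ 1 _ tau) => //; first by ring.
rewrite /sinsum !big_ord_recl !big_ord0 /=.
have -> : coefZ bell3 1 = Z.mul (Z.of_nat 60) (Z.of_nat 60) by vm_compute.
rewrite zrM !zr_nat !mul1r.
have := sin_ge_taylor3 (ltW t0).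
have : tau ^+ 3 <= tau by rewrite exprS ler_piMr ?(ltW t0)// exprn_ile1// ltW.
by lra.
Qed.

Lemma qform_gt_resonant : tau <= 259 / 100 ->
  exists s (c : int -> R[i]), uniq s /\ 2 * mass s c ^+ 2 < qform L s c.
Proof.
move=> t2; case: (leP tau 1) => [t1|/ltW t1].
  exists (chirp_support bell3), (chirp bell3 tau).
  by split; [exact: chirp_support_uniq | exact: qform_bell3].
exists (chirp_support bell13), (chirp bell13 (22%:R * 64^-1)).
by split; [exact: chirp_support_uniq | exact: qform_bell13].
Qed.

End StrictInequality.

(** * Mass and quartic functional *)

Section Functionals.
Context {R : realType}.
Local Notation mu := (@lebesgue_measure R).
Variable L : R.
Hypothesis L0 : 0 < L.
Local Notation D := (`[0, L]%classic : set R).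
Implicit Types (u v : R -> R[i]) (s : seq int) (c : int -> R[i]).

(** The division by L makes [massu] and [Qu] agree with [mass] and [qform] on trigonometric
    polynomials. *)
Definition massu u : R := L^-1 * fine (sqn L u).

Definition Qu u : R := L^-1 * fine (quart L (fun t => T L t u)).

Lemma massu_ge0 u : 0 <= massu u.
Proof. by rewrite mulr_ge0 ?invr_ge0 ?(ltW L0)// fine_ge0// sqn_ge0. Qed.

Lemma Qu_ge0 u : 0 <= Qu u.
Proof. by rewrite mulr_ge0 ?invr_ge0 ?(ltW L0)// fine_ge0// quart_ge0. Qed.

Lemma massu_trig s c : uniq s -> massu (trig L s c) = mass s c.
Proof. by move=> us; rewrite /massu sqn_trig//= mulKf// gt_eqF. Qed.

Lemma massuD_young (s : R) u v : 0 < s -> L2per L u -> L2per L v ->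
  massu (fun x => u x + v x) <= (1 + s) * massu u + (1 + s^-1) * massu v.
Proof.
move=> s0 Lu Lv; rewrite /massu !(mulrCA _ L^-1) -mulrDr ler_pM2l ?invr_gt0//.
have := sqn_young L s0 (L2per_meas Lu) (L2per_meas Lv).
rewrite -[sqn L u]fineK ?L2per_fin// -[sqn L v]fineK ?L2per_fin//.
rewrite -[leLHS]fineK; last exact: L2per_fin (L2perD Lu Lv).
by rewrite -!EFinM -EFinD lee_fin.
Qed.

Lemma massuD_le u v : L2per L u -> L2per L v ->
  massu (fun x => u x + v x) <= 2 * massu u + 2 * massu v.
Proof. by move=> Lu Lv; have := massuD_young ltr01 Lu Lv; rewrite invr1; lra. Qed.

Lemma massuZ z u : L2per L u -> massu (fun x => z * u x) = csq z * massu u.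
Proof.
move=> Lu; rewrite /massu (sqnZ _ z (L2per_meas Lu)).
by rewrite fineM ?L2per_fin//= mulrCA.
Qed.

Lemma massuN u : massu (fun x => - u x) = massu u.
Proof. by rewrite /massu sqnN. Qed.

Lemma massuBC u v : massu (fun x => u x - v x) = massu (fun x => v x - u x).
Proof.
rewrite -(massuN (fun x => u x - v x)); congr massu.
by apply/funext => x; rewrite opprB.
Qed.

Lemma massu_efun n u : L2per L u -> massu (fun x => efun L n x * u x) = massu u.
Proof.
move=> Lu; rewrite /massu /sqn.
by under eq_integral do rewrite csqM csq_efun mul1r.
Qed.

Lemma massu_ext u v : L2per L u -> L2per L v ->
  (forall n, fourier L u n = fourier L v n) -> massu u = massu v.
Proof.
move=> Lu Lv uv; rewrite /massu (sqn_ae (L2per_meas Lu) (L2per_meas Lv))//.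
exact: fourier_ae_eq.
Qed.

Lemma msumE c N : msum c N = mass (zrange N) c.
Proof. by []. Qed.

Lemma msum_massu u N : L2per L u -> msum (fourier L u) N <= massu u.
Proof. by move=> Lu; exact: msum_bessel. Qed.

Lemma massu_truncE u N : L2per L u ->
  massu (fun x => u x - trig L (zrange N) (fourier L u) x) =
  massu u - msum (fourier L u) N.
Proof.
move=> Lu; rewrite /massu bessel_eq ?zrange_uniq// mulrBr mulKf//.
by rewrite gt_eqF.
Qed.

(** The remainder of u has the same coefficients as the fast limit at time 0 minus its partial sum,
    which is small by construction; by uniqueness the masses agree. *)
Lemma massu_parseval u : L2per L u -> forall e, 0 < e ->
  exists N, forall M, (N <= M)%N -> massu u - msum (fourier L u) M < e.
Proof.
move=> Lu e e0.
have [W [psi [[_ LW FW] _ hW]]] := propagation_exists L0 Lu.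
have e20 : 0 < e / 2 * L by rewrite mulr_gt0// divr_gt0.
have [j0 /(_ j0 (leqnn _)) hj] := expr8_small e20.
exists (psi j0) => M jM.
suff h : massu u - msum (fourier L u) (psi j0) < e.
  apply: le_lt_trans h; rewrite lerD2l lerN2; exact: msum_homo.
rewrite -massu_truncE//.
have ph n : phase L 0 n = 1 :> R[i] by rewrite /phase mulr0 oppr0 expi0.
have := hW 0 j0.
set w := fun x => W 0 x - _ => hw.
have Lw : L2per L w by apply: L2perB; [exact: LW | exact: L2per_trig].
have Lt := L2per_trig L0 (zrange (psi j0)) (fourier L u).
have Lp : L2per L (fun x => partial_wave L (fourier L u) (psi j0) 0 x) by exact: L2per_trig.
have uw n : fourier L (fun x => u x - trig L (zrange (psi j0)) (fourier L u) x) n = fourier L w n.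
  rewrite (fourierB L0 n Lu Lt) (fourierB L0 n (LW 0) Lp) FW mulr0 oppr0 expi0 mul1r.
  congr (_ - fourier L _ n).
  by apply: eq_trig => k _; rewrite ph mul1r.
rewrite (massu_ext (L2perB Lu Lt) Lw uw).
apply: (@le_lt_trans _ _ (e / 2)); last by rewrite ltr_pdivrMr// ltr_pMr// ltrDl.
rewrite /massu mulrC ler_pdivrMr//; apply: le_trans hj.
by rewrite -lee_fin fineK// L2per_fin.
Qed.

Lemma H_Qu u : L2per L u -> H L u = - (2 * pi) * Qu u.
Proof.
by move=> Lu; rewrite (H_quart L0 Lu (T_propagation L0 Lu)) /Qu mulrA !mulNr.
Qed.

Lemma P_massu u : P L u = L / 2 * massu u.
Proof. by rewrite PE /massu; field; rewrite gt_eqF. Qed.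

(** Bounds on finite sums pass to all u by Fatou's lemma; with the constant of [qform_strichartz]
    this also gives finiteness. *)
Lemma quart_bound (K : R) u : 0 <= K ->
  (forall s c, uniq s -> qform L s c <= K * mass s c ^+ 2) -> L2per L u ->
  (quart L (fun t => T L t u) <= (L * (K * massu u ^+ 2))%:E)%E.
Proof.
move=> K0 HK Lu; apply: (quart_fatou L0 Lu (T_propagation L0 Lu)) => N.
rewrite (quart_trig L0 (zrange N) (fourier L u)) lee_fin ler_pM2l//.
apply: (le_trans (HK _ _ (zrange_uniq N))); rewrite ler_wpM2l//.
by rewrite lerXn2r ?nnegrE ?mass_ge0 ?massu_ge0//; exact: msum_massu.
Qed.

Lemma quart_T_fin u : L2per L u -> quart L (fun t => T L t u) \is a fin_num.
Proof.
move=> Lu; rewrite ge0_fin_numE ?quart_ge0//.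
have K0 : 0 <= 2 + 8 / tau L by rewrite addr_ge0// divr_ge0// ltW// tau_gt0.
by apply: le_lt_trans (quart_bound K0 (qform_strichartz L0) Lu) (ltry _).
Qed.

Lemma Qu_bound (K : R) u : 0 <= K ->
  (forall s c, uniq s -> qform L s c <= K * mass s c ^+ 2) -> L2per L u ->
  Qu u <= K * massu u ^+ 2.
Proof.
move=> K0 HK Lu; rewrite /Qu mulrC ler_pdivrMr// [leRHS]mulrC.
by rewrite -lee_fin fineK ?quart_T_fin//; exact: quart_bound.
Qed.

Lemma Qu_young (s : R) u v : 0 < s -> s <= 1 -> L2per L u -> L2per L v ->
  Qu (fun x => u x + v x) <= (1 + 7 * s) * Qu u + 8 * s ^- 3 * Qu v.
Proof.
move=> s0 s1 Lu Lv; rewrite /Qu !(mulrCA _ L^-1) -mulrDr ler_pM2l ?invr_gt0//.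
have [Tu Tv] := (T_propagation L0 Lu, T_propagation L0 Lv).
have Tuv := propagationD L0 Lu Lv Tu Tv.
rewrite (quart_propagation L0 (T_propagation L0 (L2perD Lu Lv)) Tuv).
have [ju _ _] := Tu; have [jv _ _] := Tv.
have := quart_young L s0 s1 ju jv.
rewrite -[quart L (fun t => T L t u)]fineK ?quart_T_fin//.
rewrite -[quart L (fun t => T L t v)]fineK ?quart_T_fin//.
rewrite -[leLHS]fineK; first by rewrite -!EFinM -EFinD lee_fin.
by rewrite -(quart_propagation L0 (T_propagation L0 (L2perD Lu Lv)) Tuv) quart_T_fin//; exact: L2perD.
Qed.

Lemma QuZ z u : L2per L u -> Qu (fun x => z * u x) = csq z ^+ 2 * Qu u.
Proof.
move=> Lu; have Tu := T_propagation L0 Lu.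
rewrite /Qu (quart_propagation L0 (T_propagation L0 (L2perZ z Lu)) (propagationZ L0 z Lu Tu)).
have [ju _ _] := Tu.
by rewrite (quartZ L z ju) fineM ?quart_T_fin//= mulrCA.
Qed.

Lemma Qu_trig s c : uniq s -> Qu (trig L s c) = qform L s c.
Proof.
move=> us; have Lt := L2per_trig L0 s c.
rewrite /Qu (quart_propagation L0 (T_propagation L0 Lt) (propagation_trig L0 c us)).
by rewrite quart_trig//= mulKf// gt_eqF.
Qed.

End Functionals.

(** * The best constant and its almost maximisers *)

Section BestConstant.
Context {R : realType}.
Variable L : R.
Hypothesis L0 : 0 < L.
Local Notation tau := (tau L).
Implicit Types (u v : R -> R[i]) (s : seq int) (c d : int -> R[i]).

Lemma trigD s c d x : trig L s (fun n => c n + d n) x = trig L s c x + trig L s d x.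
Proof. by rewrite /trig -big_split /=; apply: eq_bigr => n _; rewrite mulrDl. Qed.

Lemma trigZ s c z x : trig L s (fun n => z * c n) x = z * trig L s c x.
Proof. by rewrite /trig mulr_sumr; apply: eq_bigr => n _; rewrite mulrA. Qed.

Lemma qform_young (sg : R) s c d : 0 < sg -> sg <= 1 -> uniq s ->
  qform L s (fun n => c n + d n) <= (1 + 7 * sg) * qform L s c + 8 * sg ^- 3 * qform L s d.
Proof.
move=> s0 s1 us; rewrite -!(Qu_trig L0 _ us).
have -> : trig L s (fun n => c n + d n) = (fun x => trig L s c x + trig L s d x).
  by apply/funext => x; exact: trigD.
by apply: Qu_young => //; exact: L2per_trig.
Qed.

Lemma qformZ z s c : uniq s -> qform L s (fun n => z * c n) = csq z ^+ 2 * qform L s c.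
Proof.
move=> us; rewrite -!(Qu_trig L0 _ us).
have -> : trig L s (fun n => z * c n) = (fun x => z * trig L s c x).
  by apply/funext => x; exact: trigZ.
by rewrite QuZ//; exact: L2per_trig.
Qed.

Lemma massZ z s c : mass s (fun n => z * c n) = csq z * mass s c.
Proof. by rewrite /mass mulr_sumr; apply: eq_bigr => n _; rewrite csqM. Qed.

Definition qforms : set R := [set x | exists s c, [/\ uniq s, mass s c = 1 & x = qform L s c]].

Definition qM : R := sup qforms.

Lemma mass_normalize s c : 0 < mass s c ->
  mass s (fun n => ((Num.sqrt (mass s c))^-1)%:C * c n) = 1.
Proof.
move=> m0; rewrite massZ csq_real exprVn (sqr_sqrtr (ltW m0)) mulVf// gt_eqF//.
Qed.

Lemma has_sup_qforms : has_sup qforms.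
Proof.
split.
  exists (qform L [:: 0] (fun=> 1)), [:: 0], (fun=> 1); split => //.
  by rewrite /mass big_seq1 (_ : 1 = (1 : R)%:C)// csq_real expr1n.
exists (2 + 8 / tau) => _ [s [c [us m1 ->]]].
by apply: le_trans (qform_strichartz L0 c us) _; rewrite m1 expr1n mulr1.
Qed.

Lemma qform_le_qM s c : uniq s -> qform L s c <= qM * mass s c ^+ 2.
Proof.
move=> us; have := mass_ge0 s c; rewrite le_eqVlt => /orP[/eqP m0|m0].
  by apply: le_trans (qform_strichartz L0 c us) _; rewrite -m0 expr0n !mulr0.
have : qform L s (fun n => ((Num.sqrt (mass s c))^-1)%:C * c n) <= qM.
  apply: sup_upper_bound; first exact: has_sup_qforms.
  by do 2 eexists; split; [exact: us | exact: (mass_normalize m0) |].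
rewrite qformZ// csq_real !exprVn (sqr_sqrtr (ltW m0)).
by rewrite ler_pdivrMl ?exprn_gt0// mulrC.
Qed.

Lemma qM_approx (e : R) : 0 < e -> exists s c, [/\ uniq s, mass s c = 1 & qM - e < qform L s c].
Proof.
move=> e0; have [_ [s [c [us m1 ->]]] h] := sup_adherent e0 has_sup_qforms.
by exists s, c.
Qed.

Lemma qM_gt2 : tau <= 259 / 100 -> 2 < qM.
Proof.
move=> /(qform_gt_resonant L0) [s [c [us h]]].
have := lt_le_trans h (qform_le_qM c us).
have := mass_ge0 s c; rewrite le_eqVlt => /orP[/eqP m0|m0].
  by rewrite -m0 expr0n !mulr0 ltxx.
by rewrite ltr_pM2r// exprn_gt0.
Qed.

Hypothesis M2 : 2 < qM.

Lemma Qu_le_qM u : L2per L u -> Qu L u <= qM * massu L u ^+ 2.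
Proof.
move=> Lu; apply: Qu_bound => //; first by apply: ltW; apply: lt_trans M2.
by move=> s c us; exact: qform_le_qM.
Qed.

Lemma sum_support (J : eqType) (s t : seq J) (f : J -> R) : uniq s -> uniq t ->
  (forall n, n \notin s -> f n = 0) -> (forall n, n \notin t -> f n = 0) ->
  \sum_(n <- s) f n = \sum_(n <- t) f n.
Proof.
move=> us ut fs ft.
have h (r : seq J) : \sum_(n <- r) f n = \sum_(n <- r | f n != 0) f n.
  rewrite (bigID (fun n => f n != 0))/= [X in _ + X]big1 ?addr0// => n.
  by rewrite negbK => /eqP.
rewrite h [RHS]h -!(big_filter _ (fun n => f n != 0)); apply: perm_big.
apply: uniq_perm; rewrite ?filter_uniq// => n; rewrite !mem_filter.
case: eqP => //= f0; apply/idP/idP => _.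
  by apply: contraPT f0 => /ft ->.
by apply: contraPT f0 => /fs ->.
Qed.

Lemma msum_crestr s c K : uniq s -> (forall n, n \notin s -> c n = 0) ->
  mass s (crestr (fun n => `|n| <= K)%N c) = msum c K.
Proof.
move=> us cs.
rewrite /mass (sum_support us (zrange_uniq K)); first last.
- by move=> n; rewrite (mem_zrange L0) /crestr => /negPf ->; rewrite csq0.
- by move=> n ns; rewrite /crestr cs// if_same csq0.
by rewrite /msum !big_seq; apply: eq_bigr => n; rewrite (mem_zrange L0) /crestr => ->.
Qed.

Lemma mass_crestrC s c (P : pred int) :
  mass s (crestr (predC P) c) = mass s c - mass s (crestr P c).
Proof.
rewrite /mass -sumrB; apply: eq_bigr => n _; rewrite /crestr /=.
by case: (P n); rewrite csq0 /=; ring.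
Qed.

(** Young's inequality cuts off the annulus K < |n| <= K + j^2. The inside and the outside are then
    j^2 apart and decouple; the term in 2M - 4 is the price of the splitting. *)
Lemma qform_annulus s c (K j : nat) (sg : R) : uniq s -> (forall n, n \notin s -> c n = 0) ->
  (0 < j)%N -> 0 < sg -> sg <= 1 ->
  qform L s c <= (1 + 7 * sg) * (qM * mass s c ^+ 2
      - (2 * qM - 4) * (msum c K * (mass s c - msum c (K + j ^ 2)%N))
      + tau^-1 * (8 / j%:R * mass s c ^+ 2))
    + 8 * sg ^- 3 * (qM * (msum c (K + j ^ 2)%N - msum c K) ^+ 2).
Proof.
move=> us cs j0 s0 s1.
pose A (n : int) := (K < `|n| <= K + j ^ 2)%N.
pose c1 := crestr (predC A) c; pose c2 := crestr A c.
have {1}-> : c = (fun n => c1 n + c2 n).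
  by apply/funext => n; rewrite /c1 /c2 /crestr /=; case: (A n); rewrite ?add0r ?addr0.
apply: le_trans (qform_young _ _ s0 s1 us) _.
have m2 : mass s c2 = msum c (K + j ^ 2)%N - msum c K.
  rewrite -!(msum_crestr _ us cs) /mass -sumrB; apply: eq_bigr => n _.
  rewrite /c2 /crestr /A; case: (leqP `|n| K) => h.
    by rewrite (leq_trans h (leq_addr _ _)) /= csq0 subrr.
  by rewrite /=; case: ifP; rewrite csq0 subr0.
set a := msum c K; set t := mass s c - msum c (K + j ^ 2)%N.
have m1 : mass s c1 = a + t by rewrite /c1 mass_crestrC m2 /a /t; ring.
have a0 : 0 <= a by exact: msum_ge0.
have t0 : 0 <= t.
  rewrite /t -(msum_crestr _ us cs) -mass_crestrC; exact: mass_ge0.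
have ann0 : 0 <= msum c (K + j ^ 2)%N - a by rewrite -m2 mass_ge0.
apply: lerD; last first.
  by rewrite -m2 ler_pM2l ?qform_le_qM// mulr_gt0// invr_gt0 exprn_gt0.
rewrite ler_pM2l; last by lra.
pose Pp (n : int) := (`|n| <= K)%N.
have hsep n m : n \in s -> m \in s -> Pp n -> ~~ Pp m -> c1 n != 0 -> c1 m != 0 ->
    (j ^ 2 <= `|n - m|)%N.
  move=> _ _ Pn Pm _; rewrite /c1 /crestr /= /A; case: ifP; rewrite ?eqxx// => h _.
  by move: Pn Pm h; rewrite /Pp; clear; lia.
apply: le_trans (qform_decouple L0 us j0 hsep) _.
have mP : mass s (crestr Pp c1) = a.
  rewrite /a -(msum_crestr _ us cs) /mass; apply: eq_bigr => n _.
  rewrite /crestr /c1 /crestr /= /A /Pp; case: ifP => // h.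
  by rewrite ltnNge h.
have mQ : mass s (crestr (predC Pp) c1) = t by rewrite mass_crestrC mP m1; ring.
rewrite mP mQ m1.
have q1 := qform_le_qM (crestr Pp c1) us; have q2 := qform_le_qM (crestr (predC Pp) c1) us.
rewrite mP in q1; rewrite mQ in q2.
have at_le : a + t <= mass s c by rewrite /t; lra.
have sq : (a + t) ^+ 2 <= mass s c ^+ 2 by apply: lerXn2r => //; rewrite nnegrE; [exact: addr_ge0 | exact: mass_ge0].
have h1 : tau^-1 * (8 / j%:R * (a + t) ^+ 2) <= tau^-1 * (8 / j%:R * mass s c ^+ 2).
  by rewrite ler_pM2l ?invr_gt0 ?tau_gt0// ler_wpM2l//.
have h2 : qM * (a + t) ^+ 2 <= qM * mass s c ^+ 2 by rewrite ler_wpM2l// ltW// (lt_trans _ M2).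
have e : qM * (a + t) ^+ 2 = qM * a ^+ 2 + qM * t ^+ 2 + 2 * qM * (a * t) by ring.
move: e; set x := a * t; set y := qM * _; set z := qM * a ^+ 2; set w := qM * t ^+ 2 => e.
have : (2 * qM - 4) * x = 2 * qM * x - 4 * x by ring.
move: q1 q2 h1 h2; rewrite -/y -/z -/w; lra.
Qed.

(** Otherwise [qform_spread] keeps the form close to at most 2 m^2, which is below M m^2. *)
Lemma nonvanishing (m : R) : 0 < m -> exists2 eta : R, 0 < eta &
  exists2 dl : R, 0 < dl & forall s c, uniq s -> `|mass s c - m| < dl ->
    qM * m ^+ 2 - dl < qform L s c -> exists n, eta < csq (c n).
Proof.
move=> m0; have t0 := tau_gt0 L0.
(* The gap (M - 2) m^2 is 8 g; the far terms, the near terms, the error on 2 a^2 and [dl] use at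
   most one g each. *)
pose g := (qM - 2) * m ^+ 2 / 8.
have g0 : 0 < g by rewrite /g !mulr_gt0 ?subr_gt0 ?exprn_gt0.
have [k k0 hk] : exists2 k : nat, (0 < k)%N & tau^-1 * (8 / k%:R * (2 * m) ^+ 2) <= g.
  pose x := tau^-1 * (8 * (2 * m) ^+ 2) / g.
  exists (Num.truncn x).+1 => //.
  have xk : x <= (Num.truncn x).+1%:R by apply/ltW; exact: truncnS_gt.
  rewrite mulrAC mulrA ler_pdivrMr ?ltr0Sn//.
  by move: xk; rewrite /x ler_pdivrMr// [g * _]mulrC; lra.
have K0 : (0 : R) < k%:R by rewrite ltr0n.
pose eta := g / (tau^-1 * (16 * k%:R ^+ 4 * (2 * m))).
have den0 : 0 < tau^-1 * (16 * k%:R ^+ 4 * (2 * m)).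
  apply: mulr_gt0; first by rewrite invr_gt0.
  by apply: mulr_gt0; apply: mulr_gt0 => //; exact: exprn_gt0.
have eta0 : 0 < eta by rewrite divr_gt0.
exists eta => //.
pose dl := Num.min m (Num.min g (g / (6 * m))).
exists dl; first by rewrite !lt_min m0 g0 divr_gt0// mulr_gt0.
move=> s c us mc qc; apply: contrapT => nex.
have ce n : n \in s -> csq (c n) <= eta.
  by move=> _; rewrite leNgt; apply/negP => h; apply: nex; exists n.
have := qform_spread L0 us k0 ce.
set a := mass s c in mc *.
have a0 : 0 <= a by exact: mass_ge0.
have [d1 d2 d3] : [/\ dl <= m, dl <= g & dl * (6 * m) <= g].
  by split; rewrite ?ge_min ?lexx ?orbT// -ler_pdivlMr ?mulr_gt0// !ge_min lexx !orbT.
move: mc; rewrite ltr_norml => /andP[_ am].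
have a2 : a <= 2 * m by lra.
have h1 : tau^-1 * (8 / k%:R * a ^+ 2) <= g.
  apply: le_trans hk; rewrite ler_pM2l ?invr_gt0// ler_wpM2l ?divr_ge0//.
  by rewrite lerXn2r ?nnegrE// mulr_ge0// ltW.
have h2 : tau^-1 * (16 * k%:R ^+ 4 * (eta * a)) <= g.
  apply: (@le_trans _ _ (tau^-1 * (16 * k%:R ^+ 4 * (2 * m)) * eta)).
    have k4 : 0 < 16 * k%:R ^+ 4 :> R by apply: mulr_gt0 => //; exact: exprn_gt0.
    have it : 0 < tau^-1 by rewrite invr_gt0.
    rewrite (_ : 16 * k%:R ^+ 4 * (eta * a) = 16 * k%:R ^+ 4 * a * eta); last by ring.
    by rewrite [tau^-1 * (_ * eta)]mulrA (ler_pM2r eta0) (ler_pM2l it) (ler_pM2l k4).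
  by rewrite /eta mulrC divfK// gt_eqF.
have h3 : 2 * a ^+ 2 <= 2 * m ^+ 2 + g.
  have amd : a <= m + dl by lra.
  have dl0 : 0 <= dl by rewrite !le_min (ltW m0) (ltW g0) divr_ge0// ?(ltW g0)// mulr_ge0// ltW.
  have : a ^+ 2 <= (m + dl) ^+ 2.
    by apply: lerXn2r => //; rewrite nnegrE// addr_ge0// ltW.
  have : dl * dl <= dl * m by rewrite ler_wpM2l.
  rewrite sqrrD; lra.
have : qM * m ^+ 2 = 2 * m ^+ 2 + 8 * g by rewrite /g; field.
rewrite mulrDr; lra.
Qed.

End BestConstant.

(** * Concentration *)

Section FilterLimits.
Context {R : realType}.

(** One ultrafilter makes all the bounded coefficient sequences converge at once, in place of a
    diagonal extraction. *)
Lemma ultra_bounded_cvg (U : set_system nat) (UF : UltraFilter U) (x : nat -> R) (B : R) :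
  (forall k, `|x k| <= B) -> exists l : R, x k @[k --> U] --> l.
Proof.
move=> xB; have := @segment_compact R (- B) B (x @ U) _ _.
case=> [|l [_ cl]].
  by apply: (@filterS _ U _ setT); [move=> k _ /=; rewrite in_itv /= -ler_norml|exact: filterT].
exists l => A /= lA; have [//|nA] := in_ultra_setVsetC (x @^-1` A) UF.
have [y [/= ny yA]] := cl (~` A) A nA lA.
by [].
Qed.

Context {F : set_system nat} {FF : ProperFilter F}.

Lemma ler_cvgF (f g : nat -> R) (a b : R) : f k @[k --> F] --> a -> g k @[k --> F] --> b ->
  (forall k, f k <= g k) -> a <= b.
Proof.
move=> fa gb fg; rewrite -subr_le0.
apply: (cvgr_to_le (cvgB fa gb)).
by apply: nearW => k; rewrite subr_le0.
Qed.

Lemma cvg_seqsum (J : Type) (s : seq J) (f : J -> nat -> R) (l : J -> R) :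
  (forall j, f j k @[k --> F] --> l j) ->
  (\sum_(j <- s) f j k) @[k --> F] --> \sum_(j <- s) l j.
Proof.
move=> fl; elim: s => [|j s IH].
  by under eq_fun do rewrite big_nil; rewrite big_nil; exact: cvg_cst.
by under eq_fun do rewrite big_cons; rewrite big_cons; exact: cvgD.
Qed.

Lemma cvg_csq (x : nat -> R[i]) (l z : R[i]) :
  complex.Re (x k) @[k --> F] --> complex.Re l ->
  complex.Im (x k) @[k --> F] --> complex.Im l ->
  csq (x k - z) @[k --> F] --> csq (l - z).
Proof.
move=> re im.
have e (w : R[i]) : csq (w - z) = (complex.Re w - complex.Re z) * (complex.Re w - complex.Re z)
   + (complex.Im w - complex.Im z) * (complex.Im w - complex.Im z).
  by rewrite /csq; case: w z {re im} => [a b] [c d] /=; rewrite !expr2.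
under eq_fun do rewrite e; rewrite e.
by apply: cvgD; apply: cvgM; apply: cvgB => //; exact: cvg_cst.
Qed.

End FilterLimits.

(** * Limits of maximising sequences along an ultrafilter *)

Section Concentration.
Context {R : realType}.
Variable L : R.
Hypothesis L0 : 0 < L.
Local Notation tau := (tau L).
Local Notation M := (qM L).
Hypothesis M2 : 2 < M.

Lemma msum_le_mass s (c : int -> R[i]) N : uniq s -> (forall n, n \notin s -> c n = 0) ->
  msum c N <= mass s c.
Proof.
move=> us cs; rewrite -(msum_crestr L0 _ us cs) -subr_ge0 -mass_crestrC.
exact: mass_ge0.
Qed.

Variables (U : set_system nat) (UF : UltraFilter U).
(** A maximising sequence, already boosted so that its coefficient at 0 stays away from zero. *)
Variables (S : nat -> seq int) (C : nat -> int -> R[i]) (m B eta : R).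
Hypothesis uS : forall k, uniq (S k).
Hypothesis CS : forall k n, n \notin S k -> C k n = 0.
Hypothesis mB : forall k, mass (S k) (C k) <= B.
Hypothesis cm : mass (S k) (C k) @[k --> U] --> m.
Hypothesis cq : qform L (S k) (C k) @[k --> U] --> M * m ^+ 2.
Hypothesis eta0 : 0 < eta.
Hypothesis Ceta : forall k, eta < csq (C k 0).

Lemma csq_coef_le k n : csq (C k n) <= mass (S k) (C k).
Proof.
have [nS|nS] := boolP (n \in S k); last by rewrite CS// csq0 mass_ge0.
rewrite /mass (big_rem n)//= lerDl.
by apply: sumr_ge0 => i _; exact: csq_ge0.
Qed.

Lemma coef_limit : exists b : int -> R[i], forall n,
  complex.Re (C k n) @[k --> U] --> complex.Re (b n) /\
  complex.Im (C k n) @[k --> U] --> complex.Im (b n).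
Proof.
suff H n : exists z : R[i], complex.Re (C k n) @[k --> U] --> complex.Re z /\
    complex.Im (C k n) @[k --> U] --> complex.Im z.
  by have [b hb] := choice H; exists b.
have bnd (x : R) k : x ^+ 2 <= csq (C k n) -> `|x| <= Num.max 1 B.
  move=> h; have h1 : x ^+ 2 <= B by apply: le_trans h _; apply: le_trans (csq_coef_le k n) _.
  have [x1|x1] := leP `|x| 1; first by rewrite le_max x1.
  rewrite le_max; apply/orP; right; apply: le_trans h1.
  by rewrite -real_normK ?num_real// expr2 ler_peMl// ltW.
have [a ha] := ultra_bounded_cvg UF (fun k => bnd _ k (csq_Re (C k n))).
have [d hd] := ultra_bounded_cvg UF (fun k => bnd _ k (csq_Im (C k n))).
by exists (a +i* d).
Qed.

Variable b : int -> R[i].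
Hypothesis Cb : forall n,
  complex.Re (C k n) @[k --> U] --> complex.Re (b n) /\
  complex.Im (C k n) @[k --> U] --> complex.Im (b n).

Lemma msum_sub_limit N (d : int -> R[i]) :
  msum (fun n => C k n - d n) N @[k --> U] --> msum (fun n => b n - d n) N.
Proof.
rewrite /msum; apply: cvg_seqsum => n.
by have [h1 h2] := Cb n; exact: cvg_csq.
Qed.

Lemma msum_limit N : msum (C k) N @[k --> U] --> msum b N.
Proof.
have := @msum_sub_limit N (fun=> 0).
have -> : (fun n => b n - 0) = b by apply/funext => n; rewrite subr0.
by have -> : (fun k => msum (fun n => C k n - 0) N) = (fun k => msum (C k) N)
  by apply/funext => k; congr msum; apply/funext => n; rewrite subr0.
Qed.

Lemma msum_b_le N : msum b N <= m.
Proof.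
apply: (ler_cvgF (@msum_limit N) cm) => k.
by apply: msum_le_mass => // n; exact: CS.
Qed.

Lemma mass_pos : eta <= m.
Proof.
apply: (ler_cvgF (cvg_cst eta) cm) => k.
exact: le_trans (ltW (Ceta k)) (csq_coef_le k 0).
Qed.

(** The limit of [qform_annulus] at fixed K. The factor m - [msum b (K + j ^ 2)] contains the mass
    lost at infinity as well as the tail of b. *)
Lemma limit_dichotomy (j : nat) (sg : R) K : (0 < j)%N -> 0 < sg -> sg <= 1 ->
  M * m ^+ 2 <= (1 + 7 * sg) * (M * m ^+ 2
      - (2 * M - 4) * (msum b K * (m - msum b (K + j ^ 2)%N))
      + tau^-1 * (8 / j%:R * m ^+ 2))
    + 8 * sg ^- 3 * (M * (msum b (K + j ^ 2)%N - msum b K) ^+ 2).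
Proof.
move=> j0 s0 s1.
apply: (@ler_cvgF _ U _ (fun k => qform L (S k) (C k)) (fun k =>
  (1 + 7 * sg) * (M * (mass (S k) (C k) * mass (S k) (C k))
      - (2 * M - 4) * (msum (C k) K * (mass (S k) (C k) - msum (C k) (K + j ^ 2)%N))
      + tau^-1 * (8 / j%:R * (mass (S k) (C k) * mass (S k) (C k))))
    + 8 * sg ^- 3 * (M * ((msum (C k) (K + j ^ 2)%N - msum (C k) K) *
        (msum (C k) (K + j ^ 2)%N - msum (C k) K))))) => //; last first.
  by move=> k; have := qform_annulus L0 M2 K (uS k) (@CS k) j0 s0 s1; rewrite !expr2.
rewrite [(msum b _ - _) ^+ 2]expr2 !expr2.
have mm := cvgM cm cm.
apply: cvgD; apply: cvgMl_tmp.
  apply: cvgD; last by apply: cvgMl_tmp; apply: cvgMl_tmp; exact: mm.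
  apply: cvgB; first (apply: cvgMl_tmp; exact: mm).
  apply: cvgMl_tmp; apply: cvgM; first exact: msum_limit.
  by apply: cvgB => //; exact: msum_limit.
by apply: cvgMl_tmp; apply: cvgM; apply: cvgB; exact: msum_limit.
Qed.

(** No mass escapes. As K grows the annulus empties, and (2M - 4) be (m - be) is bounded by errors
    that j, then sg, make smaller than itself; be is positive thanks to the coefficient at 0. *)
Lemma msum_b_cvg : msum b N @[N --> \oo] --> m.
Proof.
have cb : cvgn (msum b).
  apply: nondecreasing_is_cvgn; first exact: msum_homo.
  by exists m => _ [N _ <-]; exact: msum_b_le.
set be := limn (msum b).
have bm : be <= m by apply: limr_le => //; apply: nearW => N; exact: msum_b_le.
have eb : eta <= be.
  have e0 : eta <= msum b 0.
    apply: (ler_cvgF (cvg_cst eta) (@msum_limit 0)) => k.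
    by rewrite /msum (_ : zrange 0 = [:: 0])// big_seq1 ltW.
  by apply: le_trans e0 _; apply: nondecreasing_cvgn_le => //; exact: msum_homo.
suff -> : m = be by exact: cb.
apply/eqP; rewrite eq_le bm andbT leNgt; apply/negP => ltm.
have m0 : 0 < m := lt_le_trans eta0 mass_pos.
have M0 : 0 < M := lt_trans (ltr0n R 2) M2.
have t0 := tau_gt0 L0.
pose x := (2 * M - 4) * (be * (m - be)).
have x0 : 0 < x.
  apply: mulr_gt0; first by rewrite subr_gt0 (_ : 4 = 2 * 2 :> R) ?ltr_pM2l// -natrM.
  by apply: mulr_gt0; [exact: lt_le_trans eb | rewrite subr_gt0].
have [j j0 hj] : exists2 j : nat, (0 < j)%N & tau^-1 * (8 / j%:R * m ^+ 2) <= x / 2.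
  pose y := tau^-1 * (8 * m ^+ 2) / (x / 2).
  exists (Num.truncn y).+1 => //.
  have yk : y <= (Num.truncn y).+1%:R by apply/ltW; exact: truncnS_gt.
  rewrite mulrAC mulrA ler_pdivrMr ?ltr0Sn//.
  by move: yk; rewrite /y ler_pdivrMr ?divr_gt0// [x / 2 * _]mulrC; lra.
have key (sg : R) : 0 < sg -> sg <= 1 ->
  M * m ^+ 2 <= (1 + 7 * sg) * (M * m ^+ 2 - x + tau^-1 * (8 / j%:R * m ^+ 2)).
  move=> s0 s1.
  have cj : msum b (K + j ^ 2)%N @[K --> \oo] --> be by rewrite cvg_shiftn.
  have := @ler_cvgF _ \oo _ _ _ _ _ (cvg_cst (M * m ^+ 2)) _
    (fun K => limit_dichotomy K j0 s0 s1).
  have -> : (1 + 7 * sg) * (M * m ^+ 2 - x + tau^-1 * (8 / j%:R * m ^+ 2)) =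
    (1 + 7 * sg) * (M * m ^+ 2 - x + tau^-1 * (8 / j%:R * m ^+ 2)) +
     8 * sg ^- 3 * (M * ((be - be) * (be - be))) by rewrite subrr !mul0r !mulr0 addr0.
  apply; under eq_fun do rewrite [(msum b _ - _) ^+ 2]expr2.
  apply: cvgD; apply: cvgMl_tmp.
    apply: cvgD; last exact: cvg_cst.
    apply: cvgB; first exact: cvg_cst.
    apply: cvgMl_tmp; apply: cvgM; first exact: cb.
    by apply: cvgB => //; exact: cvg_cst.
  by apply: cvgMl_tmp; apply: cvgM; apply: cvgB.
have Mm0 : 0 < M * m ^+ 2 by rewrite mulr_gt0// exprn_gt0.
(* Then 7 sg M m^2 <= x/4, against a gain of x/2. *)
pose sg := Num.min 1 (x / (28 * (M * m ^+ 2))).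
have s0 : 0 < sg by rewrite lt_min ltr01 divr_gt0// mulr_gt0.
have s1 : sg <= 1 by rewrite ge_min lexx.
have s2 : sg * (28 * (M * m ^+ 2)) <= x.
  by rewrite -ler_pdivlMr ?mulr_gt0// ge_min lexx orbT.
have := key sg s0 s1; set A := M * m ^+ 2 in Mm0 s2 *; set T := tau^-1 * _ in hj *.
have : (1 + 7 * sg) * (A - x + T) <= (1 + 7 * sg) * (A - x / 2) by rewrite ler_pM2l; lra.
have : sg * x >= 0 by rewrite mulr_ge0// ltW.
have -> : (1 + 7 * sg) * (A - x / 2) = A - x / 2 + 7 * (sg * A) - 7 / 2 * (sg * x) by ring.
have s3 : 28 * (sg * A) <= x by rewrite mulrCA.
lra.
Qed.

(** Convergence of each coefficient without loss of mass is convergence in norm; Young's inequality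
    then carries the maximal value to the limit. *)
Lemma limit_profile : exists phi, [/\ L2per L phi, massu L phi = m, Qu L phi = M * m ^+ 2 &
  massu L (fun x => trig L (S k) (C k) x - phi x) @[k --> U] --> 0].
Proof.
have [W [psi [_ LW FW _ _]]] := wave_exists L0 msum_b_le.
pose phi := W 0.
have Lphi : L2per L phi by exact: LW.
have Fphi n : fourier L phi n = b n by rewrite FW /phase mulr0 oppr0 expi0 mul1r.
have Fb : fourier L phi = b by apply/funext.
have mphi : massu L phi = m.
  apply/eqP; rewrite eq_le; apply/andP; split.
    apply/ler_addgt0Pr => e e0; have [N /(_ N (leqnn _))] := massu_parseval L0 Lphi e0.
    by rewrite Fb; have := msum_b_le N; lra.
  have : lim (msum b N @[N --> \oo]) <= massu L phi.
    apply: limr_le; first by apply/cvg_ex; exists m; exact: msum_b_cvg.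
    by apply: nearW => N; rewrite -Fb; exact: msum_massu.
  by rewrite (cvg_lim (@Rhausdorff R) msum_b_cvg).
have Lt k := L2per_trig L0 (S k) (C k).
have Ft k : fourier L (trig L (S k) (C k)) = C k.
  apply/funext => n; rewrite fourier_trig//; case: ifPn => // /CS ->//.
have conv : massu L (fun x => trig L (S k) (C k) x - phi x) @[k --> U] --> 0.
  apply/cvgr0Pnorm_lt => e e0.
  (* In the limit the bound below is six times this tail, hence less than e/2. *)
  have [N /(_ N (leqnn _)) hN] := massu_parseval L0 Lphi (divr_gt0 e0 (ltr0n R 12)).
  rewrite Fb mphi in hN.
  have Lg := L2per_trig L0 (zrange N) b.
  have bound k : massu L (fun x => trig L (S k) (C k) x - phi x) <=
    4 * (mass (S k) (C k) - msum (C k) N) + 4 * msum (fun n => C k n - b n) N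
    + 2 * (m - msum b N).
    have := massuD_le L0 (L2perB (Lt k) Lg) (L2perB Lg Lphi).
    have -> : (fun x => trig L (S k) (C k) x - trig L (zrange N) b x +
        (trig L (zrange N) b x - phi x)) = (fun x => trig L (S k) (C k) x - phi x).
      by apply/funext => x; rewrite addrA subrK.
    rewrite [massu L (fun x => trig L (zrange N) b x - phi x)]massuBC -{2}Fb.
    rewrite massu_truncE// Fb mphi.
    have LN := L2per_trig L0 (zrange N) (C k).
    have := massuD_le L0 (L2perB (Lt k) LN) (L2perB LN Lg).
    have -> : (fun x => trig L (S k) (C k) x - trig L (zrange N) (C k) x +
        (trig L (zrange N) (C k) x - trig L (zrange N) b x)) =
        (fun x => trig L (S k) (C k) x - trig L (zrange N) b x).
      by apply/funext => x; rewrite addrA subrK.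
    have tr := massu_truncE L0 N (Lt k); rewrite Ft massu_trig// in tr; rewrite tr.
    have -> : (fun x => trig L (zrange N) (C k) x - trig L (zrange N) b x) =
      trig L (zrange N) (fun n => C k n - b n).
      apply/funext => x; rewrite /trig -sumrB; apply: eq_bigr => n _.
      by rewrite mulrBl.
    rewrite massu_trig ?zrange_uniq// -msumE; lra.
  have cvgb : 4 * (mass (S k) (C k) - msum (C k) N) + 4 * msum (fun n => C k n - b n) N
    + 2 * (m - msum b N) @[k --> U] --> 4 * (m - msum b N) + 4 * msum (fun n => b n - b n) N
    + 2 * (m - msum b N).
    apply: cvgD; last exact: cvg_cst.
    apply: cvgD; apply: cvgMl_tmp; last exact: msum_sub_limit.
    by apply: cvgB => //; exact: msum_limit.
  have z0 : msum (fun n => b n - b n) N = 0.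
    by rewrite /msum big1// => n _; rewrite subrr csq0.
  rewrite z0 mulr0 addr0 in cvgb.
  have lte : 4 * (m - msum b N) + 2 * (m - msum b N) < e by lra.
  apply: (filterS _ (cvgr_lt _ cvgb _ lte)) => k hk.
  by rewrite ger0_norm ?massu_ge0//; exact: le_lt_trans (bound k) hk.
exists phi; split => //.
apply/eqP; rewrite eq_le; apply/andP; split.
  by rewrite -mphi; exact: Qu_le_qM.
have key (sg : R) : 0 < sg -> sg <= 1 -> M * m ^+ 2 <= (1 + 7 * sg) * Qu L phi.
  move=> s0 s1.
  have -> : (1 + 7 * sg) * Qu L phi = (1 + 7 * sg) * Qu L phi + 8 * sg ^- 3 * (M * (0 * 0)).
    by rewrite !mulr0 addr0.
  apply: (ler_cvgF cq (g := fun k => (1 + 7 * sg) * Qu L phi + 8 * sg ^- 3 *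
    (M * (massu L (fun x => trig L (S k) (C k) x - phi x) *
          massu L (fun x => trig L (S k) (C k) x - phi x))))).
    apply: cvgD; first exact: cvg_cst.
    by apply: cvgMl_tmp; apply: cvgMl_tmp; exact: cvgM.
  move=> k; rewrite -(Qu_trig L0 _ (uS k)).
  have := Qu_young L0 s0 s1 Lphi (L2perB (Lt k) Lphi).
  have -> : (fun x => phi x + (trig L (S k) (C k) x - phi x)) = trig L (S k) (C k).
    by apply/funext => x; rewrite addrC subrK.
  move/le_trans; apply; rewrite lerD2l ler_pM2l ?mulr_gt0 ?invr_gt0 ?exprn_gt0//.
  by rewrite -expr2; apply: Qu_le_qM => //; exact: L2perB.
apply/ler_addgt0Pr => e e0.
pose sg := Num.min 1 (e / (7 * (Qu L phi + 1))).
have q0 : 0 <= Qu L phi by exact: Qu_ge0.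
have den : 0 < 7 * (Qu L phi + 1) by lra.
have s0 : 0 < sg by rewrite lt_min ltr01 divr_gt0.
have s1 : sg <= 1 by rewrite ge_min lexx.
have : sg * (7 * (Qu L phi + 1)) <= e by rewrite -ler_pdivlMr// ge_min lexx orbT.
have := key sg s0 s1; have := mulr_ge0 (ltW s0) q0; lra.
Qed.

End Concentration.

(** * Compactness up to boosts and existence of maximisers *)

Section Compactness.
Context {R : realType}.
Variable L : R.
Hypothesis L0 : 0 < L.
Local Notation M := (qM L).
Hypothesis M2 : 2 < M.
Implicit Types (u v phi : R -> R[i]) (s : seq int) (c : int -> R[i]).

(** Young's inequality around v, both of its terms being controlled by the mass through
    [Qu_le_qM]. *)
Lemma Qu_uniform (A e : R) : 0 < A -> 0 < e -> exists2 dl : R, 0 < dl &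
  forall u v, L2per L u -> L2per L v -> massu L v <= A ->
    massu L (fun x => u x - v x) < dl -> Qu L u <= Qu L v + e.
Proof.
move=> A0 e0; have M0 : 0 < M := lt_trans (ltr0n R 2) M2.
have MA : 0 < M * A ^+ 2 by rewrite mulr_gt0// exprn_gt0.
pose sg := Num.min 1 (e / (14 * (M * A ^+ 2))).
have s0 : 0 < sg by rewrite lt_min ltr01 divr_gt0// mulr_gt0.
have s1 : sg <= 1 by rewrite ge_min lexx.
have s2 : sg * (14 * (M * A ^+ 2)) <= e.
  by rewrite -ler_pdivlMr ?mulr_gt0// ge_min lexx orbT.
pose k := 8 * sg ^- 3 * M.
have k0 : 0 < k by rewrite !mulr_gt0 ?invr_gt0 ?exprn_gt0.
exists (Num.min 1 (e / (2 * k))); first by rewrite lt_min ltr01 divr_gt0// mulr_gt0.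
move=> u v Lu Lv vA; rewrite lt_min => /andP[h1 h2].
have Lw := L2perB Lu Lv.
have := Qu_young L0 s0 s1 Lv Lw.
have -> : (fun x => v x + (u x - v x)) = u by apply/funext => x; rewrite addrC subrK.
move/le_trans; apply.
have w0 := massu_ge0 L0 (fun x => u x - v x).
set w := massu L (fun x => u x - v x) in h1 h2 w0.
have q1 : Qu L v <= M * A ^+ 2.
  apply: le_trans (Qu_le_qM L0 M2 Lv) _; rewrite ler_pM2l//.
  by rewrite lerXn2r ?nnegrE ?massu_ge0// ltW.
have q2 : 8 * sg ^- 3 * Qu L (fun x => u x - v x) <= k * w.
  rewrite /k -[8 * _ * M * w]mulrA ler_pM2l ?mulr_gt0 ?invr_gt0 ?exprn_gt0//.
  apply: le_trans (Qu_le_qM L0 M2 Lw) _; rewrite ler_pM2l// expr2.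
  by rewrite -/w ler_piMr// ltW.
have : k * w <= e / 2.
  have -> : e / 2 = k * (e / (2 * k)) by field; rewrite gt_eqF.
  by rewrite ler_pM2l// ltW.
move: q1 q2; move: (8 * sg ^- 3 * _) (k * w) => x y q1 q2.
have : sg * Qu L v <= sg * (M * A ^+ 2) by rewrite ler_pM2l.
lra.
Qed.

Lemma trig_boost s c (m : int) x :
  trig L [seq n + m | n <- s] (fun n => c (n - m)) x = efun L m x * trig L s c x.
Proof.
rewrite /trig big_map mulr_sumr; apply: eq_bigr => n _.
by rewrite addrK efunD; ring.
Qed.

Lemma Qu_trig_boost s c m : uniq s ->
  Qu L (fun x => efun L m x * trig L s c x) = Qu L (trig L s c).
Proof.
move=> us; rewrite (Qu_trig L0 _ us).
have -> : (fun x => efun L m x * trig L s c x) =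
   trig L [seq n + m | n <- s] (fun n => c (n - m)).
  by apply/funext => x; rewrite trig_boost.
have us' : uniq [seq n + m | n <- s] by rewrite map_inj_uniq//; exact: addIr.
rewrite (Qu_trig L0 _ us') -(qform_shift L0).
by have -> : (fun n => c (n + m - m)) = c by apply/funext => n; rewrite addrK.
Qed.

Lemma L2per_boost m u : L2per L u -> L2per L (fun x => efun L m x * u x).
Proof.
move=> /L2perE [mu pu fu]; apply/L2perE; split.
- by apply: cmeasurable_funM => //; exact: efun_meas.
- by move=> x; rewrite pu efun_periodic.
- by rewrite /sqn; under eq_integral do rewrite csqM csq_efun mul1r.
Qed.

(** The invariance, explicit on trigonometric polynomials, passes to phi by truncation. For the
    boosted maximisers considered below, the reverse inequality is maximality itself. *)
Lemma Qu_boost_ge m phi : L2per L phi -> Qu L phi <= Qu L (fun x => efun L m x * phi x).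
Proof.
move=> Lp; apply/ler_addgt0Pr => e e0.
have A0 : 0 < massu L phi + 1 by rewrite ltr_wpDl ?massu_ge0.
have [dl dl0 H] := Qu_uniform A0 (divr_gt0 e0 (ltr0n R 2)).
have [N /(_ N (leqnn _))] := massu_parseval L0 Lp dl0.
rewrite -massu_truncE//; set p := trig L _ _ => hN.
have Lpp : L2per L p by exact: L2per_trig.
have pA : massu L p <= massu L phi + 1.
  rewrite massu_trig ?zrange_uniq//; have := msum_massu L0 N Lp; rewrite msumE; lra.
have h1 := H _ _ Lp Lpp pA hN.
have := H _ _ (L2per_boost m Lpp) (L2per_boost m Lp).
rewrite massu_efun// Qu_trig_boost ?zrange_uniq// -/p.
have -> : massu L (fun x => efun L m x * p x - efun L m x * phi x) =
   massu L (fun x => phi x - p x).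
  transitivity (massu L (fun x => efun L m x * (p x - phi x))).
    by congr massu; apply/funext => x; rewrite mulrBr.
  by rewrite massu_efun; [exact: massuBC | exact: L2perB].
move=> /(_ _ hN) h2.
have {}h2 : Qu L p <= Qu L (fun x => efun L m x * phi x) + e / 2.
  by apply: h2; rewrite lerDl.
apply: le_trans h1 _; rewrite -lerBrDr; apply: le_trans h2 _.
by rewrite -addrA lerD2l lerBrDr -splitr.
Qed.

Lemma cvg_invn (x : nat -> R) (l : R) : (forall k, `|x k - l| < k.+1%:R^-1) ->
  x k @[k --> \oo] --> l.
Proof.
move=> h; apply/cvgrPdist_lt => e e0.
apply: filterS (near_infty_natSinv_lt (PosNum e0)) => k /= hk.
by rewrite distrC; exact: lt_trans (h k) hk.
Qed.

(** By contradiction: counterexamples for tolerances tending to 0 are boosted to have a large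
    coefficient at 0 and converge along an ultrafilter to a profile; the inverse boost of the
    profile is a maximiser close to one of them. *)
Lemma compactness_trig (m e : R) : 0 < m -> 0 < e -> exists2 dl : R, 0 < dl &
  forall s c, uniq s -> `|mass s c - m| < dl -> M * m ^+ 2 - dl < qform L s c ->
  exists phi, [/\ L2per L phi, massu L phi = m, Qu L phi = M * m ^+ 2 &
    massu L (fun x => trig L s c x - phi x) < e].
Proof.
move=> m0 e0; apply: contrapT => nex.
have M0 : 0 < M := lt_trans (ltr0n R 2) M2.
have [eta eta0 [dl dl0 nonv]] := nonvanishing L0 M2 m0.
pose d k : R := Num.min dl k.+1%:R^-1.
have d0 k : 0 < d k by rewrite lt_min dl0 invr_gt0 ltr0Sn.
have H k : exists sc : seq int * (int -> R[i]), [/\ uniq sc.1,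
    `|mass sc.1 sc.2 - m| < d k, M * m ^+ 2 - d k < qform L sc.1 sc.2 &
    forall phi, L2per L phi -> massu L phi = m -> Qu L phi = M * m ^+ 2 ->
      e <= massu L (fun x => trig L sc.1 sc.2 x - phi x)].
  apply: contrapT => nk; apply: nex; exists (d k) => // s c us h1 h2.
  apply: contrapT => nphi; apply: nk; exists (s, c); split => // phi Lphi m1 q1.
  by rewrite leNgt; apply/negP => h; apply: nphi; exists phi.
have [f Hf] := choice H.
have H2 k : exists n, eta < csq ((f k).2 n) /\ n \in (f k).1.
  have [us h1 h2 _] := Hf k.
  (* [nonvanishing] could point outside the list, where the coefficients do not enter the
     polynomial; they are set to 0 there. *)
  pose c' n := if n \in (f k).1 then (f k).2 n else 0.
  have e' : trig L (f k).1 (f k).2 = trig L (f k).1 c' by apply: eq_trig => n ns; rewrite /c' ns.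
  have hd : d k <= dl by rewrite ge_min lexx.
  have [||n] := nonv (f k).1 c' us.
  - by rewrite -(massu_trig L0 _ us) -e' massu_trig//; exact: lt_le_trans hd.
  - by rewrite -(Qu_trig L0 _ us) -e' Qu_trig//; apply: le_lt_trans h2; rewrite lerD2l lerN2.
  by rewrite /c'; case: ifPn => [ns h|_]; [exists n | rewrite csq0 ltNge (ltW eta0)].
have [nn Hn] := choice H2.
pose D k n := if n \in (f k).1 then (f k).2 n else 0.
pose S k := [seq n - nn k | n <- (f k).1].
pose C k n := D k (n + nn k).
have uS k : uniq (S k).
  by have [us _ _ _] := Hf k; rewrite map_inj_uniq//; exact: addIr.
have CS k n : n \notin S k -> C k n = 0.
  move=> nS; rewrite /C /D; case: ifP => // h; case/negP: nS.
  by apply/mapP; exists (n + nn k) => //; rewrite addrK.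
have tS k x : trig L (f k).1 (f k).2 x = efun L (nn k) x * trig L (S k) (C k) x.
  rewrite -trig_boost /S -map_comp.
  have -> : [seq ((fun n => n + nn k) \o (fun n => n - nn k)) i | i <- (f k).1] = (f k).1.
    by rewrite -[RHS]map_id; apply: eq_map => n /=; rewrite subrK.
  congr (_ x); apply: eq_trig => n ns.
  by rewrite /C subrK /D ns.
have Lt k := L2per_trig L0 (S k) (C k).
have mS k : mass (S k) (C k) = mass (f k).1 (f k).2.
  have [us _ _ _] := Hf k.
  rewrite -(massu_trig L0 _ us) -(massu_trig L0 _ (uS k)) -(massu_efun (nn k) (Lt k)).
  by congr massu; apply/funext => x; rewrite tS.
have qS k : qform L (S k) (C k) = qform L (f k).1 (f k).2.
  have [us _ _ _] := Hf k.
  rewrite -(Qu_trig L0 _ us) -(Qu_trig L0 _ (uS k)) -(Qu_trig_boost _ (nn k) (uS k)).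
  by congr Qu; apply/funext => x; rewrite tS.
have dk k : d k <= k.+1%:R^-1 by rewrite ge_min lexx orbT.
have [U [UF sU]] := ultraFilterLemma (F := \oo) _.
have cm : mass (S k) (C k) @[k --> \oo] --> m.
  apply: cvg_invn => k; rewrite mS; have [_ h _ _] := Hf k.
  exact: lt_le_trans h (dk k).
have cq : qform L (S k) (C k) @[k --> \oo] --> M * m ^+ 2.
  have c1 : M * m ^+ 2 - k.+1%:R^-1 @[k --> \oo] --> M * m ^+ 2.
    rewrite -[X in _ --> X]subr0; apply: cvgB; first exact: cvg_cst.
    exact: cvg_harmonic.
  have c2 : M * (mass (S k) (C k) * mass (S k) (C k)) @[k --> \oo] --> M * m ^+ 2.
    by rewrite expr2; apply: cvgMl_tmp; exact: cvgM.
  apply: squeeze_cvgr c1 c2; apply: nearW => k; apply/andP; split.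
    rewrite qS; have [_ _ h _] := Hf k; apply/ltW; apply: le_lt_trans h.
    by rewrite lerD2l lerN2.
  by rewrite -expr2; apply: qform_le_qM.
have toU (x : nat -> R) (l : R) : x k @[k --> \oo] --> l -> x k @[k --> U] --> l.
  by move=> h A /h hA; apply: sU.
have Ceta k : eta < csq (C k 0).
  by rewrite /C add0r /D; have [h ns] := Hn k; rewrite ns.
have mB k : mass (S k) (C k) <= m + dl.
  have [_ h _ _] := Hf k; rewrite mS.
  have := lt_le_trans h (_ : d k <= dl); rewrite ge_min lexx ltr_norml => /(_ isT).
  by move=> /andP[_]; lra.
have [b Cb] := coef_limit UF CS mB.
have [phi [Lphi mphi qphi cphi]] :=
  limit_profile L0 M2 UF uS CS (toU _ _ cm) (toU _ _ cq) eta0 Ceta Cb.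
have [k hk] : exists k, massu L (fun x => trig L (S k) (C k) x - phi x) < e.
  exact: filter_ex (cvgr_lt _ cphi _ e0).
have [_ _ _ bad] := Hf k.
have Lb := L2per_boost (nn k) Lphi.
have mb : massu L (fun x => efun L (nn k) x * phi x) = m by rewrite massu_efun.
have qb : Qu L (fun x => efun L (nn k) x * phi x) = M * m ^+ 2.
  apply/eqP; rewrite eq_le; apply/andP; split.
    by rewrite -[in leRHS]mb; exact: Qu_le_qM.
  by rewrite -qphi; exact: Qu_boost_ge.
have := bad _ Lb mb qb; rewrite leNgt => /negP; apply.
have -> : (fun x => trig L (f k).1 (f k).2 x - efun L (nn k) x * phi x) =
  (fun x => efun L (nn k) x * (trig L (S k) (C k) x - phi x)).
  by apply/funext => x; rewrite tS mulrBr.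
by rewrite massu_efun//; exact: L2perB.
Qed.

(** Truncating the Fourier series reduces to [compactness_trig]; [Qu_uniform] bounds what the form
    loses. *)
Lemma compactness (m e : R) : 0 < m -> 0 < e -> exists2 dl : R, 0 < dl &
  forall u, L2per L u -> `|massu L u - m| < dl -> M * m ^+ 2 - dl < Qu L u ->
  exists phi, [/\ L2per L phi, massu L phi = m, Qu L phi = M * m ^+ 2 &
    massu L (fun x => u x - phi x) < e].
Proof.
move=> m0 e0; have [dt dt0 H] := compactness_trig m0 (divr_gt0 e0 (ltr0n R 4)).
have A0 : 0 < m + dt by rewrite addr_gt0.
have [dq dq0 HQ] := Qu_uniform A0 (divr_gt0 dt0 (ltr0n R 2)).
exists (dt / 2); first by rewrite divr_gt0.
move=> u Lu; rewrite ltr_norml => /andP[u1 u2] qu.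
pose d := Num.min (e / 4) (Num.min dq (dt / 2)).
have d0 : 0 < d by rewrite !lt_min dq0 !divr_gt0.
have [N /(_ N (leqnn _))] := massu_parseval L0 Lu d0.
rewrite -massu_truncE//; set p := trig L _ _ => hN.
have Lp : L2per L p by exact: L2per_trig.
have mE := massu_truncE L0 N Lu; rewrite -/p in mE.
have w0 := massu_ge0 L0 (fun x => u x - p x).
move: hN; rewrite !lt_min => /and3P[h1 h2 h3].
have pm : massu L p = msum (fourier L u) N by rewrite massu_trig ?zrange_uniq.
have h4 : `|mass (zrange N) (fourier L u) - m| < dt.
  by rewrite -msumE ltr_norml; apply/andP; split; lra.
have pA : massu L p <= m + dt by rewrite pm; lra.
have := HQ _ _ Lu Lp pA h2; rewrite (Qu_trig L0 _ (zrange_uniq N)) => h5.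
have h6 : M * m ^+ 2 - dt < qform L (zrange N) (fourier L u) by lra.
have [phi [Lphi m1 q1 h7]] := H _ _ (zrange_uniq N) h4 h6.
exists phi; split => //.
have := massuD_le L0 (L2perB Lu Lp) (L2perB Lp Lphi).
have -> : (fun x => u x - p x + (p x - phi x)) = (fun x => u x - phi x).
  by apply/funext => x; rewrite addrA subrK.
move/le_lt_trans; apply; have -> : e = 2 * (e / 4) + 2 * (e / 4) by field.
by apply: ltrD; rewrite ltr_pM2l.
Qed.

(** A nearly optimal polynomial of mass 1 is scaled by sqrt m; [compactness_trig], here at tolerance
    1, returns an exact maximiser. *)
Lemma maximizer_exists (m : R) : 0 < m -> exists phi,
  [/\ L2per L phi, massu L phi = m & Qu L phi = M * m ^+ 2].
Proof.
move=> m0; have [dl dl0 H] := compactness_trig m0 ltr01.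
have m20 : 0 < m ^+ 2 by rewrite exprn_gt0.
have [s [c [us m1 qc]]] := qM_approx L0 (divr_gt0 dl0 m20).
have [||phi [h1 h2 h3 _]] := H s (fun n => (Num.sqrt m)%:C * c n) us; last by exists phi.
  by rewrite massZ m1 mulr1 csq_real sqr_sqrtr ?(ltW m0)// subrr normr0.
rewrite qformZ// csq_real sqr_sqrtr ?(ltW m0)//.
rewrite -(ltr_pM2l m20) in qc.
by move: qc; rewrite mulrBr mulrCA divff ?mulr1 ?(gt_eqF m20)// mulrC.
Qed.

End Compactness.

(** * Conservation laws and stability *)

Section Conservation.
Context {R : realType}.
Local Notation mu := (@lebesgue_measure R).
Variable L : R.
Hypothesis L0 : 0 < L.
Local Notation M := (qM L).
Hypothesis M2 : 2 < M.
Implicit Types (u v g phi : R -> R[i]) (F : (R -> R[i]) -> R).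

Lemma cvg_dnbhs0P (f : R -> R) (l : R) : f h @[h --> (0 : R)^'] --> l ->
  forall e, 0 < e -> exists2 d : R, 0 < d &
    forall h, h != 0 -> `|h| < d -> `|f h - l| < e.
Proof.
move=> /cvgrPdistC_lt fl e e0; have := fl e e0.
move=> [d /= d0 hd]; exists d => // h h0 hh.
by apply: hd => //=; rewrite sub0r normrN.
Qed.

Lemma little_oh_derive0 (f : R -> R) (t : R) :
  (forall e, 0 < e -> exists2 d : R, 0 < d &
    forall h, h != 0 -> `|h| < d -> `|f (t + h) - f t| <= e * `|h|) ->
  is_derive t (1 : R) f 0.
Proof.
move=> H.
have c0 : h^-1 *: ((f \o shift t) (h *: 1) - f t) @[h --> (0 : R)^'] --> (0 : R).
  apply/cvgr0Pnorm_le => e e0; have [d d0 hd] := H e e0.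
  rewrite /dnbhs /within /=; exists d => //= h /= hh h0.
  rewrite sub0r normrN in hh.
  rewrite /GRing.scale /= mulr1 normrM normfV mulrC ler_pdivrMr ?normr_gt0//.
  by rewrite [h + t]addrC hd.
apply: DeriveDef; last exact: cvg_lim c0.
by apply/cvg_ex; exists 0.
Qed.

(* [F] is controlled under perturbations of relative size [h]: the Young
   inequality with parameter [eta * |h|]. *)
Definition perturbable F := forall eta : R, 0 < eta -> eta <= 1 -> exists2 kp : R, 0 < kp &
  forall (h : R) u v, h != 0 -> `|h| <= 1 -> L2per L u -> L2per L v -> massu L v <= kp ->
    F (fun x => u x + h%:C * v x) <= (1 + 7 * (eta * `|h|)) * F u + eta * `|h|.

(** kp = eta^2/2 balances the factor 1/(eta |h|) of Young's inequality against the h^2 of the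
    perturbation. *)
Lemma massu_perturbable : perturbable (massu L).
Proof.
move=> eta e0 e1; exists (eta ^+ 2 / 2); first by rewrite divr_gt0// exprn_gt0.
move=> h u v h0 h1 Lu Lv vk.
have hp : 0 < `|h| by rewrite normr_gt0.
have s0 : 0 < eta * `|h| by rewrite mulr_gt0.
have := massuD_young L0 s0 Lu (L2perZ h%:C Lv); rewrite massuZ// csq_real.
move/le_trans; apply; apply: lerD.
  by rewrite ler_wpM2r ?massu_ge0//; lra.
rewrite -real_normK ?num_real//.
have s1 : eta * `|h| <= 1 by rewrite mulr_ile1// ltW.
have h2 : 1 + (eta * `|h|)^-1 <= 2 * (eta * `|h|)^-1.
  by rewrite mulr_natl mulr2n lerD2r invf_ge1.
have m0 := massu_ge0 L0 v.
apply: (@le_trans _ _ (2 * (eta * `|h|)^-1 * (`|h| ^+ 2 * (eta ^+ 2 / 2)))).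
  apply: ler_pM => //; last by rewrite ler_pM2l// exprn_gt0.
    by rewrite addr_ge0// invr_ge0 ltW.
  by rewrite mulr_ge0// exprn_ge0.
rewrite le_eqVlt; apply/orP; left; apply/eqP; field.
by rewrite !gt_eqF.
Qed.

Lemma Qu_perturbable : perturbable (Qu L).
Proof.
move=> eta e0 e1; have M0 : 0 < M := lt_trans (ltr0n R 2) M2.
(* The Young term 8 (eta |h|)^-3 h^4 Q(v) becomes at most eta |h|; kp <= 1 lets M m(v)^2 be bounded
   by M m(v). *)
pose kp := Num.min 1 (eta ^+ 4 / (8 * M)).
have kp0 : 0 < kp by rewrite lt_min ltr01 divr_gt0 ?exprn_gt0// mulr_gt0.
exists kp => // h u v h0 h1 Lu Lv vk.
have hp : 0 < `|h| by rewrite normr_gt0.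
have s0 : 0 < eta * `|h| by rewrite mulr_gt0.
have s1 : eta * `|h| <= 1 by rewrite mulr_ile1// ltW.
have := Qu_young L0 s0 s1 Lu (L2perZ h%:C Lv); rewrite QuZ// csq_real.
move/le_trans; apply; rewrite lerD2l -(real_normK (num_real h)).
have q1 : Qu L v <= M * (eta ^+ 4 / (8 * M)).
  apply: le_trans (Qu_le_qM L0 M2 Lv) _; rewrite ler_pM2l// expr2.
  have m0 := massu_ge0 L0 v.
  have v1 : massu L v <= 1 by apply: le_trans vk _; rewrite ge_min lexx.
  have v2 : massu L v <= eta ^+ 4 / (8 * M) by apply: le_trans vk _; rewrite ge_min lexx orbT.
  by rewrite -[leRHS]mul1r; apply: ler_pM.
apply: (@le_trans _ _ (8 * (eta * `|h|) ^- 3 * ((`|h| ^+ 2) ^+ 2 * (M * (eta ^+ 4 / (8 * M)))))).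
  rewrite ler_pM2l ?mulr_gt0 ?invr_gt0 ?exprn_gt0//.
  by rewrite ler_pM2l ?exprn_gt0.
rewrite le_eqVlt; apply/orP; left; apply/eqP; field.
by rewrite !gt_eqF.
Qed.

(** The derivative of F at u vanishes in the direction -i g, which is the velocity of the flow when
    g is the gradient. *)
Definition stationary F u g := forall e, 0 < e -> exists2 d : R, 0 < d &
  forall h, h != 0 -> `|h| < d ->
    `|F (fun x => u x + h%:C * (- 'i%C * g x)) - F u| <= e * `|h|.

Lemma L2normE_massu u : L2norm L u = Num.sqrt (L * massu L u).
Proof. by rewrite L2normE /massu mulrA divff ?mul1r// gt_eqF. Qed.

(** u(t + h) = b + h r, where b is the Euler step u(t) - i h g and r is small in norm. Stationarity
    compares F(b) with F(u(t)); perturbability, used from b to u(t + h) and back, bounds the rest on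
    both sides. The derivative of F along the solution is thus zero. *)
Lemma conserved F u0 (u : R -> R -> R[i]) : (forall v, 0 <= F v) -> perturbable F ->
  (forall v g, L2per L v -> is_gradH L v g -> stationary F v g) ->
  is_solution L u0 u -> forall t, F (u t) = F (u 0).
Proof.
move=> F0 pF sF [Lu _ du] t.
apply: (@is_derive_0_is_cst _ (fun t => F (u t))) => {}t.
apply: little_oh_derive0 => e e0.
have [g gg dg] := du t; have [Lg _] := gg.
set A := F (u t); have A0 : 0 <= A by exact: F0.
(* A generous bound for the constants accumulated by the three comparisons. *)
pose K := 200 * (A + 1).
have K0 : 0 < K by apply: mulr_gt0; [exact: ltr0n | exact: ltr_wpDl].
pose eta := Num.min 1 (e / K).
have et0 : 0 < eta by rewrite lt_min ltr01 divr_gt0.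
have et1 : eta <= 1 by rewrite ge_min lexx.
have et2 : eta * K <= e by rewrite -ler_pdivlMr// ge_min lexx orbT.
have [kp kp0 Hkp] := pF eta et0 et1.
have [d1 d10 hd1] := sF _ _ (Lu t) gg eta et0.
have lk0 : 0 < Num.sqrt (L * kp) by rewrite sqrtr_gt0 mulr_gt0.
have [d2 d20 hd2] := cvg_dnbhs0P dg lk0.
exists (Num.min 1 (Num.min d1 d2)); first by rewrite !lt_min ltr01 d10 d20.
move=> h h0; rewrite !lt_min => /and3P[h1 hh1 hh2].
have := hd2 h h0 hh2; rewrite subr0 L2normE_massu ger0_norm ?sqrtr_ge0//.
set r := fun x => _; rewrite ltr_sqrt ?mulr_gt0// ltr_pM2l// => rk.
pose G x := - 'i%C * g x; pose b x := u t x + h%:C * G x.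
have LG : L2per L G by exact: L2perZ.
have Lb : L2per L b := L2perD (Lu t) (L2perZ _ LG).
have Lr : L2per L r := L2perB (L2perZ _ (L2perB (Lu _) (Lu t))) LG.
have hC : h%:C * (h^-1)%:C = 1 :> R[i] by rewrite -rmorphM/= divff.
have e1 : u (t + h) = (fun x => b x + h%:C * r x).
  apply/funext => x; transitivity (u t x + h%:C * (h^-1)%:C * (u (t + h) x - u t x)).
    by rewrite hC; ring.
  by rewrite /b /r /G; ring.
have e2 : b = (fun x => u (t + h) x + h%:C * ((-1) * r x)).
  by apply/funext => x; rewrite e1 mulN1r mulrN addrK.
have rk' : massu L (fun x => (-1) * r x) <= kp.
  by rewrite massuZ// csqN (_ : 1 = (1 : R)%:C)// csq_real expr1n mul1r ltW.
have i1 := Hkp h b r h0 (ltW h1) Lb Lr (ltW rk).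
have i2 := Hkp h (u (t + h)) (fun x => (-1) * r x) h0 (ltW h1) (Lu _) (L2perZ _ Lr) rk'.
have i3 := hd1 h h0 hh1.
rewrite -e1 in i1; rewrite -e2 in i2; rewrite -/b -/A in i3.
move: (F (u (t + h))) (F b) (F0 (u (t + h))) (F0 b) i1 i2 i3 => x y x0 y0 i1 i2 i3.
have hp : 0 <= `|h| by exact: normr_ge0.
move: i3; rewrite ler_norml => /andP[i3 i4].
apply: (@le_trans _ _ (eta * K * `|h|)); last by rewrite ler_wpM2r.
set z := eta * `|h| in i1 i2 i3 i4.
have z0 : 0 <= z by rewrite mulr_ge0// ltW.
have z1 : z <= 1 by rewrite mulr_ile1// ltW.
have -> : eta * K * `|h| = z * (200 * (A + 1)) by rewrite /z /K; ring.
have zA : 0 <= z * A by rewrite mulr_ge0.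
clearbody A z; clear -A0 x0 y0 i1 i2 i3 i4 z0 z1 zA.
have y1 : y <= A + 1 by lra.
have zy : z * y <= z * (A + 1) by rewrite ler_wpM2l.
have zz : z * (A + 1) <= A + 1 by rewrite ler_piMl// addr_ge0.
have x1 : x <= 8 * (A + 1) + 1 by lra.
have zx : z * x <= z * (8 * (A + 1) + 1) by rewrite ler_wpM2l.
by rewrite ler_norml; apply/andP; split; lra.
Qed.

Lemma csq_imag (a : R) : csq (0 +i* a) = a ^+ 2.
Proof. by rewrite /csq /= expr0n add0r. Qed.

(* H((1 + i a e) u) = (1 + a^2 e^2)^2 H(u) has zero derivative at e = 0. *)
Lemma gradH_phase_orth u g (a : R) : L2per L u -> is_gradH L u g ->
  L2inner L g (fun x => (0 +i* a) * u x) = 0.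
Proof.
move=> Lu [Lg dH]; have Lv := L2perZ (0 +i* a) Lu.
have := dH _ Lv; set l := L2inner _ _ _ => cl.
apply/eqP/negP => /negP l0.
have e20 : 0 < `|l| / 2 by rewrite divr_gt0// normr_gt0.
have [d d0 hd] := cvg_dnbhs0P cl e20.
pose q := 2 * pi * Qu L u.
have q0 : 0 <= q by rewrite mulr_ge0 ?Qu_ge0// mulr_ge0// pi_ge0.
have a20 : 0 <= a ^+ 2 by exact: sqr_ge0.
have a40 : 0 <= a ^+ 4 by rewrite exprn_even_ge0.
pose K := q * (2 * a ^+ 2 + a ^+ 4).
have K0 : 0 <= K by rewrite /K mulr_ge0// addr_ge0// mulr_ge0.
pose e := Num.min (d / 2) (Num.min 1 (`|l| / 2 / (K + 1))).
have K1 : 0 < K + 1 by rewrite ltr_wpDl.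
have e0 : 0 < e by rewrite !lt_min ltr01 !divr_gt0// normr_gt0.
have ed : `|e| < d by rewrite gtr0_norm// gt_min; apply/orP; left; rewrite ltr_pdivrMr// ltr_pMr// ltrDl.
have e1 : e <= 1 by rewrite !ge_min lexx !orbT.
have e2 : e * (K + 1) <= `|l| / 2 by rewrite -ler_pdivlMr// !ge_min lexx !orbT.
have := hd e (lt0r_neq0 e0) ed.
have -> : (fun x => u x + e%:C * ((0 +i* a) * u x)) = (fun x => (1 + e%:C * (0 +i* a)) * u x).
  by apply/funext => x; ring.
rewrite (H_Qu L0 (L2perZ _ Lu)) (H_Qu L0 Lu) QuZ//.
have -> : csq (1 + e%:C * (0 +i* a)) = 1 + (e * a) ^+ 2 by rewrite /csq /=; ring.
set X := _ / e; have -> : X = - (q * (2 * a ^+ 2 + e ^+ 2 * a ^+ 4)) * e.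
  by rewrite /X /q; field; rewrite gt_eqF.
set Y := q * _.
have e22 : 0 <= e ^+ 2 <= 1 by rewrite sqr_ge0 exprn_ile1// ltW.
have Y0 : 0 <= Y <= K.
  case/andP: e22 => e22 e23; rewrite /Y mulr_ge0//=; last first.
    by rewrite addr_ge0// mulr_ge0.
  by rewrite /K ler_wpM2l// lerD2l ler_piMl.
have : e * Y <= e * K by rewrite ler_pM2l//; case/andP: Y0.
have := ler_normD (- Y * e - l) (Y * e).
have -> : - Y * e - l + Y * e = - l by ring.
have Ye : 0 <= Y * e by rewrite mulr_ge0 ?(ltW e0)//; case/andP: Y0.
rewrite normrN [`|Y * e|]ger0_norm//.
move: (`|l|) (`|_ - l|) e20 e2 => a1 a2; lra.
Qed.

(** The first-order term pairs u with i g and vanishes by [gradH_phase_orth]; only h^2 times the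
    mass of g remains. *)
Lemma massu_stationary u g : L2per L u -> is_gradH L u g -> stationary (massu L) u g.
Proof.
move=> Lu gg e e0; have [Lg _] := gg.
pose d := e / (massu L g + 1).
have m0 := massu_ge0 L0 g; have m1 : 0 < massu L g + 1 by rewrite ltr_wpDl.
exists d; first by rewrite divr_gt0.
move=> h h0 hd.
have LG : L2per L (fun x => (0 +i* h) * g x) by exact: L2perZ.
have -> : (fun x => u x + h%:C * (- 'i%C * g x)) = (fun x => u x - (0 +i* h) * g x).
  apply/funext => x; have -> : (0 +i* h) = h%:C * 'i%C :> R[i].
    by rewrite /GRing.mul /=; congr (_ +i* _); ring.
  ring.
have -> : massu L (fun x => u x - (0 +i* h) * g x) = massu L u + h ^+ 2 * massu L g.
  rewrite -csq_imag -massuZ// /massu sqnB_cip// -mulrDr.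
  have -> : complex.Re (cip L u (fun x => (0 +i* h) * g x)) = 0; last by rewrite mulr0 subr0.
  transitivity (L2inner L g (fun x => (0 +i* - h) * u x)); last exact: gradH_phase_orth.
  rewrite -[RHS]/(complex.Re (cip L g _)) !Re_cipE.
  apply: eq_Rintegral => x _; case: (u x) (g x) => [a b] [a' b'] /=; ring.
rewrite addrC addKr ger0_norm; last exact: mulr_ge0 (sqr_ge0 _) m0.
rewrite -real_normK ?num_real// expr2 -mulrA mulrC ler_wpM2r//.
apply: (@le_trans _ _ (d * (massu L g + 1))); last by rewrite divfK// gt_eqF.
by apply: ler_pM => //; [exact: ltW | rewrite lerDl].
Qed.

(** The derivative of H along -i g is the real inner product of g with -i g, which is zero. *)
Lemma Qu_stationary u g : L2per L u -> is_gradH L u g -> stationary (Qu L) u g.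
Proof.
move=> Lu [Lg dH] e e0; have LG : L2per L (fun x => - 'i%C * g x) by exact: L2perZ.
have p2 : 0 < 2 * pi :> R by rewrite mulr_gt0// pi_gt0.
have z0 : L2inner L g (fun x => - 'i%C * g x) = 0.
  rewrite -[LHS]/(complex.Re (cip L g _)) Re_cipE.
  transitivity (\int[mu]_(x in `[0, L]) (0 : R)).
    by apply: eq_Rintegral => x _; case: (g x) => [a b] /=; ring.
  by rewrite /Rintegral integral0.
have := dH _ LG; rewrite z0 => cl.
have [d d0 hd] := cvg_dnbhs0P cl (mulr_gt0 p2 e0).
exists d => // h h0 hh; have := hd h h0 hh.
rewrite subr0 (H_Qu L0 (L2perD Lu (L2perZ _ LG))) (H_Qu L0 Lu) -mulrBr normrM normfV.
rewrite ltr_pdivrMr ?normr_gt0// normrM normrN (gtr0_norm p2) -[2 * pi * e * _]mulrA ltr_pM2l//.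
exact: ltW.
Qed.

Lemma massu_conserved u0 (u : R -> R -> R[i]) t : is_solution L u0 u ->
  massu L (u t) = massu L (u 0).
Proof.
move=> su; apply: (conserved _ massu_perturbable _ su); last exact: massu_stationary.
exact: massu_ge0.
Qed.

Lemma Qu_conserved u0 (u : R -> R -> R[i]) t : is_solution L u0 u ->
  Qu L (u t) = Qu L (u 0).
Proof.
move=> su; apply: (conserved _ Qu_perturbable _ su); last exact: Qu_stationary.
exact: Qu_ge0.
Qed.

(** Prescribing P fixes the mass m = 2 lambda / L, and the infimum of H is then -2 pi M m^2,
    attained by [maximizer_exists]. *)
Lemma ground_statesP (lambda : R) phi : 0 < lambda -> ground_states L lambda phi <->
  [/\ L2per L phi, massu L phi = 2 * lambda / L & Qu L phi = M * (2 * lambda / L) ^+ 2].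
Proof.
move=> l0; set m := 2 * lambda / L.
have m0 : 0 < m by rewrite divr_gt0// mulr_gt0.
have p2 : 0 < 2 * pi :> R by rewrite mulr_gt0// pi_gt0.
have PE' u : P L u = lambda <-> massu L u = m.
  rewrite P_massu// /m; split => [<-|->]; field; rewrite gt_eqF//.
set E := [set (H L u)%:E | u in [set u | L2per L u /\ P L u = lambda]].
have HE : ereal_inf E = (- (2 * pi) * (M * m ^+ 2))%:E.
  apply/eqP; rewrite eq_le; apply/andP; split.
    have [psi [Lpsi m1 q1]] := maximizer_exists L0 M2 m0.
    by apply: ereal_inf_lbound; exists psi; [split => //; exact/PE' | rewrite H_Qu// q1].
  apply: le_ereal_inf_tmp => _ [v [Lv /PE' mv] <-].
  rewrite lee_fin H_Qu// !mulNr lerN2 ler_pM2l// -mv; exact: Qu_le_qM.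
rewrite /ground_states /=; split => [[Lphi /PE' mphi]|[Lphi mphi qphi]].
  rewrite HE H_Qu// => -[] /(mulfI _) qE; split => //; apply: qE.
  by rewrite oppr_eq0 gt_eqF.
by split => //; [exact/PE' | rewrite HE H_Qu// qphi].
Qed.

End Conservation.

(** * Stability of the set of ground states *)

Section Stability.
Context {R : realType}.
Variable L : R.
Hypothesis L0 : 0 < L.
Local Notation mu := (@lebesgue_measure R).
Local Notation M := (qM L).
Hypothesis M2 : 2 < M.
Implicit Types (u v phi : R -> R[i]) (S : set (R -> R[i])).

Lemma L2norm_lt u (e : R) : 0 < e -> (L2norm L u < e) = (massu L u < e ^+ 2 / L).
Proof.
move=> e0; rewrite L2normE_massu// ltr_pdivlMr// mulrC.
rewrite -[in LHS](@gtr0_norm _ e)// -sqrtr_sqr ltr_sqrt ?exprn_gt0//.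
Qed.

(** Nonemptiness matters: the real infimum of the empty set is 0 by convention. *)
Lemma L2dist_lt u S (e : R) : 0 < e -> S !=set0 ->
  L2dist L u S < e <-> exists2 phi, S phi & massu L (fun x => u x - phi x) < e ^+ 2 / L.
Proof.
move=> e0 [psi Spsi]; rewrite /L2dist; split => [|[phi Sphi]].
  move/inf_lt => -[|_ [phi Sphi <-]]; last by rewrite L2norm_lt//; exists phi.
  by exists (L2norm L (fun x => u x - psi x)), psi.
rewrite -L2norm_lt//; apply: le_lt_trans; apply: ge_inf.
  by exists 0 => _ [v _ <-]; exact: sqrtr_ge0.
by exists phi.
Qed.

(** The case h = 1 of the estimate behind conservation, read as continuity on sets where F is
    bounded. *)
Lemma perturbable_uniform (F : (R -> R[i]) -> R) (A e : R) : (forall u, 0 <= F u) ->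
  perturbable L F -> 0 < A -> 0 < e -> exists2 dl : R, 0 < dl &
  forall u v, L2per L u -> L2per L v -> F v <= A ->
    massu L (fun x => u x - v x) <= dl -> F u <= F v + e.
Proof.
move=> F0 pF A0 e0; pose eta := Num.min 1 (e / (7 * A + 1)).
have k0 : 0 < 7 * A + 1 by lra.
have et0 : 0 < eta by rewrite lt_min ltr01 divr_gt0.
have et1 : eta <= 1 by rewrite ge_min lexx.
have et2 : eta * (7 * A + 1) <= e by rewrite -ler_pdivlMr// ge_min lexx orbT.
have [kp kp0 H] := pF eta et0 et1; exists kp => // u v Lu Lv vA h.
have := H 1 v _ (oner_neq0 _) _ Lv (L2perB Lu Lv) h.
rewrite normr1 lexx mulr1 => /(_ isT).
have -> : (fun x => v x + 1%:C * (u x - v x)) = u.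
  by apply/funext => x; rewrite mul1r addrC subrK.
move/le_trans; apply.
have : eta * F v <= eta * A by rewrite ler_pM2l.
move: (F v) (F0 v) => y y0; lra.
Qed.

Lemma massu_ae u v w : L2per L u -> L2per L v -> L2per L w ->
  {ae mu, forall x, u x = v x} ->
  massu L (fun x => u x - w x) = massu L (fun x => v x - w x).
Proof.
move=> Lu Lv Lw uv; rewrite /massu; congr (_ * fine _); apply: sqn_ae.
- exact: L2per_meas (L2perB Lu Lw).
- exact: L2per_meas (L2perB Lv Lw).
- by apply: (aeS uv) => x /= -> _.
Qed.

Lemma ground_states_nonempty (lambda : R) : 0 < lambda -> ground_states L lambda !=set0.
Proof.
move=> l0; have m0 : 0 < 2 * lambda / L by rewrite divr_gt0// mulr_gt0.
have [phi H] := maximizer_exists L0 M2 m0.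
by exists phi; apply/ground_statesP.
Qed.

(** Mass and Q of u(0) are close to those of a ground state and are conserved, so [compactness]
    applies at every time; the ground state close to u(t) may change with t. *)
Lemma ground_states_stable (lambda eps : R) : 0 < lambda -> 0 < eps ->
  exists2 delta : R, 0 < delta &
    forall u0 : R -> R[i], L2per L u0 ->
    L2dist L u0 (ground_states L lambda) < delta ->
    forall u : R -> R -> R[i], is_solution L u0 u ->
    forall t : R, L2dist L (u t) (ground_states L lambda) < eps.
Proof.
move=> l0 e0; set m := 2 * lambda / L.
have m0 : 0 < m by rewrite divr_gt0// mulr_gt0.
have M0 : 0 < M := lt_trans (ltr0n R 2) M2.
have G0 := ground_states_nonempty l0.
have [dl dl0 comp] := compactness L0 M2 m0 (divr_gt0 (exprn_gt0 2 e0) L0).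
have dl20 : 0 < dl / 2 by rewrite divr_gt0.
have A0 : 0 < m + dl by rewrite addr_gt0.
have Q0 : 0 < M * (m + dl) ^+ 2 by rewrite mulr_gt0// exprn_gt0.
have [d1 d10 H1] := perturbable_uniform (@massu_ge0 R L L0)
  (massu_perturbable L0) A0 dl20.
have [d2 d20 H2] := perturbable_uniform (@Qu_ge0 R L L0) (Qu_perturbable L0 M2) Q0 dl20.
pose d := Num.min d1 d2.
have d0 : 0 < d by rewrite lt_min d10.
have sd : Num.sqrt (L * d) ^+ 2 / L = d.
  by rewrite sqr_sqrtr ?mulr_ge0 ?ltW// mulrC mulKf// gt_eqF.
have s0 : 0 < Num.sqrt (L * d) by rewrite sqrtr_gt0 mulr_gt0.
exists (Num.sqrt (L * d)) => // u0 Lu0 /(L2dist_lt _ s0 G0)[phi Gphi].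
rewrite sd => hphi u su t; have [Lu uu0 _] := su.
have /(ground_statesP L0 M2 phi l0)[Lphi mphi qphi] := Gphi.
rewrite -/m in mphi qphi.
rewrite -(massu_ae (Lu 0) Lu0 Lphi uu0) in hphi.
have h1 : massu L (fun x => u 0 x - phi x) <= d1.
  by apply: le_trans (ltW hphi) _; rewrite ge_min lexx.
have h2 : massu L (fun x => phi x - u 0 x) <= d1 by rewrite massuBC.
have h3 : massu L (fun x => phi x - u 0 x) <= d2.
  by rewrite massuBC; apply: le_trans (ltW hphi) _; rewrite ge_min lexx orbT.
have k1 : massu L (u 0) <= m + dl / 2.
  by rewrite -mphi; apply: H1 => //; rewrite mphi lerDl ltW.
have k1' : massu L (u 0) <= m + dl.
  by apply: le_trans k1 _; rewrite lerD2l ler_pdivrMr// ler_pMr// ler1n.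
have k2 : m <= massu L (u 0) + dl / 2 by rewrite -mphi; apply: H1.
have q1 : Qu L (u 0) <= M * (m + dl) ^+ 2.
  apply: le_trans (Qu_le_qM L0 M2 (Lu 0)) _; rewrite ler_pM2l//.
  by apply: lerXn2r => //; rewrite nnegrE ?massu_ge0// ltW.
have k3 : M * m ^+ 2 <= Qu L (u 0) + dl / 2 by rewrite -qphi; apply: H2.
have dl2 : dl / 2 < dl by rewrite ltr_pdivrMr// ltr_pMr// ltr1n.
have mt : `|massu L (u t) - m| < dl.
  rewrite (massu_conserved L0 t su) ltr_norml.
  apply/andP; split.
    by rewrite ltrBrDr addrC ltrBlDr (le_lt_trans k2)// ltrD2l.
  by rewrite ltrBlDl (le_lt_trans k1)// ltrD2l.
have qt : M * m ^+ 2 - dl < Qu L (u t).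
  by rewrite (Qu_conserved L0 M2 t su) ltrBlDr (le_lt_trans k3)// ltrD2l.
have [psi [Lpsi mpsi qpsi hpsi]] := comp _ (Lu t) mt qt.
have Gpsi : ground_states L lambda psi by apply/(ground_statesP L0 M2 psi l0).
exact: (L2dist_lt (u t) e0 G0).2 (ex_intro2 _ _ psi Gpsi hpsi).
Qed.

End Stability.

Theorem theorem6p2 (R : realType) :
  exists B4 : R, `|B4 - 260 / 100| <= 1 / 100 /\
  forall L : R, 2 * pi / Num.sqrt B4 < L ->
  forall lambda : R, 0 < lambda ->
    ground_states L lambda !=set0 /\
    forall eps : R, 0 < eps ->
    exists2 delta : R, 0 < delta &
      forall u0 : R -> R[i], L2per L u0 ->
      L2dist L u0 (ground_states L lambda) < delta ->
      forall u : R -> R -> R[i], is_solution L u0 u ->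
      forall t : R, 0 <= t ->
        L2dist L (u t) (ground_states L lambda) < eps.
Proof.
(* With this value the condition on L gives tau <= 2.59, the range covered by
   [qform_gt_resonant]. *)
exists (259 / 100); split; first by rewrite ler_norml; apply/andP; split; lra.
move=> L hL lambda l0.
have B0 : (0 : R) < 259 / 100 by clear; lra.
have s0 : 0 < Num.sqrt (259 / 100 : R) by rewrite sqrtr_gt0.
have p0 : 0 < 2 * pi :> R by rewrite mulr_gt0// pi_gt0.
have L0 : 0 < L by apply: lt_trans hL; rewrite divr_gt0.
have tau_le : tau L <= 259 / 100.
  rewrite -(sqr_sqrtr (ltW B0)) /tau /freq mulr1z mulr1.
  apply: lerXn2r; rewrite ?nnegrE ?divr_ge0 ?ltW//.
  by rewrite ltr_pdivrMr// [_ * L]mulrC -ltr_pdivrMr.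
have M2 := qM_gt2 L0 tau_le.
split; first exact: ground_states_nonempty.
move=> eps e0; have [delta d0 H] := ground_states_stable L0 M2 l0 e0.
by exists delta => // u0 Lu0 du u su t _; exact: H su t.
Qed.
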